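(* Let $S=\operatorname{Sys}(A,B,C)$ be a $(U,X,Y)$-relation such that $X$ has a Schauder subspace-basis adapted to $A$. Then there exists a finite-dimensional $(Y,W,U)$-relation $T=\operatorname{Sys}(E,F,G)$ such that $\operatorname{Close}(T\circ S)$ is exponentially stable if and only if $S$ is stabilizable, detectable, and has finite unstable part.
   Context: For Banach spaces $U,X,Y$, a $(U,X,Y)$-relation is any subset of $C^0(\mathbb{R}_{\ge 0},U)\times C^0(\mathbb{R}_{\ge 0},X)\times C^0(\mathbb{R}_{\ge 0},Y)$; elements $(u,x,y)$ are input, state, output; finite-dimensional means $\dim X<\infty$. For $A$ generating a strongly continuous semigroup $(e^{At})$ on $X$, bounded $B:U\to X$ and $C:\operatorname{Dom}(A)\to Y$ bounded in the graph norm, $\operatorname{Sys}(A,B,C)$ is the relation of all $(u,x,y)$ with $u\in C^0(\mathbb{R}_{\ge0},U)$, $x\in C^0(\mathbb{R}_{\ge0},\operatorname{Dom}(A))\cap C^1(\mathbb{R}_{\ge0},X)$, $y\in C^0(\mathbb{R}_{\ge0},Y)$, $\dot x=Ax+Bu$, $y=Cx$ (same conditions for $\operatorname{Sys}(E,F,G)$). $S_2\circ S_1$ (for a $(U_1,X_1,Y_1)$-relation $S_1$, $(Y_1,X_2,Y_2)$-relation $S_2$) is the relation of all $(u_1,(x_1,x_2),y_2)$ such that some $y_1$ has $(u_1,x_1,y_1)\in S_1$, $(y_1,x_2,y_2)\in S_2$. $S_1+S_2$ (same input/output spaces) consists of $(u,(x_1,x_2),y_1+y_2)$ with $(u,x_j,y_j)\in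 S_j$. $\operatorname{Close}(S)$ for a $(U,X,U)$-relation consists of all $(0,x,0)$ with $(u,x,u)\in S$ for some $u$. $S_1\cong S_2$ means a topological linear isomorphism $\phi$ of state spaces with $(u,x,y)\in S_1\iff(u,\phi\circ x,y)\in S_2$. Exponentially stable: $\exists\beta>0,M$ with $\|x(t)\|\le Me^{-\beta t}\|x(0)\|$ for all elements $(0,x,y)$ and $t\ge0$. Stabilizable: $\{x(0)\mid(u,x,y)\in S,\lim_{t\to\infty}\|x(t)\|=0\}$ dense in $X$. Detectable: every $(0,x,0)\in S$ has $\lim_{t\to\infty}\|x(t)\|=0$. Finite unstable part: $S\cong S_u+S_s$ with $S_u=\operatorname{Sys}(A_u,B_u,C_u)$ finite-dimensional, $S_s=\operatorname{Sys}(A_s,B_s,C_s)$ exponentially stable. A Schauder subspace-basis of $X$ is a countable family $\{X_j\}_{j\in\mathbb{N}}$ of finite-dimensional subspaces such that each $x\in X$ can be written uniquely as a convergent series $x=\sum_{j\in\mathbb{N}}x_j$ with $x_j\in X_j$; it is adapted to $A$ if each $X_j$ is $A$-invariant, i.e. $e^{At}X_j\subseteq X_j$ for all $t\ge0$. *)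

(* Defs.v *)
From HB Require Import structures.
From mathcomp Require Import all_boot all_order all_algebra.
From mathcomp Require Import all_classical all_reals all_analysis.
Set Implicit Arguments. Unset Strict Implicit. Unset Printing Implicit Defensive.
Import Order.TTheory GRing.Theory Num.Theory.
Import numFieldNormedType.Exports.
Local Open Scope classical_set_scope.
Local Open Scope ring_scope.

Section Defs.
Variable R : realType.

(* Time functions are modelled as functions R -> V; only their values on
   t >= 0 matter. *)
Definition cont0 {V : topologicalType} (f : R -> V) : Prop :=
  {within `[0%R, +oo[, continuous f}.

Definition is_deriv0 {V : normedModType R} (x x' : R -> V) : Prop :=
  forall t : R, 0 <= t ->
    (fun h : R => h^-1 *: (x (t + h) - x t))
      @ within (fun h : R => 0 <= t + h) (0%R)^' --> x' t.

Definition is_linear {V W : lmodType R} (f : V -> W) : Prop :=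
  forall (a : R) (u v : V), f (a *: u + v) = a *: f u + f v.

Definition bounded_linear {V W : normedModType R} (f : V -> W) : Prop :=
  is_linear f /\ continuous f.

Definition C0_semigroup {X : normedModType R} (T : R -> X -> X) : Prop :=
  [/\ forall t, 0 <= t -> bounded_linear (T t),
      forall x, T 0 x = x,
      forall s t x, 0 <= s -> 0 <= t -> T (s + t) x = T s (T t x)
    & forall x, cont0 (fun t => T t x)].

Definition generator {X : normedModType R} (D : set X) (A : X -> X)
    (T : R -> X -> X) : Prop :=
  C0_semigroup T /\
  forall x, (D x <-> exists l : X, (fun h : R => h^-1 *: (T h x - x)) @ (0%R)^'+ --> l)
         /\ (D x -> (fun h : R => h^-1 *: (T h x - x)) @ (0%R)^'+ --> A x).

Definition graph_bounded {X Y : normedModType R} (D : set X) (A : X -> X)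
    (C : X -> Y) : Prop :=
  (forall (a : R) u v, D u -> D v -> C (a *: u + v) = a *: C u + C v) /\
  exists M : R, forall x, D x -> `|C x| <= M * (`|x| + `|A x|).

Definition sys_data {U X Y : normedModType R} (D : set X) (A : X -> X)
    (B : U -> X) (C : X -> Y) : Prop :=
  [/\ exists T, generator D A T, bounded_linear B & graph_bounded D A C].

Definition relation (U X Y : Type) := set ((R -> U) * (R -> X) * (R -> Y)).

Definition Sys {U X Y : normedModType R} (D : set X) (A : X -> X)
    (B : U -> X) (C : X -> Y) : relation U X Y :=
  [set uxy | let: (u, x, y) := uxy in
    [/\ cont0 u,
        (forall t, 0 <= t -> D (x t)) /\ cont0 x /\ cont0 (fun t => A (x t)),
        (exists x', cont0 x' /\ is_deriv0 x x' /\
                    forall t, 0 <= t -> x' t = A (x t) + B (u t)),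
        cont0 y
      & forall t, 0 <= t -> y t = C (x t)]].

Definition comp_rel {U1 X1 Y1 X2 Y2 : Type} (S1 : relation U1 X1 Y1)
    (S2 : relation Y1 X2 Y2) : relation U1 (X1 * X2) Y2 :=
  [set uxy | let: (u1, x, y2) := uxy in
    exists y1, S1 (u1, (fun t => (x t).1), y1) /\ S2 (y1, (fun t => (x t).2), y2)].

Definition sum_rel {U X1 X2 Y : zmodType} (S1 : relation U X1 Y)
    (S2 : relation U X2 Y) : relation U (X1 * X2) Y :=
  [set uxy | let: (u, x, y) := uxy in
    exists y1 y2, S1 (u, (fun t => (x t).1), y1) /\ S2 (u, (fun t => (x t).2), y2)
                  /\ y = (fun t => y1 t + y2 t)].

Definition Close {U X : zmodType} (S : relation U X U) : relation U X U :=
  [set uxy | let: (u, x, y) := uxy in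
    u = (fun _ => 0) /\ y = (fun _ => 0) /\ exists v, S (v, x, v)].

Definition top_lin_iso {X1 X2 : normedModType R} (phi : X1 -> X2) : Prop :=
  bounded_linear phi /\ exists psi : X2 -> X1,
    continuous psi /\ cancel phi psi /\ cancel psi phi.

Definition rel_iso {U X1 X2 Y : normedModType R} (S1 : relation U X1 Y)
    (S2 : relation U X2 Y) : Prop :=
  exists phi : X1 -> X2, top_lin_iso phi /\
    forall u x y, S1 (u, x, y) <-> S2 (u, phi \o x, y).

Definition exp_stable {U X Y : normedModType R} (S : relation U X Y) : Prop :=
  exists beta : R, 0 < beta /\ exists M : R,
    forall x y, S ((fun _ => 0), x, y) ->
      forall t, 0 <= t -> `|x t| <= M * expR (- beta * t) * `|x 0|.

Definition stabilizable {U X Y : normedModType R} (S : relation U X Y) : Prop :=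
  dense [set z | exists u x y, S (u, x, y) /\
                   (fun t => `|x t|) @ +oo --> (0:R) /\ z = x 0].

Definition detectable {U X Y : normedModType R} (S : relation U X Y) : Prop :=
  forall x, S ((fun _ => 0), x, (fun _ => 0)) -> (fun t => `|x t|) @ +oo --> (0:R).

Definition findim_sub {X : lmodType R} (V : set X) : Prop :=
  exists (n : nat) (e : 'I_n -> X),
    forall x, V x <-> exists c : 'I_n -> R, x = \sum_(i < n) c i *: e i.

Definition findim (X : lmodType R) : Prop := findim_sub [set: X].

Definition finite_unstable_part {U X Y : normedModType R}
    (S : relation U X Y) : Prop :=
  exists (Xu Xs : completeNormedModType R)
         (Du : set Xu) (Au : Xu -> Xu) (Bu : U -> Xu) (Cu : Xu -> Y)
         (Ds : set Xs) (As : Xs -> Xs) (Bs : U -> Xs) (Cs : Xs -> Y),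
    [/\ findim Xu, sys_data Du Au Bu Cu, sys_data Ds As Bs Cs,
        exp_stable (Sys Ds As Bs Cs)
      & rel_iso S (sum_rel (Sys Du Au Bu Cu) (Sys Ds As Bs Cs))].

Definition schauder_subspace_basis {X : normedModType R} (Xs : nat -> set X) : Prop :=
  (forall j, findim_sub (Xs j)) /\
  forall z : X, exists! xs : nat -> X, (forall j, Xs j (xs j)) /\ series xs n @[n --> \oo] --> z.

Definition adapted {X : normedModType R} (Xs : nat -> set X) (T : R -> X -> X) : Prop :=
  forall j t x, 0 <= t -> Xs j x -> Xs j (T t x).

End Defs.

(* Main.v *)
(* Let Q_n be the projection onto the first n blocks of the basis. The Q_n are
   uniformly bounded and commute with the semigroup, and their ranges are finite
   dimensional, hence lie in the domain of A.

   Necessity. Closed loop trajectories started at Q_k x with zero controller state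
   decay, which gives stabilizability; an unobserved trajectory together with the
   zero controller state is a closed loop trajectory, which gives detectability.
   Let Q_N x = 0. By Duhamel's formula the tail (1 - Q_N) of the closed loop
   trajectory from x differs from the free orbit T t x by the response to
   (1 - Q_N) B G w, which is small for large N since the controller state w ranges
   over a finite-dimensional space. Hence some T tau is a contraction on the range
   of 1 - Q_N, so the system is exponentially stable there, and the range of Q_N
   carries the finite-dimensional summand.

   Sufficiency. The same comparison, with the unstable part in the place of the
   controller, shows that the range of 1 - Q_n is exponentially stable for some
   n = n0. On the range of Q_n0 the Hautus-type form of stabilizability and
   detectability yields a stabilizing feedback K and a stabilizing output
   injection L. The controller is an observer on the range of Q_n for some
   n >= n0, with feedback and injection acting through Q_n0 only. The
   observation error is then driven by (1 - Q_n) B K alone, which tends to 0 as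
   n grows, and a small-gain estimate closes the loop. *)

Require Import Defs.
From HB Require Import structures.
From mathcomp Require Import all_boot all_order all_algebra.
From mathcomp Require Import all_classical all_reals all_analysis.
From mathcomp Require Import zify ring lra.
Set Implicit Arguments. Unset Strict Implicit. Unset Printing Implicit Defensive.
Import Order.TTheory GRing.Theory Num.Theory.
Import numFieldNormedType.Exports.
Local Open Scope classical_set_scope.
Local Open Scope ring_scope.

(** The obstacle throughout is that [C] is bounded in the graph norm only: the closed loop is not a
    bounded perturbation of a generator, and the output along a tail orbit is not bounded by the
    state. One device removes both difficulties. If the semigroup of [A - l] decays, then
    [C = Ct (A - l)] with [Ct] bounded. The substitution [w - F Ct x] in the controller state makes
    the closed loop a bounded perturbation; necessity depends on this, since exponential stability
    says nothing about trajectories that do not exist. In the observation error the same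
    factorisation writes the tail output as a derivative plus a bounded term, and the derivative is
    absorbed into the head component. Trajectories start in the domain, so tail estimates are proved
    for finite expansions and extended by density. Integrals are replaced by primitives, and
    variation of constants by an inequality for right derivatives. The gains are built over the
    reals without eigenvalues. They and the constants of the closed loop depend on [n0] only, so [n]
    can be chosen once the small-gain threshold is known. *)

Section LinearExpressions.
Variables (K : comPzRingType) (V : lmodType K).

Inductive lexpr :=
  LVar of nat | LAdd of lexpr & lexpr | LOpp of lexpr | LScale of K & lexpr | LZero.

Fixpoint leval (env : seq V) e : V :=
  match e with
  | LVar i => nth 0 env i
  | LAdd a b => leval env a + leval env b
  | LOpp a => - leval env a
  | LScale k a => k *: leval env a
  | LZero => 0
  end.

(** The test is [eqn] rather than [==] so that [cbv] with a short list of constants evaluates it on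
    concrete indices. *)
Fixpoint lcoef e (i : nat) : K :=
  match e with
  | LVar j => if eqn i j then 1 else 0
  | LAdd a b => lcoef a i + lcoef b i
  | LOpp a => - lcoef a i
  | LScale k a => k * lcoef a i
  | LZero => 0
  end.

(** A recursive conjunction instead of a quantifier over indices: on a concrete environment it
    unfolds to one scalar identity per atom. *)
Fixpoint lcoef_eq (n : nat) e1 e2 : Prop :=
  if n is m.+1 then lcoef e1 m = lcoef e2 m /\ lcoef_eq m e1 e2 else True.

Lemma leval_coef env e :
  leval env e = \sum_(i < size env) lcoef e i *: nth 0 env i.
Proof.
elim: e => [j|a IHa b IHb|a IHa|k a IHa|] /=; rewrite ?IHa ?IHb.
- have E i : (if eqn i j then 1 else 0 : K) = (i == j)%:R by rewrite eqnE; case: eqP.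
  under eq_bigr do rewrite E.
  have [jn|nj] := ltnP j (size env); last first.
    rewrite nth_default// big1// => i _; case: eqP => [ij|]; rewrite ?scale0r//.
    by move: (ltn_ord i); rewrite ij ltnNge nj.
  rewrite (bigD1 (Ordinal jn))//= eqxx scale1r big1 ?addr0// => i.
  by rewrite -val_eqE /= => /negbTE ->; rewrite scale0r.
- by rewrite -big_split; apply: eq_bigr => i _; rewrite scalerDl.
- by rewrite -sumrN; apply: eq_bigr => i _; rewrite scaleNr.
- by rewrite scaler_sumr; apply: eq_bigr => i _; rewrite scalerA.
- by rewrite big1// => i _; rewrite scale0r.
Qed.

Lemma leval_eq env e1 e2 : lcoef_eq (size env) e1 e2 -> leval env e1 = leval env e2.
Proof.
move=> H; rewrite !leval_coef; apply: eq_bigr => i _; congr (_ *: _).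
elim: (size env) H i => [_ []//|n IH /= [e H] i].
have [->//|ni] := eqVneq (val i) n.
have lt : (i < n)%N by rewrite ltn_neqAle ni -ltnS ltn_ord.
exact: (IH H (Ordinal lt)).
Qed.

End LinearExpressions.

Ltac lmod_same x y := match goal with _ => unify x y end.
Ltac lmod_add x l :=
  let rec mem l := lazymatch l with
    | cons ?y ?t => match goal with
      | _ => let _ := lmod_same x y in l
      | _ => let t' := mem t in constr:(cons y t')
      end
    | nil => constr:(cons x nil)
    end in mem l.
Ltac lmod_atoms V t l :=
  lazymatch t with
  | (?a + ?b)%R => let l := lmod_atoms V a l in lmod_atoms V b l
  | (- ?a)%R => lmod_atoms V a l
  | (_ *: ?a)%R => lmod_atoms V a l
  | (0)%R => l
  | _ => lmod_add t l
  end.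
Ltac lmod_idx x l :=
  lazymatch l with
  | cons ?y ?t => match goal with
    | _ => let _ := lmod_same x y in constr:(O)
    | _ => let n := lmod_idx x t in constr:(S n)
    end
  end.
Ltac lmod_reify K t l :=
  lazymatch t with
  | (?a + ?b)%R => let a := lmod_reify K a l in let b := lmod_reify K b l in
      constr:(LAdd a b)
  | (- ?a)%R => let a := lmod_reify K a l in constr:(LOpp a)
  | (?k *: ?a)%R => let a := lmod_reify K a l in constr:(LScale (k : K) a)
  | (0)%R => constr:(@LZero K)
  | _ => let n := lmod_idx t l in constr:(@LVar K n)
  end.
(* Equality of linear combinations in a module over [K], atom by atom with
   [ring]. Atoms are compared up to conversion, since over [R : realType] the
   same operation can be inferred along syntactically different paths. *)
Ltac lmod K :=
  lazymatch goal with
  | |- @eq ?V ?a ?b =>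
    let l := lmod_atoms V a (@nil V) in
    let l := lmod_atoms V b l in
    let ea := lmod_reify K a l in
    let eb := lmod_reify K b l in
    refine (@leval_eq K _ l ea eb _);
    cbv [size lcoef_eq lcoef eqn]; repeat (split; [try ring|]); try exact I
  end.

(** * Continuity and differentiation on the half line *)

Section HalfLine.
Variable R : realType.
Implicit Types (V W : normedModType R).

Lemma cont0P V (f : R -> V) : cont0 f <->
  forall t, 0 <= t -> forall e : R, 0 < e -> exists2 d : R, 0 < d &
    forall s, 0 <= s -> `|s - t| < d -> `|f s - f t| <= e.
Proof.
rewrite /cont0 subspace_continuousP; split=> [h t t0 e e0|h t].
  have tI : `[0%R, +oo[%classic t by rewrite /= in_itv /= t0.
  have /cvgrPdist_le /(_ e e0) /nbhs_ballP[d /= d0 hd] := h t tI.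
  exists d => // s s0 st; rewrite distrC; apply: hd; first by rewrite /ball/= distrC.
  by rewrite in_itv /= s0.
rewrite /= in_itv /= andbT => t0; apply/cvgrPdist_le => e e0.
have [d d0 hd] := h t t0 e e0.
apply/nbhs_ballP; exists d => //= s; rewrite /ball /= => st.
by rewrite in_itv /= andbT => s0; rewrite distrC; apply: hd; rewrite // distrC.
Qed.

Lemma is_deriv0P V (x x' : R -> V) : is_deriv0 x x' <->
  forall t, 0 <= t -> forall e : R, 0 < e -> exists2 d : R, 0 < d &
    forall s, 0 <= s -> `|s - t| < d ->
      `|x s - x t - (s - t) *: x' t| <= e * `|s - t|.
Proof.
split=> [h t t0 e e0|h t t0].
  have /cvgrPdist_le /(_ e e0) := h t t0.
  move=> /nbhs_ballP[d /= d0 hd]; exists d => // s s0 st.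
  have [->|sNt] := eqVneq s t.
    by rewrite !subrr scale0r subr0 !normr0 mulr0.
  have st0 : s - t != 0 by rewrite subr_eq0.
  have := hd (s - t); rewrite /ball /= sub0r normrN => /(_ st st0).
  rewrite subrKC => /(_ s0) hh.
  have -> : x s - x t - (s - t) *: x' t =
     - (s - t) *: (x' t - (s - t)^-1 *: (x s - x t)).
    by rewrite scaleNr (scalerBr _ (x' t)) scalerA divff// scale1r opprB.
  by rewrite normrZ normrN mulrC ler_wpM2r.
apply/cvgrPdist_le => e e0.
have [d d0 hd] := h t t0 e e0.
apply/nbhs_ballP; exists d => //= k; rewrite /ball /= sub0r normrN => kd k0 tk.
have := hd (t + k) tk; rewrite addrAC subrr add0r => /(_ kd) hh.
have -> : x' t - k^-1 *: (x (t + k) - x t) =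
   - k^-1 *: (x (t + k) - x t - k *: x' t).
  by rewrite scaleNr (scalerBr _ (_ - _)) scalerA mulVf// scale1r opprB.
rewrite normrZ normrN normfV mulrC ler_pdivrMr ?normr_gt0//.
Qed.

Definition rderiv V (x : R -> V) (t : R) (v : V) := forall e : R, 0 < e ->
  exists2 d : R, 0 < d & forall h, 0 < h -> h < d ->
    `|x (t + h) - x t - h *: v| <= e * h.

Lemma gen_limP V (T : R -> V -> V) (x l : V) :
  (fun h : R => h^-1 *: (T h x - x)) @ (0%R)^'+ --> l <->
  forall e : R, 0 < e ->
  exists2 d : R, 0 < d & forall h, 0 < h -> h < d ->
    `|T h x - x - h *: l| <= e * h.
Proof.
have aux h : 0 < h -> `|l - h^-1 *: (T h x - x)| = `|T h x - x - h *: l| / h.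
  move=> h0; rewrite distrC.
  have -> : h^-1 *: (T h x - x) - l = h^-1 *: (T h x - x - h *: l).
    by rewrite [in RHS]scalerBr scalerA mulVf ?scale1r// gt_eqF.
  by rewrite normrZ normfV (gtr0_norm h0) mulrC.
split=> [/cvgrPdist_le H e e0|H].
  have [d /= d0 hd] := H e e0; exists d => // h h0 hd'.
  have := hd h; rewrite /ball /= sub0r normrN (gtr0_norm h0) => /(_ hd' h0).
  by rewrite aux// ler_pdivrMr.
apply/cvgrPdist_le => e e0; have [d d0 hd] := H e e0.
exists d => //= h; rewrite /ball /= sub0r normrN => hd' h0.
by rewrite aux// ler_pdivrMr// hd// (le_lt_trans _ hd')// ler_norm.
Qed.

(** Real induction: the supremum of the points up to which [P] holds is itself such a point by the
    last hypothesis, and the one before forbids it to lie below [b]. *)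
Lemma real_ind (P : R -> Prop) (a b : R) : P a ->
  (forall s, a <= s -> s < b -> (forall r, a <= r -> r <= s -> P r) ->
     exists2 d : R, 0 < d & forall h : R, 0 < h -> h < d -> P (s + h)) ->
  (forall s, a < s -> s <= b -> (forall r, a <= r -> r < s -> P r) -> P s) ->
  forall t, a <= t -> t <= b -> P t.
Proof.
move=> Pa Pr Pl t at_ tb.
have ab : a <= b by exact: le_trans tb.
pose S : set R := [set c | a <= c <= b /\ forall r, a <= r -> r <= c -> P r].
have Sa : S a.
  split; first by rewrite lexx.
  by move=> r ar ra; have -> : r = a by apply/le_anti; rewrite ra ar.
have hS : has_sup S by split; [exists a|exists b => x [/andP[]]].
pose c := sup S.
have ac : a <= c by apply: ub_le_sup; first by case: hS.
have cb : c <= b by apply: ge_sup; [exists a|move=> x [/andP[]]].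
have Plt r : a <= r -> r < c -> P r.
  move=> ar rc; have [y [/andP[ay yb] Py] ry] := sup_gt hS.1 rc.
  exact: Py ar (ltW ry).
have Pc : P c.
  have [->//|ca] := eqVneq c a.
  by apply: Pl => //; rewrite lt_neqAle eq_sym ca.
have Pcl r : a <= r -> r <= c -> P r.
  by move=> ar; rewrite le_eqVlt => /predU1P[->//|]; exact: Plt.
suff bc : b <= c by apply: Pcl => //; exact: le_trans bc.
rewrite leNgt; apply/negP => cb'.
have [d d0 hd] := Pr c ac cb' Pcl.
pose k := Num.min (d / 2) (b - c).
have k0 : 0 < k by rewrite lt_min divr_gt0// subr_gt0.
have kd : k < d by rewrite gt_min; apply/orP; left; lra.
have kb : k <= b - c by rewrite ge_min lexx orbT.
suff : c + k <= c by lra.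
apply: ub_le_sup; first by case: hS.
split; first by apply/andP; split; lra.
move=> r ar; have [rc _|cr rk] := leP r c; first exact: Pcl.
by have := hd (r - c); rewrite subrKC; apply; lra.
Qed.

(* Only a right-sided bound on the increments is required: the derivative of
   [s |-> T (t - s) (z s)] is easy to obtain from the right only. *)
Lemma mean_value V (F : R -> V) (g : R -> R) (a b : R) : cont0 F -> cont0 g ->
  0 <= a -> a <= b ->
  (forall s, a <= s -> s < b -> forall e : R, 0 < e ->
     exists2 d : R, 0 < d & forall h, 0 < h -> h < d ->
       `|F (s + h) - F s| <= g (s + h) - g s + e * h) ->
  `|F b - F a| <= g b - g a.
Proof.
move=> /cont0P cF /cont0P cg a0 ab H.
suff K e : 0 < e -> `|F b - F a| <= g b - g a + e * (b - a).
  apply/ler_addgt0Pr => e e0.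
  have e0' : 0 < e / (b - a + 1) by apply: divr_gt0 => //; lra.
  apply: (le_trans (K _ e0')); rewrite lerD2l mulrAC ler_pdivrMr; last lra.
  by rewrite ler_pM2l//; lra.
move=> e0.
apply: (@real_ind (fun t => `|F t - F a| <= g t - g a + e * (t - a)) a b) => //.
- by rewrite !subrr normr0 mulr0 addr0.
- move=> s as_ sb Ps.
  have [d d0 hd] := H s as_ sb e e0; exists d => // h h0 hd'.
  have := hd h h0 hd'; have := Ps s as_ (lexx _).
  have := ler_normD (F (s + h) - F s) (F s - F a); rewrite subrKA.
  by lra.
- move=> s as_ sb Ps; apply/ler_addgt0Pr => k k0.
  have s0 : 0 <= s by lra.
  have k3 : 0 < k / 3 by lra.
  have [d1 d10 hd1] := cF s s0 _ k3.
  have [d2 d20 hd2] := cg s s0 _ k3.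
  have [r [ar rs /andP[r1 r2]]] : exists r, [/\ a <= r, r < s & (s - r < d1) && (s - r < d2)].
    pose m := Num.min (Num.min d1 d2) (s - a).
    have m0 : 0 < m by rewrite !lt_min d10 d20 subr_gt0.
    have m1 : m <= d1 by rewrite !ge_min lexx.
    have m2 : m <= d2 by rewrite !ge_min lexx !orbT.
    have m3 : m <= s - a by rewrite !ge_min lexx !orbT.
    by exists (s - m / 2); split; [lra|lra|apply/andP; split; lra].
  have r0 : 0 <= r by lra.
  have nr : `|r - s| = s - r by rewrite distrC gtr0_norm//; lra.
  have := hd1 r r0; rewrite nr => /(_ r1) h1.
  have := hd2 r r0; rewrite nr => /(_ r2); rewrite ler_norml => /andP[_ h2].
  have := Ps r ar rs.
  have := ler_normD (F s - F r) (F r - F a); rewrite subrKA (distrC (F s) (F r)).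
  have : e * (r - a) <= e * (s - a) by rewrite ler_pM2l//; lra.
  move: h1 h2; lra.
Qed.

Lemma geometric_small (C e : R) : 0 <= C -> 0 < e -> exists n, C * 2^-1 ^+ n <= e.
Proof.
move=> C0 e0; have C1 : 0 < C + 1 by lra.
have /cvgrPdist_le /(_ (e / (C + 1))) := @cvg_expr R 2^-1 ltac:(rewrite ger0_norm; lra).
move=> /(_ ltac:(exact: divr_gt0)) [n _ /(_ n (leqnn _))].
have p : 0 < 2^-1 ^+ n :> R by rewrite exprn_gt0// invr_gt0.
rewrite sub0r normrN (gtr0_norm p) ler_pdivlMr// => h; exists n; lra.
Qed.

End HalfLine.

Section ContinuousHalfLine.
Variable R : realType.
Implicit Types (V W : normedModType R).

Lemma cont0D V (f g : R -> V) : cont0 f -> cont0 g -> cont0 (fun t => f t + g t).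
Proof.
move=> /subspace_continuousP cf /subspace_continuousP cg.
by apply/subspace_continuousP => t tI; apply: cvgD; [exact: cf|exact: cg].
Qed.

Lemma cont0N V (f : R -> V) : cont0 f -> cont0 (fun t => - f t).
Proof.
move=> /subspace_continuousP cf.
by apply/subspace_continuousP => t tI; apply: cvgN; exact: cf.
Qed.

Lemma cont0B V (f g : R -> V) : cont0 f -> cont0 g -> cont0 (fun t => f t - g t).
Proof. by move=> cf cg; apply: cont0D => //; exact: cont0N. Qed.

Lemma cont0Z V (a : R -> R) (f : R -> V) : cont0 a -> cont0 f ->
  cont0 (fun t => a t *: f t).
Proof.
move=> /subspace_continuousP cf /subspace_continuousP cg.
by apply/subspace_continuousP => t tI; apply: cvgZ; [exact: cf|exact: cg].
Qed.

Lemma cont0_cst V (v : V) : cont0 (fun _ : R => v).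
Proof. by apply/subspace_continuousP => t tI; exact: cvg_cst. Qed.

Lemma cont0_comp V W (f : R -> V) (K : V -> W) : cont0 f -> continuous K ->
  cont0 (K \o f).
Proof.
move=> /subspace_continuousP cf cK.
by apply/subspace_continuousP => t tI; apply: cvg_comp (cf t tI) (cK _).
Qed.

Lemma cont0_of_continuous V (f : R -> V) : continuous f -> cont0 f.
Proof.
move=> cf; apply/subspace_continuousP => t _.
exact: cvg_within_filter (cf t).
Qed.

Lemma cont0_id : cont0 (fun t : R => t).
Proof. by apply: cont0_of_continuous => t; exact: cvg_id. Qed.

Lemma cont0_lip V (f : R -> V) (L : R) :
  (forall s t, 0 <= s -> 0 <= t -> `|f s - f t| <= L * `|s - t|) -> cont0 f.
Proof.
move=> H; apply/cont0P => t t0 e e0.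
have L1 : 0 < `|L| + 1 by apply: ltr_wpDl.
exists (e / (`|L| + 1)) => [|s s0 st]; first exact: divr_gt0.
apply: (le_trans (H _ _ s0 t0)).
apply: (@le_trans _ _ ((`|L| + 1) * `|s - t|)).
  by rewrite ler_wpM2r//; have := ler_norm L; lra.
by rewrite mulrC -ler_pdivlMr//; exact: ltW.
Qed.

(** Convolution kernels are written with [max 0 (t - s)]: it agrees with [t - s] on the interval of
    integration and keeps the semigroup at nonnegative times, so that the kernels are continuous on
    the whole half line. *)
Lemma cont0_pos_sub (t : R) : cont0 (V := R) (fun s => Num.max 0 (t - s)).
Proof.
apply: (@cont0_lip _ _ 1) => x y _ _; rewrite mul1r.
wlog xy : x y / x <= y => [H|].
  by case: (leP x y) => [|/ltW] xy; [|rewrite distrC (distrC x)]; exact: H.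
rewrite (distrC x) (ger0_norm (_ : 0 <= y - x)) ?subr_ge0// ger0_norm.
  by case: (leP 0 (t - x)) => ?; case: (leP 0 (t - y)) => ?; lra.
by rewrite subr_ge0 le_max2//; lra.
Qed.

Lemma cont0_ext V (f g : R -> V) : (forall t, 0 <= t -> f t = g t) -> cont0 f -> cont0 g.
Proof.
move=> fg /cont0P cf; apply/cont0P => t t0 e e0.
have [d d0 hd] := cf t t0 e e0; exists d => // s s0 st.
by rewrite -!fg//; exact: hd.
Qed.

(** Real induction on [a]: around a point [s] the values differ from [f s] by at most [e / 2], hence
    from each other by at most [e], and uniformity up to some [r] in that neighbourhood passes
    across it. *)
Lemma heine V (f : R -> V) (a e : R) : cont0 f -> 0 <= a -> 0 < e ->
  exists2 d : R, 0 < d & forall s t, 0 <= s -> s <= t -> t <= a -> t - s < d ->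
    `|f t - f s| <= e.
Proof.
move=> /cont0P cf a0 e0.
have key s d2 r b : 0 <= s -> (forall t, 0 <= t -> `|t - s| < d2 -> `|f t - f s| <= e / 2) ->
   s - d2 < r -> r <= s -> b < s + d2 ->
   (exists2 d : R, 0 < d & forall s t, 0 <= s -> s <= t -> t <= r -> t - s < d ->
    `|f t - f s| <= e) ->
   (exists2 d : R, 0 < d & forall s t, 0 <= s -> s <= t -> t <= b -> t - s < d ->
    `|f t - f s| <= e).
  move=> s0 H2 sr rs bs [d1 d10 H1].
  exists (Num.min d1 (r - (s - d2))); first by rewrite lt_min d10 subr_gt0.
  move=> x y x0 xy yb; rewrite lt_min => /andP[yx1 yx2].
  have [yr|ry] := leP y r; first exact: H1.
  have h1 : `|y - s| < d2 by rewrite ltr_norml; apply/andP; split; lra.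
  have h2 : `|x - s| < d2 by rewrite ltr_norml; apply/andP; split; lra.
  have := H2 y (le_trans x0 xy) h1; have := H2 x x0 h2.
  have := ler_normB (f y - f s) (f x - f s).
  rewrite opprB addrA subrK; lra.
apply: (@real_ind R (fun a => exists2 d : R, 0 < d & forall s t, 0 <= s -> s <= t -> t <= a -> t - s < d ->
    `|f t - f s| <= e) 0 a) => //.
- exists 1 => // s t s0 st t0 _.
  have -> : t = s by lra.
  by rewrite subrr normr0 ltW.
- move=> s s0 sa Ps.
  have [d2 d20 H2] := cf s s0 (e/2) ltac:(lra).
  exists d2 => // h h0 hd.
  by apply: (key s d2 s) => //; [lra|lra|exact: Ps].
- move=> s s0 sa Ps.
  have [d2 d20 H2] := cf s (ltW s0) (e/2) ltac:(lra).
  pose r := Num.max 0 (s - d2 / 2).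
  have rs : r < s by rewrite gt_max s0/=; lra.
  have r0 : 0 <= r by rewrite le_max lexx.
  have rd : s - d2 / 2 <= r by rewrite le_max lexx orbT.
  by apply: (key s d2 r) => //; [lra|lra|lra|lra|exact: Ps].
Qed.

Lemma cont0_bounded V (f : R -> V) (a : R) : cont0 f ->
  exists2 M : R, 0 < M & forall s, 0 <= s -> s <= a -> `|f s| <= M.
Proof.
move=> cf; have [a0|a0] := leP 0 a; last by exists 1 => // s s0 sa; lra.
have [d d0 H] := heine cf a0 ltr01.
have K n : forall s, 0 <= s -> s <= a -> s < n%:R * (d / 2) -> `|f s| <= `|f 0| + n%:R.
  elim: n => [s s0 _|n IH s s0 sa sn]; first by rewrite mul0r; lra.
  have [sd|sd] := leP s (d / 2).
    have := H 0 s (lexx _) s0 sa; rewrite subr0 => /(_ ltac:(lra)) h.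
    have := ler_normD (f s - f 0) (f 0); rewrite subrK.
    have : 1 <= n.+1%:R :> R by rewrite ler1n.
    by lra.
  have h1 : `|f s - f (s - d / 2)| <= 1 by apply: H; lra.
  have h2 : `|f (s - d / 2)| <= `|f 0| + n%:R.
    apply: IH; [lra|lra|].
    by move: sn; rewrite -natr1 mulrDl mul1r; lra.
  have := ler_normD (f s - f (s - d / 2)) (f (s - d / 2)); rewrite subrK.
  by rewrite -natr1; lra.
pose n := (Num.trunc (a / (d / 2))).+1.
have an : a < n%:R * (d / 2).
  by rewrite -ltr_pdivrMr ?truncnS_gt//; lra.
exists (`|f 0| + n%:R).
  by apply: ltr_wpDl => //; rewrite ltr0n.
by move=> s s0 sa; apply: K => //; exact: le_lt_trans an.
Qed.

Lemma cauchy_seq (V : completeNormedModType R) (u : nat -> V) :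
  (forall e : R, 0 < e -> exists N, forall n m, (N <= n)%N -> (N <= m)%N -> `|u n - u m| <= e) ->
  exists l, forall e : R, 0 < e -> exists N, forall n, (N <= n)%N -> `|u n - l| <= e.
Proof.
move=> H; have /cauchy_cvgP/cvg_ex[l ul] : cauchy (u n @[n --> \oo]).
  apply: cauchy_exP => e e0; have [N HN] := H (e / 2) ltac:(lra).
  exists (u N), N => // n /= nN; rewrite -ball_normE /=.
  by have := HN N n (leqnn _) nN; lra.
exists l => e e0; have /cvgrPdist_le /(_ e e0) [N _ HN] := ul.
by exists N => n nN; rewrite distrC; exact: HN.
Qed.

Lemma clamp_lip (d x y : R) :
  `|Num.min (Num.max x 0) d - Num.min (Num.max y 0) d| <= `|x - y|.
Proof.
wlog xy : x y / x <= y => [H|].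
  by case: (leP x y) => [|/ltW] xy; [|rewrite distrC (distrC x)]; exact: H.
have h1 : Num.min (Num.max x 0) d <= Num.min (Num.max y 0) d.
  by rewrite le_min2// le_max2.
have h2 : Num.min (Num.max y 0) d - Num.min (Num.max x 0) d <= y - x.
  have : Num.max y 0 - Num.max x 0 <= y - x.
    by case: (leP y 0) => ?; case: (leP x 0) => ?; lra.
  have : Num.max x 0 <= Num.max y 0 by rewrite le_max2.
  move: (Num.max x 0) (Num.max y 0) => a b.
  by case: (leP a d) => ?; case: (leP b d) => ?; lra.
by rewrite distrC (distrC x) !ger0_norm ?subr_ge0.
Qed.

(** [F] is the integral of a step function: [f] is frozen at the grid points [i * d], and
    [l (t - i * d)] is the length of the part of cell [i] that lies below [t]. Uniform continuity
    bounds the error in the right derivative by [e]. *)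
Lemma eps_prim V (f : R -> V) (a e : R) : cont0 f -> 0 < e ->
  exists F : R -> V, [/\ cont0 F, F 0 = 0 &
    forall s, 0 <= s -> s < a -> exists2 d : R, 0 < d &
      forall h, 0 < h -> h < d -> `|F (s + h) - F s - h *: f s| <= e * h].
Proof.
move=> cf e0; have [a0|a0] := leP 0 a; last first.
  exists (fun _ => 0); split => //; first exact: cont0_cst.
  by move=> s s0 sa; lra.
have [d d0 H] := heine cf a0 e0.
pose N := (Num.trunc (a / d)).+1.
pose l (x : R) := Num.min (Num.max x 0) d.
have l_lip x y : `|l x - l y| <= `|x - y|.
  exact: clamp_lip.
pose F t := \sum_(i < N) l (t - i%:R * d) *: f (i%:R * d).
exists F; split.
- apply: (@cont0_lip _ _ (\sum_(i < N) `|f (i%:R * d)|)) => s t _ _.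
  rewrite /F -sumrB mulr_suml; apply: (le_trans (ler_norm_sum _ _ _)).
  apply: ler_sum => i _; rewrite -scalerBl normrZ mulrC ler_wpM2l//.
  by apply: (le_trans (l_lip _ _)); rewrite opprB addrA subrK.
- apply: big1 => i _; have id0 : 0 <= i%:R * d by rewrite mulr_ge0// ltW.
  by rewrite /l max_r ?min_l ?scale0r//; lra.
- move=> s s0 sa; pose k := Num.trunc (s / d).
  have /andP[ks sk] : k%:R * d <= s < k.+1%:R * d.
    rewrite -ler_pdivlMr// -ltr_pdivrMr//; apply: truncn_itv.
    by rewrite divr_ge0// ltW.
  have kN : (k < N)%N.
    by rewrite ltnS le_truncn// ler_pM2r ?invr_gt0// ltW.
  exists (k.+1%:R * d - s); first by rewrite subr_gt0.
  move=> h h0 hk.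
  have -> : F (s + h) - F s = h *: f (k%:R * d).
    rewrite /F -sumrB (bigD1 (Ordinal kN))//= big1 ?addr0.
      rewrite -scalerBl; congr (_ *: _).
      move: sk hk; rewrite -natr1 mulrDl mul1r => sk hk.
      by rewrite /l !max_l ?min_l ?min_l; lra.
    move=> i; rewrite -val_eqE /= neq_ltn => ik.
    suff -> : l (s + h - i%:R * d) = l (s - i%:R * d) by rewrite subrr.
    case/orP: ik => ik.
      have : i.+1%:R * d <= k%:R * d by rewrite ler_pM2r// ler_nat.
      rewrite -natr1 mulrDl mul1r => id.
      by rewrite /l !max_l ?min_r; lra.
    have id : k.+1%:R * d <= i%:R * d by rewrite ler_pM2r// ler_nat.
    by rewrite /l !max_r//; lra.
  rewrite -scalerBr normrZ (gtr0_norm h0) mulrC ler_pM2r// distrC.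
  apply: H => //; [|exact: ltW|].
    by rewrite mulr_ge0// ltW.
  by move: sk; rewrite -natr1 mulrDl mul1r; lra.
Qed.

(** Approximate primitives with error [1 / (n + 1)] on [[0, n]] are Cauchy at each time by the mean
    value inequality. Their increment estimate survives in the limit as [F2], which yields the
    two-sided derivative. *)
Lemma prim_exists (V : completeNormedModType R) (f : R -> V) : cont0 f ->
  exists F : R -> V, F 0 = 0 /\ is_deriv0 F f.
Proof.
move=> cf.
have /choice[G HG] : forall n : nat, exists F : R -> V, [/\ cont0 F, F 0 = 0 &
    forall s, 0 <= s -> s < n%:R -> exists2 d : R, 0 < d &
      forall h, 0 < h -> h < d -> `|F (s + h) - F s - h *: f s| <= n.+1%:R^-1 * h].
  by move=> n; apply: eps_prim.
have G1 n m t : 0 <= t -> t <= n%:R -> t <= m%:R ->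
   `|G n t - G m t| <= (n.+1%:R^-1 + m.+1%:R^-1) * t.
  move=> t0 tn tm; have [c1 z1 H1] := HG n; have [c2 z2 H2] := HG m.
  have := @mean_value R V (fun s => G n s - G m s) (fun s => (n.+1%:R^-1 + m.+1%:R^-1) * s) 0 t.
  rewrite z1 z2 !subr0 mulr0 subr0; apply => //.
  - exact: cont0B.
  - by apply: (@cont0Z R^o); [exact: cont0_cst|exact: cont0_id].
  move=> s s0 st e e0.
  have [d1 d10 K1] := H1 s s0 (lt_le_trans st tn).
  have [d2 d20 K2] := H2 s s0 (lt_le_trans st tm).
  exists (Num.min d1 d2); first by rewrite lt_min d10.
  move=> h h0; rewrite lt_min => /andP[/(K1 h h0) h1 /(K2 h h0) h2].
  have -> : G n (s + h) - G m (s + h) - (G n s - G m s) =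
    (G n (s + h) - G n s - h *: f s) - (G m (s + h) - G m s - h *: f s).
    by lmod R.
  have := ler_normB (G n (s + h) - G n s - h *: f s) (G m (s + h) - G m s - h *: f s).
  have : 0 <= e * h by rewrite mulr_ge0// ltW.
  move: h1 h2; move: (n.+1%:R^-1) (m.+1%:R^-1) => p q; move: (_ - _ - _ *: _) => A.
  move: (_ - _ - _ *: _) => B.
  by lra.
have G2 n s t c k : 0 <= s -> s <= t -> t <= n%:R ->
    (forall r, s <= r -> r <= t -> `|f r - c| <= k) ->
    `|G n t - G n s - (t - s) *: c| <= (n.+1%:R^-1 + k) * (t - s).
  move=> s0 st tn Hk; have [c1 z1 H1] := HG n.
  have := @mean_value R V (fun r => G n r - r *: c) (fun r => (n.+1%:R^-1 + k) * r) s t.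
  have -> : G n t - t *: c - (G n s - s *: c) = G n t - G n s - (t - s) *: c.
    by lmod R.
  rewrite -mulrBr; apply => //.
  - by apply: cont0B => //; apply: cont0Z; [exact: cont0_id|exact: cont0_cst].
  - by apply: (@cont0Z R^o); [exact: cont0_cst|exact: cont0_id].
  move=> r sr rt e e0.
  have [d1 d10 K1] := H1 r (le_trans s0 sr) (lt_le_trans rt tn).
  exists d1 => // h h0 hd; have h1 := K1 h h0 hd.
  have -> : G n (r + h) - (r + h) *: c - (G n r - r *: c) =
     (G n (r + h) - G n r - h *: f r) + h *: (f r - c).
    by lmod R.
  have := ler_normD (G n (r + h) - G n r - h *: f r) (h *: (f r - c)).
  rewrite normrZ (gtr0_norm h0).
  have : h * `|f r - c| <= h * k by rewrite ler_pM2l// Hk// ltW.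
  have : 0 <= e * h by rewrite mulr_ge0// ltW.
  by move: h1; move: (n.+1%:R^-1) => p; lra.
have small e : 0 < e -> exists N, forall n, (N <= n)%N -> n.+1%:R^-1 <= e :> R.
  move=> e0; exists (Num.trunc e^-1).+1 => n Nn.
  rewrite -[leRHS]invrK lef_pV2 ?posrE ?invr_gt0 ?ltr0n//.
  rewrite ltW// (lt_le_trans (truncnS_gt _))// ler_nat.
  exact: leq_trans Nn _.
have big (t : R) : exists N, forall n, (N <= n)%N -> t <= n%:R.
  exists (Num.trunc t).+1 => n Nn.
  by rewrite ltW// (lt_le_trans (truncnS_gt _))// ler_nat.
have /choice[F HF] : forall t : R, exists l, 0 <= t ->
   forall e : R, 0 < e -> exists N, forall n, (N <= n)%N -> `|G n t - l| <= e.
  move=> t; have [t0|] := leP 0 t; last by exists 0.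
  have [|l Hl] := @cauchy_seq V (fun n => G n t); last by exists l.
  move=> e e0; have t1 : 0 < t + 1 by lra.
  have [N1 HN1] := big t; have [N2 HN2] := small (e / 2 / (t + 1)) ltac:(by rewrite !divr_gt0//; lra).
  exists (maxn N1 N2) => n m; rewrite !geq_max => /andP[n1 n2] /andP[m1 m2].
  apply: le_trans (G1 n m t t0 (HN1 _ n1) (HN1 _ m1)) _.
  have : (n.+1%:R^-1 + m.+1%:R^-1) * t <= (e / 2 / (t + 1) + e / 2 / (t + 1)) * (t + 1).
    apply: ler_pM => //; last lra.
    by rewrite lerD// ?HN2.
  by move=> /le_trans; apply; rewrite mulrDl !divfK ?gt_eqF//; lra.
have F2 s t c k : 0 <= s -> s <= t ->
    (forall r, s <= r -> r <= t -> `|f r - c| <= k) ->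
    `|F t - F s - (t - s) *: c| <= k * (t - s).
  move=> s0 st Hk; have t0 := le_trans s0 st.
  have ts0 : 0 < t - s + 2 by lra.
  apply/ler_addgt0Pr => e e0; pose e' := e / (t - s + 2).
  have e'0 : 0 < e' by rewrite divr_gt0.
  have [N1 HN1] := big t; have [N2 HN2] := small e' e'0.
  have [N3 HN3] := HF t t0 _ e'0; have [N4 HN4] := HF s s0 _ e'0.
  pose n := maxn (maxn N1 N2) (maxn N3 N4).
  have := HN1 n; have := HN2 n; have := HN3 n; have := HN4 n.
  rewrite !leq_max !leqnn !orbT /= => /(_ isT) h4 /(_ isT) h3 /(_ isT) h2 /(_ isT) h1.
  have h := G2 n s t c k s0 st h1 Hk.
  have -> : F t - F s - (t - s) *: c = (G n t - G n s - (t - s) *: c) +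
     ((G n s - F s) - (G n t - F t)).
    by lmod R.
  have hh := ler_normD (G n t - G n s - (t - s) *: c) ((G n s - F s) - (G n t - F t)).
  have hh2 := ler_normB (G n s - F s) (G n t - F t).
  have : n.+1%:R^-1 * (t - s) <= e' * (t - s) by rewrite ler_wpM2r// subr_ge0.
  have : e' * (t - s) + 2 * e' = e.
    by rewrite (mulrC 2) -mulrDr divfK// gt_eqF.
  move: h hh hh2 h2 h3 h4; rewrite mulrDl; move: (n.+1%:R^-1) => p; lra.
exists F; split.
  apply/eqP; rewrite -normr_le0; apply/ler_addgt0Pr => e e0.
  have [N /(_ N (leqnn _))] := HF 0 (lexx _) e e0.
  by have [_ -> _] := HG N; rewrite sub0r normrN add0r.
apply/is_deriv0P => t t0 e e0.
have [d d0 hd] := (cont0P _).1 cf t t0 e e0; exists d => // s s0 st.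
have [ts|ts] := leP t s.
  rewrite (ger0_norm (_ : 0 <= s - t)) ?subr_ge0//; apply: F2 => // r tr rs.
  by apply: hd; [lra|rewrite ltr_norml; move: st; rewrite ltr_norml => /andP[? ?]; apply/andP; split; lra].
rewrite distrC (distrC s) (gtr0_norm (_ : 0 < t - s)) ?subr_gt0//.
have -> : (s - t) *: f t - (F s - F t) = F t - F s - (t - s) *: f t by lmod R.
apply: F2 => //; first exact: ltW.
move=> r sr rt; apply: hd; first by lra.
by rewrite ltr_norml; move: st; rewrite ltr_norml => /andP[? ?]; apply/andP; split; lra.
Qed.

End ContinuousHalfLine.

Section Derivatives.
Variable R : realType.
Implicit Types (V W : normedModType R).

Section IsLinear.
Variables (V W : lmodType R) (f : V -> W).
Hypothesis lf : is_linear f.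
Lemma lin0 : f 0 = 0.
Proof. by have /eqP := lf 1 0 0; rewrite !scale1r addr0 -subr_eq0 opprD addrA subrr sub0r oppr_eq0 => /eqP. Qed.
Lemma linD u v : f (u + v) = f u + f v.
Proof. by have := lf 1 u v; rewrite !scale1r. Qed.
Lemma linZ a u : f (a *: u) = a *: f u.
Proof. by have := lf a u 0; rewrite lin0 !addr0. Qed.
Lemma linN u : f (- u) = - f u.
Proof. by rewrite -scaleN1r linZ scaleN1r. Qed.
Lemma linB u v : f (u - v) = f u - f v.
Proof. by rewrite linD linN. Qed.
Lemma lin_sum (I : Type) (r : seq I) (P : pred I) (F : I -> V) :
  f (\sum_(i <- r | P i) F i) = \sum_(i <- r | P i) f (F i).
Proof. exact: (big_morph f linD lin0). Qed.
End IsLinear.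

Lemma bounded_linear_bound V W (f : V -> W) : bounded_linear f ->
  exists2 M : R, 0 < M & forall x, `|f x| <= M * `|x|.
Proof.
move=> [lf cf]; have /cvgrPdist_le /(_ 1 ltr01) /nbhs_ballP[d /= d0 hd] := cf 0.
have d2 : 0 < d / 2 by lra.
exists (2 / d); first by rewrite divr_gt0.
move=> x; have [->|x0] := eqVneq x 0; first by rewrite lin0// !normr0 mulr0.
have nx : 0 < `|x| by rewrite normr_gt0.
have := hd ((d / 2 / `|x|) *: x).
rewrite -ball_normE /ball_ /= sub0r normrN normrZ ger0_norm; last by rewrite divr_ge0// ltW.
rewrite divfK ?gt_eqF// (lin0 lf) sub0r normrN (linZ lf) normrZ ger0_norm; last first.
  by rewrite divr_ge0// ltW.
move=> /(_ ltac:(lra)); rewrite mulrAC ler_pdivrMr// mul1r.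
by rewrite -[2 / d]invf_div ler_pdivlMl.
Qed.

Lemma bounded_linear_intro V W (f : V -> W) (M : R) : is_linear f ->
  (forall x, `|f x| <= M * `|x|) -> bounded_linear f.
Proof.
move=> lf H; split=> // x; apply/cvgrPdist_le => e e0.
have M0 : 0 < `|M| + 1 by rewrite ltr_wpDl.
apply/nbhs_ballP; exists (e / (`|M| + 1)) => /=; first exact: divr_gt0.
move=> y; rewrite -ball_normE /ball_ /= => xy.
rewrite -linB//; apply: (le_trans (H _)).
apply: (@le_trans _ _ ((`|M| + 1) * `|x - y|)).
  by rewrite ler_wpM2r//; have := ler_norm M; lra.
by rewrite mulrC -ler_pdivlMr// ltW.
Qed.

Lemma is_deriv0_cont V (x x' : R -> V) : is_deriv0 x x' -> cont0 x.
Proof.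
move=> /is_deriv0P H; apply/cont0P => t t0 e e0.
have [d d0 hd] := H t t0 1 ltr01.
pose m := Num.min d (e / (1 + `|x' t|)).
have n0 : 0 < 1 + `|x' t| by rewrite ltr_pwDl.
have em : 0 < e / (1 + `|x' t|) by rewrite divr_gt0.
exists m; first by rewrite lt_min d0.
move=> s s0; rewrite lt_min => /andP[h1 h2].
have := hd s s0 h1; rewrite mul1r => h3.
have := ler_normD (x s - x t - (s - t) *: x' t) ((s - t) *: x' t).
rewrite subrK normrZ => h4; move: h2; rewrite ltr_pdivlMr// => h2; lra.
Qed.

Lemma is_deriv0_rderiv V (x x' : R -> V) t : is_deriv0 x x' -> 0 <= t -> rderiv x t (x' t).
Proof.
move=> /is_deriv0P H t0 e e0; have [d d0 hd] := H t t0 e e0.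
exists d => // h h0 hd'.
have := hd (t + h); rewrite addrAC subrr add0r (gtr0_norm h0).
by apply=> //; lra.
Qed.

Lemma mean_value_rderiv V (F f : R -> V) (g g' : R -> R) (a b : R) :
  cont0 F -> is_deriv0 (V := R) g g' -> 0 <= a -> a <= b ->
  (forall s, a <= s -> s < b -> rderiv F s (f s)) ->
  (forall s, a <= s -> s < b -> `|f s| <= g' s) ->
  `|F b - F a| <= g b - g a.
Proof.
move=> cF dg a0 ab dF le; apply: mean_value => //.
  exact: (is_deriv0_cont dg).
move=> s as_ sb e e0; have s0 : 0 <= s by lra.
have [d1 d10 H1] := dF s as_ sb (e / 2) ltac:(lra).
have [d2 d20 H2] := is_deriv0_rderiv dg s0 (e := e / 2) ltac:(lra).
exists (Num.min d1 d2); first by rewrite lt_min d10.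
move=> h h0; rewrite lt_min => /andP[/(H1 h h0) h1 /(H2 h h0)].
rewrite ler_norml => /andP[h2 _].
have := ler_normD (F (s + h) - F s - h *: f s) (h *: f s).
rewrite subrK normrZ (gtr0_norm h0).
have : h * `|f s| <= h * g' s by rewrite ler_pM2l// le.
have -> : h * g' s = h *: g' s by [].
lra.
Qed.

Lemma is_deriv0_id : is_deriv0 (V := R) id (fun _ => 1).
Proof.
apply/is_deriv0P => t _ e e0; exists 1 => // s _ _.
have -> : s - t - (s - t) *: (1 : R) = 0 by rewrite /GRing.scale /= mulr1 subrr.
by rewrite normr0 mulr_ge0// ltW.
Qed.

Lemma is_deriv0_lin V W (K : V -> W) (x x' : R -> V) : bounded_linear K ->
  is_deriv0 x x' -> is_deriv0 (K \o x) (K \o x').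
Proof.
move=> bK /is_deriv0P H; have [M M0 HM] := bounded_linear_bound bK.
apply/is_deriv0P => t t0 e e0; have [d d0 hd] := H t t0 (e / M) ltac:(exact: divr_gt0).
exists d => // s s0 st; have lK := bK.1; rewrite /= -linB// -linZ// -linB//.
apply: (le_trans (HM _)).
by have := hd s s0 st; rewrite mulrAC ler_pdivlMr// mulrC.
Qed.

Lemma is_deriv0D V (x x' y y' : R -> V) : is_deriv0 x x' -> is_deriv0 y y' ->
  is_deriv0 (fun t => x t + y t) (fun t => x' t + y' t).
Proof.
move=> /is_deriv0P Hx /is_deriv0P Hy; apply/is_deriv0P => t t0 e e0.
have [d1 d10 H1] := Hx t t0 (e / 2) ltac:(lra).
have [d2 d20 H2] := Hy t t0 (e / 2) ltac:(lra).
exists (Num.min d1 d2); first by rewrite lt_min d10.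
move=> s s0; rewrite lt_min => /andP[/(H1 s s0) h1 /(H2 s s0) h2].
have -> : x s + y s - (x t + y t) - (s - t) *: (x' t + y' t) =
  (x s - x t - (s - t) *: x' t) + (y s - y t - (s - t) *: y' t) by lmod R.
by apply: (le_trans (ler_normD _ _)); lra.
Qed.

Lemma is_deriv0Z V (a : R) (x x' : R -> V) : is_deriv0 x x' ->
  is_deriv0 (fun t => a *: x t) (fun t => a *: x' t).
Proof.
apply: is_deriv0_lin; apply: (@bounded_linear_intro _ _ _ `|a|).
  by move=> k u v; lmod R.
by move=> v; rewrite normrZ.
Qed.

Lemma is_deriv0N V (x x' : R -> V) : is_deriv0 x x' ->
  is_deriv0 (fun t => - x t) (fun t => - x' t).
Proof.
apply: is_deriv0_lin; apply: (@bounded_linear_intro _ _ _ 1).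
  by move=> k u v; lmod R.
by move=> v; rewrite normrN mul1r.
Qed.

Lemma is_deriv0B V (x x' y y' : R -> V) : is_deriv0 x x' -> is_deriv0 y y' ->
  is_deriv0 (fun t => x t - y t) (fun t => x' t - y' t).
Proof. by move=> hx hy; apply: is_deriv0D => //; exact: is_deriv0N. Qed.

Lemma is_deriv0_cst V (v : V) : is_deriv0 (fun _ => v) (fun _ => 0).
Proof.
apply/is_deriv0P => t _ e e0; exists 1 => // s _ _.
by rewrite subrr scaler0 subr0 normr0 mulr_ge0// ltW.
Qed.

Lemma is_deriv0_ext V (x x' y y' : R -> V) : (forall t, 0 <= t -> x t = y t) ->
  (forall t, 0 <= t -> x' t = y' t) -> is_deriv0 x x' -> is_deriv0 y y'.
Proof.
move=> xy xy' /is_deriv0P H; apply/is_deriv0P => t t0 e e0.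
have [d d0 hd] := H t t0 e e0; exists d => // s s0 st.
by rewrite -!xy// -xy'//; exact: hd.
Qed.

Lemma deriv_unique V (F G f g : R -> V) a : cont0 F -> cont0 G ->
  (forall s, 0 <= s -> s < a -> rderiv F s (f s)) ->
  (forall s, 0 <= s -> s < a -> rderiv G s (g s)) ->
  (forall s, 0 <= s -> s < a -> f s = g s) -> F 0 = G 0 ->
  forall t, 0 <= t -> t <= a -> F t = G t.
Proof.
move=> cF cG dF dG fg FG0 t t0 ta; apply/eqP; rewrite -subr_eq0 -normr_le0.
have := @mean_value_rderiv V (fun s => F s - G s) (fun s => f s - g s)
  (fun _ => 0) (fun _ => 0) 0 t; rewrite FG0 !subrr subr0; apply => //.
- exact: cont0B.
- exact: (@is_deriv0_cst R^o).
- move=> s s0 st e e0; have sa : s < a by lra.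
  have [d1 d10 H1] := dF s s0 sa (e / 2) ltac:(lra).
  have [d2 d20 H2] := dG s s0 sa (e / 2) ltac:(lra).
  exists (Num.min d1 d2); first by rewrite lt_min d10.
  move=> h h0; rewrite lt_min => /andP[/(H1 h h0) h1 /(H2 h h0) h2].
  have -> : F (s + h) - G (s + h) - (F s - G s) - h *: (f s - g s) =
    (F (s + h) - F s - h *: f s) - (G (s + h) - G s - h *: g s) by lmod R.
  by apply: (le_trans (ler_normB _ _)); lra.
- by move=> s s0 st; rewrite fg ?subrr ?normr0//; lra.
Qed.

Lemma is_deriv0_of_derive (f f' : R -> R) :
  (forall t : R, is_derive t 1 f (f' t)) -> is_deriv0 (V := R) f f'.
Proof.
move=> H t t0; have [df <-] := H t.
have : (fun h : R => h^-1 *: ((f \o shift t) (h *: 1) - f t)) @ 0^' --> 'D_1 f t by exact: df.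
move=> h; apply: cvg_within_filter.
rewrite (_ : (fun h => _) = (fun h : R => h^-1 *: ((f \o shift t) (h *: 1) - f t)))//.
by apply/funext => k /=; rewrite /GRing.scale /= mulr1 [k + t]addrC.
Qed.

Lemma is_deriv0_expR (a : R) : is_deriv0 (V := R) (fun t => expR (a * t)) (fun t => a * expR (a * t)).
Proof.
apply: is_deriv0_of_derive => t.
have -> : (fun t => expR (a * t)) = expR \o (fun t => a * t) by [].
apply: is_derive_eq.
by rewrite /GRing.scale /= mulr1 mulrC.
Qed.

End Derivatives.

(** Strong continuity and local uniform boundedness give joint continuity. The family is abstract
    because both the semigroup and its primitive [sgV] are substituted. *)
Lemma cont0_family (R : realType) (X : normedModType R) (S : R -> X -> X) (a : R -> R) (f : R -> X) :
  (forall t, 0 <= t -> is_linear (S t)) ->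
  (forall b, exists2 M : R, 0 < M & forall t x, 0 <= t -> t <= b -> `|S t x| <= M * `|x|) ->
  (forall x, cont0 (fun t => S t x)) ->
  cont0 (V := R) a -> (forall s, 0 <= s -> 0 <= a s) -> cont0 f ->
  cont0 (fun s => S (a s) (f s)).
Proof.
move=> linS bdS cS /cont0P ca a0 /cont0P cf; apply/cont0P => t t0 e e0.
have [d1 d10 H1] := ca t t0 1 ltr01.
have [M M0 HM] := bdS (a t + 1).
have [d2 d20 H2] := cf t t0 (e / 2 / M) ltac:(by rewrite divr_gt0//; lra).
have [d3 d30 H3] := (cont0P _).1 (cS (f t)) (a t) (a0 t t0) (e / 2) ltac:(lra).
have [d4 d40 H4] := ca t t0 (d3 / 2) ltac:(lra).
exists (Num.min d1 (Num.min d2 d4)); first by rewrite !lt_min d10 d20.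
move=> s s0; rewrite !lt_min => /and3P[/(H1 s s0) h1 /(H2 s s0) h2 /(H4 s s0) h4].
have as0 := a0 s s0.
have at1 : a s <= a t + 1 by move: h1; rewrite ler_norml => /andP[_]; lra.
have h3 := H3 (a s) as0 ltac:(lra).
have -> : S (a s) (f s) - S (a t) (f t) =
   S (a s) (f s - f t) + (S (a s) (f t) - S (a t) (f t)).
  by rewrite (linB (linS _ as0)) subrKA.
have := HM (a s) (f s - f t) as0 at1.
have := ler_normD (S (a s) (f s - f t)) (S (a s) (f t) - S (a t) (f t)).
move: h2; rewrite ler_pdivlMr// mulrC; lra.
Qed.

(** * Primitives in place of integrals *)

Section Primitive.
Variables (R : realType) (V : completeNormedModType R).
Implicit Types f g : R -> V.

(** The integral of [f] from 0, obtained by choice: for continuous [f] the two conditions determine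
    it at nonnegative times, and identities between integrals are proved by comparing right
    derivatives through [prim_unique]. *)
Definition prim f : R -> V := xget (fun _ => 0) [set F | F 0 = 0 /\ is_deriv0 F f].

Lemma primP f : cont0 f -> prim f 0 = 0 /\ is_deriv0 (prim f) f.
Proof.
by move=> /prim_exists[F HF]; rewrite /prim; case: xgetP => [G -> //|/(_ F)[]].
Qed.
Lemma prim0 f : cont0 f -> prim f 0 = 0. Proof. by move=> /primP[]. Qed.
Lemma prim_deriv f : cont0 f -> is_deriv0 (prim f) f. Proof. by move=> /primP[]. Qed.
Lemma prim_cont f : cont0 f -> cont0 (prim f).
Proof. by move=> /prim_deriv; exact: is_deriv0_cont. Qed.

Lemma prim_unique f (F F' : R -> V) a : cont0 f -> cont0 F -> F 0 = 0 ->
  (forall s, 0 <= s -> s < a -> rderiv F s (F' s)) ->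
  (forall s, 0 <= s -> s < a -> F' s = f s) ->
  forall t, 0 <= t -> t <= a -> F t = prim f t.
Proof.
move=> cf cF F0 dF Ff; apply: (deriv_unique cF (prim_cont cf) dF _ Ff).
  by move=> s s0 sa; apply: is_deriv0_rderiv => //; exact: prim_deriv.
by rewrite prim0.
Qed.

Lemma prim_bound f (g g' : R -> R) a b : cont0 f -> is_deriv0 (V := R) g g' ->
  0 <= a -> a <= b -> (forall s, a <= s -> s < b -> `|f s| <= g' s) ->
  `|prim f b - prim f a| <= g b - g a.
Proof.
move=> cf dg a0 ab le; apply: (mean_value_rderiv (prim_cont cf) dg a0 ab _ le).
by move=> s as_ sb; apply: is_deriv0_rderiv; [exact: prim_deriv|lra].
Qed.

Lemma prim_bound_cst f (k : R) a b : cont0 f -> 0 <= a -> a <= b ->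
  (forall s, a <= s -> s < b -> `|f s| <= k) ->
  `|prim f b - prim f a| <= k * (b - a).
Proof.
move=> cf a0 ab le.
have := @prim_bound f (fun t => k * t) (fun _ => k * 1) a b cf.
rewrite -mulrBr; apply => //; first exact: (@is_deriv0Z R R^o k _ _ (@is_deriv0_id R)).
by move=> s as_ sb; rewrite mulr1 le.
Qed.

Lemma primD f g t : cont0 f -> cont0 g -> 0 <= t ->
  prim (fun s => f s + g s) t = prim f t + prim g t.
Proof.
move=> cf cg t0; symmetry.
have d := is_deriv0D (prim_deriv cf) (prim_deriv cg).
apply: (@prim_unique _ (fun t => prim f t + prim g t) (fun t => f t + g t) t) => //.
- exact: cont0D.
- exact: is_deriv0_cont d.
- by rewrite !prim0// addr0.
- by move=> s s0 _; exact: is_deriv0_rderiv d s0.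
Qed.

End Primitive.

Lemma prim_lin (R : realType) (V W : completeNormedModType R) (K : V -> W) f t :
  bounded_linear K -> cont0 f -> 0 <= t -> prim (K \o f) t = K (prim f t).
Proof.
move=> bK cf t0; symmetry.
have d := is_deriv0_lin bK (prim_deriv cf).
apply: (@prim_unique _ _ _ (K \o prim f) (K \o f) t) => //.
- exact: cont0_comp bK.2.
- exact: is_deriv0_cont d.
- by rewrite /= prim0// (lin0 bK.1).
- by move=> s s0 _; exact: is_deriv0_rderiv d s0.
Qed.

Lemma prim_ext (R : realType) (V : completeNormedModType R) (f g : R -> V) t : cont0 f -> cont0 g ->
  0 <= t -> (forall s, 0 <= s -> s < t -> f s = g s) -> prim f t = prim g t.
Proof.
move=> cf cg t0 fg.
apply: (@prim_unique _ _ _ (prim f) f t) => //.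
- exact: prim_cont.
- exact: prim0.
- by move=> r r0 _; exact: (is_deriv0_rderiv (prim_deriv cf) r0).
Qed.

Lemma primB (R : realType) (V : completeNormedModType R) (f g : R -> V) t : cont0 f -> cont0 g ->
  0 <= t -> prim (fun s => f s - g s) t = prim f t - prim g t.
Proof.
move=> cf cg t0; have d := is_deriv0B (prim_deriv cf) (prim_deriv cg).
symmetry; apply: (@prim_unique _ _ _ (fun t => prim f t - prim g t) (fun t => f t - g t) t) => //.
- exact: cont0B.
- exact: is_deriv0_cont d.
- by rewrite !prim0// subr0.
- by move=> s s0 _; exact: is_deriv0_rderiv d s0.
Qed.

(** * Strongly continuous semigroups *)

Section Semigroup.
Variables (R : realType) (X : completeNormedModType R) (T : R -> X -> X).

Definition glim (x l : X) := forall e : R, 0 < e ->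
  exists2 d : R, 0 < d & forall h, 0 < h -> h < d -> `|T h x - x - h *: l| <= e * h.

Lemma glim_unique x l m : glim x l -> glim x m -> l = m.
Proof.
move=> Hl Hm; apply/eqP; rewrite -subr_eq0 -normr_le0; apply/ler_addgt0Pr => e e0.
have [d1 d10 H1] := Hl (e / 2) ltac:(lra).
have [d2 d20 H2] := Hm (e / 2) ltac:(lra).
pose h := Num.min d1 d2 / 2.
have m0 : 0 < Num.min d1 d2 by rewrite lt_min d10.
have h0 : 0 < h by rewrite divr_gt0.
have hm : h < Num.min d1 d2 by rewrite /h; lra.
move: hm; rewrite lt_min => /andP[/(H1 h h0) h1 /(H2 h h0) h2].
rewrite -(ler_pM2l h0) -[X in X * `|_|](gtr0_norm h0) -normrZ.
have -> : h *: (l - m) = (T h x - x - h *: m) - (T h x - x - h *: l) by lmod R.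
by apply: (le_trans (ler_normB _ _)); lra.
Qed.

Hypothesis sgT : C0_semigroup T.

Lemma sg_lin t : 0 <= t -> is_linear (T t).
Proof. by case: sgT => h _ _ _ t0; exact: (h t t0).1. Qed.
Lemma sg_blin t : 0 <= t -> bounded_linear (T t).
Proof. by case: sgT => h _ _ _ t0; exact: h. Qed.
Lemma sg0 x : T 0 x = x. Proof. by case: sgT. Qed.
Lemma sgD s t x : 0 <= s -> 0 <= t -> T (s + t) x = T s (T t x).
Proof. by case: sgT => _ _ h _; exact: h. Qed.
Lemma sg_cont x : cont0 (fun t => T t x). Proof. by case: sgT. Qed.
Arguments sg_cont x : clear implicits.

Lemma sgC s t x : 0 <= s -> 0 <= t -> T s (T t x) = T t (T s x).
Proof. by move=> s0 t0; rewrite -!sgD// addrC. Qed.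

(** Orbits are bounded on [[0, 1]], so uniform boundedness gives one constant [M >= 1] there.
    Splitting off the integer part [n] of [t] gives [M * M ^+ n], which is at most
    [M * expR (ln M * t)]. *)
Lemma sg_growth : exists M w : R, [/\ 1 <= M, 0 <= w &
  forall t x, 0 <= t -> `|T t x| <= M * expR (w * t) * `|x|].
Proof.
have [] := @Banach_Steinhauss R X X [set f | exists2 t, 0 <= t <= 1 & f = T t] _ _ 1.
- move=> _ [t /andP[t0 t1] ->]; split; last exact: sg_lin.
  have [M M0 HM] := bounded_linear_bound (sg_blin t0).
  move=> r; exists (M * r) => x xr; apply: (le_trans (HM _)).
  by rewrite ler_pM2l.
- move=> x; have [M M0 HM] := cont0_bounded 1 (sg_cont x).
  by exists M => _ [t /andP[t0 t1] ->]; exact: HM.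
move=> M0 HM0; pose M := Num.max M0 1.
have M1 : 1 <= M by rewrite le_max lexx orbT.
have Mp : 0 < M by exact: lt_le_trans M1.
have HM t x : 0 <= t -> t <= 1 -> `|T t x| <= M * `|x|.
  move=> t0 t1; have [->|x0] := eqVneq x 0.
    by rewrite lin0 ?normr0 ?mulr0//; exact: sg_lin.
  have nx : 0 < `|x| by rewrite normr_gt0.
  have tI : 0 <= t <= 1 by rewrite t0.
  have := HM0 (T t) (ex_intro2 _ _ t tI erefl) (`|x|^-1 *: x).
  rewrite normrZ normfV normr_id mulVf ?gt_eqF// => /(_ (lexx _)).
  rewrite linZ; last exact: sg_lin.
  rewrite normrZ normfV normr_id => h.
  rewrite -ler_pdivrMr// mulrC; apply: (le_trans h).
  by rewrite le_max lexx.
exists M, (ln M); split => //; first exact: ln_ge0.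
move=> t x t0.
have key (n : nat) s : 0 <= s -> s <= 1 -> `|T (n%:R + s) x| <= M * M ^+ n * `|x|.
  move=> s0 s1; elim: n => [|n IH]; first by rewrite add0r expr0 mulr1; exact: HM.
  rewrite -natr1 -addrA addrCA sgD//; last by rewrite addr_ge0.
  by rewrite exprS -!mulrA (mulrA M (M ^+ n)); apply: (le_trans (HM _ _ _ _)) => //; rewrite ler_pM2l.
pose n := Num.trunc t.
have /andP[nt tn] := truncn_itv t0.
have := key n (t - n%:R); rewrite subrKC => /(_ _ _)/le_trans; apply.
- by rewrite subr_ge0.
- by move: tn; rewrite -natr1 -/n; lra.
rewrite ler_wpM2r// ler_pM2l// -[M in M ^+ n]lnK ?posrE// -expRM_natl.
by rewrite ler_expR mulrC ler_wpM2l// ln_ge0.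
Qed.

Lemma sg_bounded a : exists2 M : R, 0 < M & forall t x, 0 <= t -> t <= a ->
  `|T t x| <= M * `|x|.
Proof.
have [M [w [M1 w0 H]]] := sg_growth.
have M0 : 0 < M by exact: lt_le_trans M1.
exists (M * expR (w * a)); first by rewrite mulr_gt0// expR_gt0.
move=> t x t0 ta; apply: (le_trans (H t x t0)).
by rewrite ler_wpM2r// ler_pM2l// ler_expR ler_wpM2l.
Qed.

Lemma cont0_sg (a : R -> R) (f : R -> X) : cont0 (V := R) a ->
  (forall s, 0 <= s -> 0 <= a s) -> cont0 f -> cont0 (fun s => T (a s) (f s)).
Proof. exact: (cont0_family sg_lin sg_bounded sg_cont). Qed.

(** The integrated semigroup. Its values lie in the domain of the generator for every [x], so it
    supplies the elements of the domain. *)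
Definition sgV t x := prim (fun s => T s x) t.

Lemma sgV0 x : sgV 0 x = 0. Proof. exact: prim0 (sg_cont x). Qed.

Lemma sgV_deriv x : is_deriv0 (fun t => sgV t x) (fun t => T t x).
Proof. exact: prim_deriv (sg_cont x). Qed.
Arguments sgV_deriv x : clear implicits.

Lemma sgV_cont x : cont0 (fun t => sgV t x). Proof. exact: prim_cont (sg_cont x). Qed.
Arguments sgV_cont x : clear implicits.

Lemma sgV_shift s t x : 0 <= s -> 0 <= t -> sgV (s + t) x - sgV s x = sgV t (T s x).
Proof.
move=> s0 t0.
have d : is_deriv0 (fun t => sgV (s + t) x - sgV s x) (fun t => T t (T s x)).
  apply/is_deriv0P => r r0 e e0.
  have sr0 : 0 <= s + r by lra.
  have [d d0 H] := (is_deriv0P _ _).1 (prim_deriv (sg_cont x)) (s + r) sr0 e e0.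
  exists d => // q q0 qr; have := H (s + q) ltac:(lra).
  have -> : s + q - (s + r) = q - r by lra.
  rewrite [s + r]addrC sgD// => /(_ qr); rewrite -/(sgV _ _) [r + s]addrC.
  by have -> : sgV (s + q) x - sgV (s + r) x =
    sgV (s + q) x - sgV s x - (sgV (s + r) x - sgV s x) by lmod R.
apply: (@prim_unique _ _ (fun t => T t (T s x)) (fun t => sgV (s + t) x - sgV s x) (fun t => T t (T s x)) t) => //.
- exact: sg_cont.
- exact: is_deriv0_cont d.
- by rewrite addr0 subrr.
- by move=> r r0 _; exact: is_deriv0_rderiv d r0.
Qed.

Lemma sgV_comm s t x : 0 <= s -> 0 <= t -> T s (sgV t x) = sgV t (T s x).
Proof.
move=> s0 t0; have d := is_deriv0_lin (sg_blin s0) (sgV_deriv x).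
apply: (@prim_unique _ _ _ (T s \o sgV^~ x) (T s \o T^~ x) t) => //.
- exact: sg_cont.
- exact: is_deriv0_cont d.
- by rewrite /= sgV0 (lin0 (sg_lin s0)).
- by move=> r r0 _; exact: is_deriv0_rderiv d r0.
- by move=> r r0 _; exact: sgC.
Qed.

Lemma sgV_lin t : 0 <= t -> is_linear (sgV t).
Proof.
move=> t0 a u v; symmetry.
have d := is_deriv0D (@is_deriv0Z _ _ a _ _ (sgV_deriv u)) (sgV_deriv v).
apply: (@prim_unique _ _ _ (fun t => a *: sgV t u + sgV t v) (fun t => a *: T t u + T t v) t) => //.
- exact: sg_cont.
- exact: is_deriv0_cont d.
- by rewrite !sgV0 scaler0 addr0.
- by move=> s s0 _; exact: is_deriv0_rderiv d s0.
- by move=> s s0 _; rewrite (sg_lin s0).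
Qed.

Lemma sgV_bound a : exists2 M : R, 0 < M & forall t x, 0 <= t -> t <= a ->
  `|sgV t x| <= M * t * `|x|.
Proof.
have [M M0 HM] := sg_bounded a; exists M => // t x t0 ta.
have := @prim_bound_cst _ _ (fun s => T s x) (M * `|x|) 0 t (sg_cont x) (lexx _) t0.
rewrite prim0; last exact: sg_cont.
rewrite !subr0 mulrAC; apply=> s s0 st; apply: HM => //; lra.
Qed.

Lemma sgV_blin t : 0 <= t -> bounded_linear (sgV t).
Proof.
move=> t0; have [M M0 HM] := sgV_bound t.
by apply: (bounded_linear_intro (sgV_lin t0) (M := M * t)) => x; exact: HM.
Qed.

(** [T h] shifts the interval of integration, so the difference [T h (sgV t x) - sgV t x] is the
    increment of [sgV] at [t] minus its increment at 0. *)
Lemma sgV_glim t x : 0 <= t -> glim (sgV t x) (T t x - x).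
Proof.
move=> t0 e e0.
have dV := sgV_deriv x.
have [d1 d10 H1] := is_deriv0_rderiv dV t0 (e := e / 2) ltac:(lra).
have [d2 d20 H2] := is_deriv0_rderiv dV (lexx 0) (e := e / 2) ltac:(lra).
exists (Num.min d1 d2); first by rewrite lt_min d10.
move=> h h0; rewrite lt_min => /andP[/(H1 h h0) + /(H2 h h0)].
rewrite add0r sg0 sgV0 => h1 h2.
rewrite sgV_comm//; last exact: ltW.
rewrite -sgV_shift//; last exact: ltW.
rewrite [h + t]addrC.
have -> : sgV (t + h) x - sgV h x - sgV t x - h *: (T t x - x) =
  (sgV (t + h) x - sgV t x - h *: T t x) - (sgV h x - 0 - h *: x) by lmod R.
by apply: (le_trans (ler_normB _ _)); lra.
Qed.

(* [sgV h / h] tends strongly to the identity, hence [T h w - w = sgV h y]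
   exhibits [w] as a point of the domain with image [y]. *)
Lemma glim_of_sgV w y : (forall h, 0 < h -> T h w - w = sgV h y) -> glim w y.
Proof.
move=> H e e0.
have [d d0 Hd] := is_deriv0_rderiv (sgV_deriv y) (lexx 0) e0.
exists d => // h h0 hd; have := Hd h h0 hd.
by rewrite add0r sg0 sgV0 subr0 H.
Qed.

End Semigroup.
Arguments sg_cont {R X T} sgT x.
Arguments sgV_cont {R X T} sgT x.
Arguments sgV_deriv {R X T} sgT x.

Section Generator.
Variables (R : realType) (X : completeNormedModType R).
Variables (D : set X) (A : X -> X) (T : R -> X -> X).
Hypothesis hG : generator D A T.

Let sgT : C0_semigroup T := hG.1.

Lemma genP x : D x -> glim T x (A x).
Proof. by case: (hG.2 x) => _ H Dx; apply/gen_limP; exact: H. Qed.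

Lemma gen_intro x l : glim T x l -> D x /\ A x = l.
Proof.
move=> H; have Dx : D x by apply/(hG.2 x).1; exists l; apply/gen_limP.
by split=> //; exact: glim_unique (genP Dx) H.
Qed.

Lemma gen_lin a x y : D x -> D y -> D (a *: x + y) /\ A (a *: x + y) = a *: A x + A y.
Proof.
move=> Dx Dy; apply: gen_intro => e e0.
have a0 : 0 < `|a| + 1 by rewrite ltr_wpDl.
have [d1 d10 H1] := genP Dx (e := e / 2 / (`|a| + 1)) ltac:(by rewrite divr_gt0//; lra).
have [d2 d20 H2] := genP Dy (e := e / 2) ltac:(lra).
exists (Num.min d1 d2); first by rewrite lt_min d10.
move=> h h0; rewrite lt_min => /andP[/(H1 h h0) h1 /(H2 h h0) h2].
rewrite (sg_lin sgT)//; last exact: ltW.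
have -> : a *: T h x + T h y - (a *: x + y) - h *: (a *: A x + A y) =
  a *: (T h x - x - h *: A x) + (T h y - y - h *: A y) by lmod R.
apply: (le_trans (ler_normD _ _)); rewrite normrZ.
have : `|a| * `|T h x - x - h *: A x| <= e / 2 * h.
  move: h1; rewrite mulrAC ler_pdivlMr// mulrC.
  by apply: le_trans; rewrite ler_wpM2r//; lra.
lra.
Qed.

Lemma gen0 : D 0 /\ A 0 = 0.
Proof.
apply: gen_intro => e e0; exists 1 => // h h0 _.
rewrite lin0; last by apply: (sg_lin sgT); exact: ltW.
by rewrite scaler0 !subr0 normr0 mulr_ge0// ltW.
Qed.

Lemma genZ a x : D x -> D (a *: x) /\ A (a *: x) = a *: A x.
Proof. by move=> Dx; have [] := gen_lin a Dx gen0.1; rewrite gen0.2 !addr0. Qed.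

Lemma genD x y : D x -> D y -> D (x + y) /\ A (x + y) = A x + A y.
Proof. by move=> Dx Dy; have [] := gen_lin 1 Dx Dy; rewrite !scale1r. Qed.

Lemma genB x y : D x -> D y -> D (x - y) /\ A (x - y) = A x - A y.
Proof.
by move=> Dx Dy; have [] := gen_lin (-1) Dy Dx; rewrite !scaleN1r ![- _ + _]addrC.
Qed.

Lemma gen_sgV t x : 0 <= t -> D (sgV T t x) /\ A (sgV T t x) = T t x - x.
Proof. by move=> t0; apply: gen_intro; exact: sgV_glim. Qed.

Lemma gen_sg t x : 0 <= t -> D x -> D (T t x) /\ A (T t x) = T t (A x).
Proof.
move=> t0 Dx; apply: gen_intro => e e0.
have [M M0 HM] := bounded_linear_bound (sg_blin sgT t0).
have lT := sg_lin sgT t0.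
have [d d0 H] := genP Dx (e := e / M) ltac:(exact: divr_gt0).
exists d => // h h0 hd; rewrite (sgC sgT)//; last exact: ltW.
rewrite -linB// -linZ// -linB//; apply: (le_trans (HM _)).
by have := H h h0 hd; rewrite mulrAC ler_pdivlMr// mulrC.
Qed.

Lemma orbit_prim t x : 0 <= t -> D x -> T t x = x + sgV T t (A x).
Proof.
move=> t0 Dx; apply/eqP; rewrite addrC -subr_eq; apply/eqP.
apply: (@prim_unique _ _ _ (fun t => T t x - x) (fun t => T t (A x)) t) => //.
- exact: sg_cont.
- by apply: cont0B; [exact: sg_cont|exact: cont0_cst].
- by rewrite sg0// subrr.
move=> s s0 _ e e0; have [Ds As] := gen_sg s0 Dx.
have [d d0 H] := genP Ds e0; exists d => // h h0 hd.
have := H h h0 hd; rewrite As.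
rewrite [s + h]addrC (sgD sgT)//; last exact: ltW.
by have -> : T h (T s x) - x - (T s x - x) = T h (T s x) - T s x by lmod R.
Qed.

Lemma orbit_deriv x : D x -> is_deriv0 (fun t => T t x) (fun t => T t (A x)).
Proof.
move=> Dx; apply: (@is_deriv0_ext _ _ (fun t => x + sgV T t (A x)) (fun t => 0 + T t (A x))).
- by move=> t t0; rewrite -orbit_prim.
- by move=> t _; rewrite add0r.
- apply: is_deriv0D; first exact: is_deriv0_cst.
  exact: prim_deriv (sg_cont sgT (A x)).
Qed.

Lemma sgV_gen t x : 0 <= t -> D x -> sgV T t (A x) = T t x - x.
Proof. by move=> t0 Dx; rewrite (orbit_prim t0 Dx) addrC addKr. Qed.

(** The curve [T (t - s) (z s)] joins [T t (z 0)] to [z t], and the terms with [A] cancel in its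
    right derivative, which is [T (t - s) (f s)]. The majorant [g] lets the mean value inequality
    apply directly. *)
Lemma duhamel (z f : R -> X) t : cont0 z -> 0 <= t -> (forall s, 0 <= s -> D (z s)) ->
  (forall s, 0 <= s -> rderiv z s (A (z s) + f s)) ->
  forall g g' : R -> R, is_deriv0 (V := R) g g' ->
  (forall s, 0 <= s -> s < t -> `|T (t - s) (f s)| <= g' s) ->
  `|z t - T t (z 0)| <= g t - g 0.
Proof.
move=> cz t0 Dz dz g g' dg Hg.
have c1 := @cont0_pos_sub R t.
have c0 s : 0 <= s -> 0 <= Num.max 0 (t - s) by rewrite le_max lexx.
have := @mean_value_rderiv _ _ (fun s => T (Num.max 0 (t - s)) (z s)) (fun s => T (t - s) (f s)) g g' 0 t.
rewrite subrr maxxx sg0// subr0 max_r//; apply=> //.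
  exact: cont0_sg.
move=> s s0 st e e0; have ts0 : 0 < t - s by lra.
have [M M0 HM] := sg_bounded sgT t.
have e3 : 0 < e / 3 / M by rewrite divr_gt0//; lra.
have [d1 d10 H1] := dz s s0 _ e3.
have [d2 d20 H2] := genP (Dz s s0) e3.
have [d3 d30 H3] := (cont0P _).1 (sg_cont sgT (f s)) 0 (lexx _) _ e3.
exists (Num.min (Num.min d1 d2) (Num.min d3 (t - s))).
  by rewrite !lt_min d10 d20 d30.
move=> h h0; rewrite !lt_min => /andP[/andP[/(H1 h h0) h1 /(H2 h h0) h2] /andP[h3 h4]].
have h00 := ltW h0.
have := H3 h h00; rewrite subr0 (gtr0_norm h0) sg0// => /(_ h3) h3'.
have r0 : 0 <= t - s - h by lra.
rewrite !max_r; [|lra|lra].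
(* Everything is pulled behind [T (t - s - h)], which is bounded by [M], so that only right-sided
   limits at [s] are needed. *)
have -> : t - (s + h) = t - s - h by lra.
have -> : T (t - s) (z s) = T (t - s - h) (T h (z s)) by rewrite -sgD// subrK.
have -> : T (t - s) (f s) = T (t - s - h) (T h (f s)) by rewrite -sgD// subrK.
have lT := sg_lin sgT r0.
rewrite -linB// -linZ// -linB//.
have -> : z (s + h) - T h (z s) - h *: T h (f s) =
   (z (s + h) - z s - h *: (A (z s) + f s)) - (T h (z s) - z s - h *: A (z s))
   - h *: (T h (f s) - f s) by lmod R.
apply: (le_trans (HM _ _ r0 _)); first by lra.
move: h1 h2 h3'.
set a := z (s + h) - z s - _; set b := T h (z s) - _ - _; set c := T h (f s) - f s => h1 h2 h3'.
have := ler_normB (a - b) (h *: c); have := ler_normB a b; rewrite normrZ (gtr0_norm h0).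
have : h * `|c| <= h * (e / 3 / M) by rewrite ler_pM2l.
move=> q1 q2 q3.
have : `|a - b - h *: c| <= 3 * (e / 3 / M) * h by lra.
have -> : 3 * (e / 3 / M) * h = e * h / M by field; rewrite gt_eqF.
by rewrite ler_pdivlMr// mulrC.
Qed.

End Generator.

Lemma cauchy_geo (R : realType) (V : completeNormedModType R) (u : nat -> V) (c : R) : 0 <= c ->
  (forall n, `|u n.+1 - u n| <= c * 2^-1 ^+ n) ->
  exists l, forall n, `|u n - l| <= 2 * c * 2^-1 ^+ n.
Proof.
move=> c0 H.
have half n : 0 < 2^-1 ^+ n :> R by rewrite exprn_gt0// invr_gt0.
have K n m : `|u (n + m)%N - u n| <= 2 * c * (2^-1 ^+ n - 2^-1 ^+ (n + m)).
  elim: m => [|m IH]; first by rewrite addn0 !subrr normr0 mulr0.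
  rewrite addnS; have := H (n + m)%N.
  have := ler_normD (u (n + m).+1 - u (n + m)%N) (u (n + m)%N - u n); rewrite subrKA.
  rewrite [in X in _ -> _ -> _ <= X]exprS; move: (2^-1 ^+ (n + m)) IH => q; lra.
have K2 n m : (n <= m)%N -> `|u m - u n| <= 2 * c * 2^-1 ^+ n.
  move=> nm; rewrite -(subnKC nm); apply: (le_trans (K _ _)).
  by rewrite ler_wpM2l ?mulr_ge0// lerBlDr lerDl ltW.
have [|l Hl] := @cauchy_seq R V u.
  move=> e e0; have [N HN] := @geometric_small R (2 * c) (e / 2) ltac:(lra) ltac:(lra).
  exists N => n m nN mN; have := K2 N n nN; have := K2 N m mN.
  have := ler_normB (u n - u N) (u m - u N); rewrite opprB addrA subrK; lra.
exists l => n; apply/ler_addgt0Pr => e e0; have [N HN] := Hl e e0.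
have := HN (maxn N n) (leq_maxl _ _); have := K2 n (maxn N n) (leq_maxr _ _).
have := ler_normB (u (maxn N n) - l) (u (maxn N n) - u n).
have -> : u (maxn N n) - l - (u (maxn N n) - u n) = u n - l by lmod R.
lra.
Qed.

(** * Mild solutions and bounded perturbations *)

Section Convolution.
Variables (R : realType) (X : completeNormedModType R).
Variables (T : R -> X -> X).
Hypothesis sgT : C0_semigroup T.
Implicit Types g : R -> X.

Local Notation pos t s := (Num.max (0 : R) (t - s)).
Let pos_ge0 t s : 0 <= pos t s. Proof. by rewrite le_max lexx. Qed.
Let posE t s : s <= t -> pos t s = t - s. Proof. by move=> st; rewrite max_r//; lra. Qed.

(** The forced response in the variation of constants formula; [convV] is its analogue for the
    integrated semigroup. *)
Definition conv g t := prim (fun s => T (Num.max 0 (t - s)) (g s)) t.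
Definition convV g t := prim (fun s => sgV T (Num.max 0 (t - s)) (g s)) t.

Lemma conv_kernel g t : cont0 g -> cont0 (fun s => T (pos t s) (g s)).
Proof.
move=> cg; apply: cont0_sg => //; exact: cont0_pos_sub.
Qed.
Arguments conv_kernel {g} t _.

Lemma convV_kernel g t : cont0 g -> cont0 (fun s => sgV T (pos t s) (g s)).
Proof.
move=> cg; apply: cont0_family => //.
- exact: sgV_lin.
- move=> b; have [M M0 HM] := sgV_bound sgT b.
  have b1 : 0 < `|b| + 1 by rewrite ltr_wpDl.
  exists (M * (`|b| + 1)); first exact: mulr_gt0.
  move=> s x s0 sb; apply: (le_trans (HM _ _ s0 sb)).
  by rewrite ler_wpM2r// ler_pM2l//; have := ler_norm b; lra.
- exact: sgV_cont.
- exact: cont0_pos_sub.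
Qed.
Arguments convV_kernel {g} t _.

Lemma conv_bound g t (G G' : R -> R) : cont0 g -> 0 <= t -> is_deriv0 (V := R) G G' ->
  (forall s, 0 <= s -> s < t -> `|T (t - s) (g s)| <= G' s) ->
  `|conv g t| <= G t - G 0.
Proof.
move=> cg t0 dG H; have ck := conv_kernel t cg.
have := prim_bound ck dG (lexx _) t0; rewrite prim0// subr0; apply.
by move=> s s0 st; rewrite posE; [exact: H|exact: ltW].
Qed.

Lemma conv_sub g1 g2 t : cont0 g1 -> cont0 g2 -> 0 <= t ->
  conv g1 t - conv g2 t = conv (fun s => g1 s - g2 s) t.
Proof.
move=> c1 c2 t0; rewrite /conv -primB//; try exact: conv_kernel.
apply: prim_ext => //; first by apply: cont0B; exact: conv_kernel.
  by apply: conv_kernel; exact: cont0B.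
by move=> s s0 st; rewrite (linB (sg_lin sgT (pos_ge0 t s))).
Qed.

(** [T (t - r) (conv g r)] is the contribution of [[0, r]] to [conv g t], so the difference is an
    integral over [[r, t]]. *)
Lemma conv_split g a : cont0 g -> exists2 C : R, 0 < C & forall r t, 0 <= r -> r <= t ->
  t <= a -> `|conv g t - T (t - r) (conv g r)| <= C * (t - r).
Proof.
move=> cg; have [M M0 HM] := sg_bounded sgT a; have [G G0 HG] := cont0_bounded a cg.
exists (M * G); first exact: mulr_gt0.
move=> r t r0 rt ta; have t0 := le_trans r0 rt.
have tr0 : 0 <= t - r by rewrite subr_ge0.
have -> : T (t - r) (conv g r) = prim (fun s => T (pos t s) (g s)) r.
  rewrite /conv -prim_lin//; [|exact: sg_blin|exact: conv_kernel].
  apply: prim_ext => //; [|exact: conv_kernel|].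
    by apply: cont0_comp (conv_kernel r cg) (sg_blin sgT tr0).2.
  move=> s s0 sr /=; rewrite !posE; [|lra|lra].
  by rewrite -sgD//; [congr T; lra|lra].
apply: prim_bound_cst => //; first exact: conv_kernel.
move=> s rs st; rewrite posE; last exact: ltW.
apply: (le_trans (HM _ _ _ _)); [lra|lra|].
by rewrite ler_pM2l// HG//; lra.
Qed.

(** [conv_split] only looks forward, so the values at [s] and [t] are both compared with the free
    orbit of [conv g r] for an [r] slightly before them. *)
Lemma conv_cont g : cont0 g -> cont0 (conv g).
Proof.
move=> cg; apply/cont0P => t t0 e e0.
have [C C0 HC] := conv_split (t + 1) cg.
pose n := e / 4 / C.
have n0 : 0 < n by rewrite !divr_gt0.
pose r := Num.max 0 (t - n).
have r0 : 0 <= r by rewrite le_max lexx.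
have rt : r <= t by rewrite ge_max t0 /=; lra.
have rn : t - n <= r by rewrite le_max lexx orbT.
have tr0 : 0 <= t - r by lra.
have [d d0 Hd] := (cont0P _).1 (sg_cont sgT (conv g r)) (t - r) tr0 (e / 4) ltac:(lra).
exists (Num.min d (Num.min n 1)); first by rewrite !lt_min d0 n0 /=.
move=> s s0; rewrite !lt_min !ltr_norml => /and3P[/andP[h1 h1'] /andP[h2 h2'] /andP[h3 h3']].
have rs : r <= s by rewrite ge_max s0 /=; lra.
have k1 := HC r s r0 rs ltac:(lra); have k2 := HC r t r0 rt ltac:(lra).
have k3 := Hd (s - r) ltac:(lra) ltac:(rewrite ltr_norml; apply/andP; split; lra).
have k4 : C * (s - r) <= C * (2 * n) by rewrite ler_pM2l//; lra.
have k5 : C * (t - r) <= C * n by rewrite ler_pM2l//; lra.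
have k6 : C * n = e / 4 by rewrite /n mulrC divfK// gt_eqF.
have -> : conv g s - conv g t = (conv g s - T (s - r) (conv g r))
  + (T (s - r) (conv g r) - T (t - r) (conv g r)) - (conv g t - T (t - r) (conv g r)) by lmod R.
move: k1 k2 k3; set x := conv g s - _; set y := conv g t - _; set z := T (s - r) _ - _.
move=> k1 k2 k3.
have := ler_normB (x + z) y; have := ler_normD x z.
by move: k4; rewrite mulrCA k6; lra.
Qed.

(** By [sgV_shift] the remainder is the integral of [sgV T (t + h - s) (g s)] over [[t, t + h]]. The
    integrand is itself of order [h], whence the square. *)
Lemma convV_increment g a : cont0 g -> exists2 C : R, 0 < C & forall t h, 0 <= t -> 0 <= h ->
  t + h <= a -> `|convV g (t + h) - convV g t - sgV T h (conv g t)| <= C * h * h.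
Proof.
move=> cg; have [M M0 HM] := sgV_bound sgT a; have [G G0 HG] := cont0_bounded a cg.
exists (M * G); first exact: mulr_gt0.
move=> t h t0 h0 tha.
have th0 : 0 <= t + h by lra.
have -> : sgV T h (conv g t) = prim (fun s => sgV T (pos (t + h) s) (g s)) t - convV g t.
  rewrite /convV -primB//; try exact: convV_kernel.
  rewrite /conv -prim_lin//; [|exact: sgV_blin|exact: conv_kernel].
  apply: prim_ext => //.
  - by apply: cont0_comp (conv_kernel t cg) (sgV_blin sgT h0).2.
  - by apply: cont0B; exact: convV_kernel.
  move=> s s0 st /=; rewrite !posE; [|lra|lra].
  have -> : t + h - s = (t - s) + h by lra.
  by rewrite sgV_shift//; lra.
have -> : convV g (t + h) - convV g t -
    (prim (fun s => sgV T (pos (t + h) s) (g s)) t - convV g t) =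
    convV g (t + h) - prim (fun s => sgV T (pos (t + h) s) (g s)) t by lmod R.
have := @prim_bound_cst _ _ (fun s => sgV T (pos (t + h) s) (g s)) (M * h * G) t (t + h)
  (convV_kernel (t + h) cg) t0.
rewrite addrAC subrr add0r => /(_ _ _)/le_trans; apply.
- lra.
- move=> s ts st; rewrite posE; last exact: ltW.
  apply: (le_trans (HM _ _ _ _)); [lra|lra|].
  apply: ler_pM => //; [|rewrite ler_pM2l//; lra|apply: HG; lra].
  by rewrite mulr_ge0//; lra.
- by rewrite [M * h * G]mulrAC.
Qed.

(** An interchange of integrations without double integrals: by the quadratic remainder, [convV g]
    has right derivative [conv g]. *)
Lemma convV_prim g t : cont0 g -> 0 <= t -> convV g t = prim (conv g) t.
Proof.
move=> cg t0; have cc := conv_cont cg.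
have c0 : convV g 0 = 0 by apply: prim0; exact: (convV_kernel 0 cg).
apply: (@prim_unique _ _ _ (convV g) (conv g) (t + 1)) => //; last by lra.
- apply/cont0P => s s0 e e0.
  have [C C0 HC] := convV_increment (s + 1) cg.
  have [M M0 HM] := sgV_bound sgT (s + 1).
  have [G G0 HG] := cont0_bounded (s + 1) cc.
  have L x y : 0 <= x -> x <= y -> y <= s + 1 -> y - x <= 1 ->
     `|convV g y - convV g x| <= (C + M * G) * (y - x).
    move=> x0 xy ys yx; have yx0 : 0 <= y - x by lra.
    have := HC x (y - x) x0 yx0; rewrite subrKC => /(_ ys) h1.
    have h2 := HM (y - x) (conv g x) yx0 ltac:(lra).
    have h3 : M * (y - x) * `|conv g x| <= M * (y - x) * G.
      by rewrite ler_wpM2l ?mulr_ge0// ?(ltW M0)// HG//; lra.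
    have h4 : C * (y - x) * (y - x) <= C * (y - x) * 1.
      by rewrite ler_wpM2l// mulr_ge0// ltW.
    have := ler_normD (convV g y - convV g x - sgV T (y - x) (conv g x)) (sgV T (y - x) (conv g x)).
    rewrite subrK; lra.
  have CM0 : 0 < C + M * G by rewrite addr_gt0// mulr_gt0.
  exists (Num.min 1 (e / (C + M * G))); first by rewrite lt_min ltr01 divr_gt0.
  move=> x x0; rewrite lt_min ltr_pdivlMr// => /andP[h1 h2].
  have [xs|sx] := leP s x.
    move: h1 h2; rewrite (ger0_norm (_ : 0 <= x - s)) ?subr_ge0// => h1 h2.
    by have := L s x s0 xs ltac:(lra) ltac:(lra); lra.
  move: h1 h2; rewrite distrC (gtr0_norm (_ : 0 < s - x)) ?subr_gt0// => h1 h2.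
  rewrite distrC.
  by have := L x s x0 ltac:(lra) ltac:(lra) ltac:(lra); lra.
move=> s s0 st e e0.
have [C C0 HC] := convV_increment (s + 1) cg.
have [d d0 Hd] := is_deriv0_rderiv (sgV_deriv sgT (conv g s)) (lexx 0) (e := e / 2) ltac:(lra).
exists (Num.min d (Num.min 1 (e / 2 / C))).
  by rewrite !lt_min d0 ltr01 /= !divr_gt0.
move=> h h0; rewrite !lt_min ltr_pdivlMr// => /and3P[/(Hd h h0) h1 h2 h3].
have h4 := HC s h s0 (ltW h0) ltac:(lra).
move: h1; rewrite add0r (sg0 sgT) (sgV0 sgT) subr0 => h1.
have := ler_normD (convV g (s + h) - convV g s - sgV T h (conv g s)) (sgV T h (conv g s) - h *: conv g s).
rewrite subrKA.
have : C * h * h <= e / 2 * h by rewrite ler_pM2r//; lra.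
lra.
Qed.

(** Under the integral, [T h - 1] applied to [sgV (t - s)] is [sgV h] applied to [T (t - s) - 1],
    which is the form that [glim_of_sgV] asks for. *)
Lemma convV_glim g t : cont0 g -> 0 <= t -> glim T (convV g t) (conv g t - prim g t).
Proof.
move=> cg t0; apply: (glim_of_sgV sgT) => h h0; have h00 := ltW h0.
have ck := convV_kernel t cg; have ck' := conv_kernel t cg.
have cTk : cont0 (T h \o (fun s => sgV T (pos t s) (g s))).
  exact: cont0_comp ck (sg_blin sgT h00).2.
rewrite /conv -primB// /convV -[T h _]prim_lin//; last exact: sg_blin.
rewrite -primB// -prim_lin//; [|exact: sgV_blin|exact: cont0B].
apply: prim_ext => //; first exact: cont0B.
  by apply: cont0_comp (cont0B ck' cg) (sgV_blin sgT h00).2.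
move=> s s0 st /=.
have p0 := pos_ge0 t s.
rewrite (linB (sgV_lin sgT h00)) -sgV_shift// [T h _]sgV_comm// -sgV_shift//.
by rewrite [h + _]addrC; lmod R.
Qed.

(** In the supremum norm with weight [expR (- l * s)], convolution has norm at most [M / (l - w)]. A
    large [l] thus makes the Picard map a contraction on the whole half line at once. *)
Lemma conv_weight (M w l c : R) g t : cont0 g -> 0 <= t -> 0 <= M -> w < l -> 0 <= c ->
  (forall t x, 0 <= t -> `|T t x| <= M * expR (w * t) * `|x|) ->
  (forall s, 0 <= s -> `|g s| <= c * expR (l * s)) ->
  `|conv g t| <= M * c / (l - w) * expR (l * t).
Proof.
move=> cg t0 M0 wl c0 HT Hg.
have lw : 0 < l - w by lra.
pose k := M * c / (l - w) * expR (w * t).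
have k0 : 0 <= k by rewrite !mulr_ge0 ?expR_ge0// invr_ge0 ltW.
have := @conv_bound g t (fun s => k * expR ((l - w) * s)) (fun s => k * ((l - w) * expR ((l - w) * s))) cg t0.
move=> /(_ _ _)/le_trans; apply.
- exact: (@is_deriv0Z R R^o k _ _ (@is_deriv0_expR R (l - w))).
- move=> s s0 st; apply: (le_trans (HT _ _ _)); first lra.
  have -> : k * ((l - w) * expR ((l - w) * s)) = M * expR (w * (t - s)) * (c * expR (l * s)).
    have E : expR (w * t) * expR ((l - w) * s) = expR (w * (t - s)) * expR (l * s).
      by rewrite -!expRD; congr expR; ring.
    rewrite (_ : k * _ = M * c * (expR (w * t) * expR ((l - w) * s))).
      by rewrite E; ring.
    by rewrite /k; field; lra.
  by rewrite ler_wpM2l ?Hg// mulr_ge0// expR_ge0.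
- have -> : k * expR ((l - w) * t) = M * c / (l - w) * expR (l * t).
    by rewrite /k -mulrA -expRD; congr (_ * expR _); ring.
  by rewrite lerBlDr lerDl mulr_ge0// expR_ge0.
Qed.

End Convolution.

Section Perturbation.
Variables (R : realType) (X : completeNormedModType R).
Variables (D : set X) (A : X -> X) (T : R -> X -> X) (K : X -> X).
Hypotheses (hG : generator D A T) (bK : bounded_linear K).
Let sgT : C0_semigroup T := hG.1.

Lemma mild_solution (x0 : X) : exists xi : R -> X, cont0 xi /\
  forall t, 0 <= t -> xi t = T t x0 + conv T (K \o xi) t.
Proof.
have [M [w [M1 w0 HT]]] := sg_growth sgT.
have M0 : 0 < M by exact: lt_le_trans M1.
have [k k0 HK] := bounded_linear_bound bK.
have lK := bK.1.
(* Chosen so that [M * k / (l - w)] is one half: the Picard map halves weighted distances. *)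
pose l := w + 2 * (M * k).
have Mk0 : 0 < M * k by exact: mulr_gt0.
have wl : w < l by rewrite /l; lra.
have half g c t : cont0 g -> 0 <= t -> 0 <= c ->
    (forall s, 0 <= s -> `|g s| <= c * expR (l * s)) ->
    `|conv T (K \o g) t| <= c / 2 * expR (l * t).
  move=> cg t0 c0 Hg.
  have := @conv_weight R X T sgT M w l (k * c) (K \o g) t (cont0_comp cg bK.2) t0 (ltW M0) wl.
  have -> : M * (k * c) / (l - w) = c / 2 by rewrite /l; field; lra.
  apply => //; first by rewrite mulr_ge0// ltW.
  move=> s s0; apply: (le_trans (HK _)); rewrite -mulrA ler_pM2l//; exact: Hg.
pose xi := fix xi (n : nat) : R -> X := if n is m.+1 then fun t => T t x0 + conv T (K \o xi m) t else fun _ => 0.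
have cxi n : cont0 (xi n).
  elim: n => [|n IH] /=; first exact: cont0_cst.
  apply: cont0D; first exact: sg_cont.
  by apply: conv_cont => //; apply: cont0_comp IH bK.2.
pose c := M * `|x0|.
have c0 : 0 <= c by rewrite mulr_ge0// ltW.
have conv_K0 t : 0 <= t -> conv T (K \o (fun _ => 0)) t = 0.
  move=> t0; apply/eqP; rewrite -normr_le0.
  have := @half (fun _ => 0) 0 t (@cont0_cst R X 0) t0 (lexx _).
  by rewrite !mul0r; apply=> s s0; rewrite normr0 mul0r.
have step n t : 0 <= t -> `|xi n.+1 t - xi n t| <= c * 2^-1 ^+ n * expR (l * t).
  elim: n t => [|n IH] t t0.
    rewrite /= conv_K0// addr0 subr0 expr0 mulr1.
    apply: (le_trans (HT _ _ t0)); rewrite mulrAC -/c ler_wpM2l// ler_expR.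
    by rewrite ler_wpM2r// ltW.
  have -> : xi n.+2 t - xi n.+1 t = conv T (K \o (fun s => xi n.+1 s - xi n s)) t.
    have -> : K \o (fun s => xi n.+1 s - xi n s) = fun s => (K \o xi n.+1) s - (K \o xi n) s.
      by apply/funext => s; rewrite /= linB.
    rewrite -conv_sub//; [|exact: cont0_comp (cxi n.+1) bK.2|exact: cont0_comp (cxi n) bK.2].
    by rewrite /=; lmod R.
  have := @half (fun s => xi n.+1 s - xi n s) (c * 2^-1 ^+ n) t (cont0B (cxi n.+1) (cxi n)) t0.
  rewrite exprSr mulrA; apply => //.
  by rewrite mulr_ge0// exprn_ge0// invr_ge0.
have /choice[x Hx] : forall t : R, exists v : X, 0 <= t ->
    forall n, `|xi n t - v| <= 2 * (c * expR (l * t)) * 2^-1 ^+ n.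
  move=> t; have [t0|] := leP 0 t; last by exists 0.
  have [||v Hv] := @cauchy_geo R X (fun n => xi n t) (c * expR (l * t)).
  - by rewrite mulr_ge0// ?expR_ge0.
  - by move=> n; rewrite mulrAC; exact: step.
  - by exists v.
have cx : cont0 x.
  apply/cont0P => t t0 e e0.
  pose C := 2 * (c * expR (l * (t + 1))).
  have l0 : 0 <= l by rewrite addr_ge0// mulr_ge0// ltW.
  have C0 : 0 <= C by rewrite /C; repeat apply: mulr_ge0 => //; exact: expR_ge0.
  have [n Hn] := geometric_small C0 (e := e / 3) ltac:(lra).
  have B s : 0 <= s -> s <= t + 1 -> `|xi n s - x s| <= e / 3.
    move=> s0 st; apply: (le_trans (Hx s s0 n)); apply: le_trans Hn.
    rewrite ler_wpM2r//.
    by rewrite /C ler_wpM2l// ler_wpM2l// ler_expR ler_wpM2l.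
  have [d d0 Hd] := (cont0P _).1 (cxi n) t t0 (e / 3) ltac:(lra).
  exists (Num.min d 1); first by rewrite lt_min d0 /=.
  move=> s s0; rewrite lt_min => /andP[/(Hd s s0) h1]; rewrite ltr_norml => /andP[h2 h3].
  have h4 := B s s0 ltac:(lra); have h5 := B t t0 ltac:(lra).
  have -> : x s - x t = (xi n s - xi n t) - (xi n s - x s) + (xi n t - x t) by lmod R.
  have := ler_normD ((xi n s - xi n t) - (xi n s - x s)) (xi n t - x t).
  have := ler_normB (xi n s - xi n t) (xi n s - x s).
  by lra.
exists x; split=> // t t0; apply/eqP; rewrite -subr_eq0 -normr_le0.
apply/ler_addgt0Pr => e e0; rewrite add0r.
have C0 : 0 <= 2 * (c * expR (l * t)) by repeat apply: mulr_ge0 => //; exact: expR_ge0.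
have [n Hn] := geometric_small C0 (e := e / 2) ltac:(lra).
have q0 : 0 <= 2^-1 ^+ n :> R by rewrite exprn_ge0// invr_ge0.
have h1 : `|xi n.+1 t - x t| <= e / 2.
  apply: (le_trans (Hx t t0 n.+1)); apply: le_trans Hn.
  by rewrite ler_wpM2l// exprS; lra.
have h2 : `|xi n.+1 t - (T t x0 + conv T (K \o x) t)| <= e / 2.
  have -> : xi n.+1 t - (T t x0 + conv T (K \o x) t) = conv T (K \o (fun s => xi n s - x s)) t.
    have -> : K \o (fun s => xi n s - x s) = fun s => (K \o xi n) s - (K \o x) s.
      by apply/funext => s; rewrite /= linB.
    rewrite -conv_sub//; [|exact: cont0_comp (cxi n) bK.2|exact: cont0_comp cx bK.2].
    by rewrite /=; lmod R.
  have := @half (fun s => xi n s - x s) (2 * c * 2^-1 ^+ n) t (cont0B (cxi n) cx) t0.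
  move=> /(_ _ _)/le_trans; apply.
  - by apply: mulr_ge0 => //; apply: mulr_ge0.
  - move=> s s0; apply: (le_trans (Hx s s0 n)); rewrite le_eqVlt; apply/orP; left; apply/eqP; ring.
  - have : 0 <= c * expR (l * t) * 2^-1 ^+ n by repeat apply: mulr_ge0 => //; exact: expR_ge0.
    by move: Hn; lra.
have := ler_normB (xi n.+1 t - (T t x0 + conv T (K \o x) t)) (xi n.+1 t - x t).
have -> : xi n.+1 t - (T t x0 + conv T (K \o x) t) - (xi n.+1 t - x t) =
  x t - (T t x0 + conv T (K \o x) t) by lmod R.
lra.
Qed.

(* The candidate for the derivative is the mild solution started at
   [A z0 + K z0]; its primitive is differentiable by construction and takes
   values in the domain by [convV_glim]. *)
Lemma perturbed_solution (z0 : X) : D z0 -> exists z z' : R -> X,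
  [/\ z 0 = z0, cont0 z', is_deriv0 z z',
      forall t, 0 <= t -> D (z t) & forall t, 0 <= t -> z' t = A (z t) + K (z t)].
Proof.
move=> Dz0; have lK := bK.1.
have [xi [cxi Hxi]] := mild_solution (A z0 + K z0).
have cK : cont0 (K \o xi) by apply: cont0_comp cxi bK.2.
have DA t : 0 <= t -> D (prim xi t) /\ A (prim xi t) = xi t - (A z0 + K z0) - K (prim xi t).
  move=> t0.
  have -> : prim xi t = sgV T t (A z0 + K z0) + convV T (K \o xi) t.
    rewrite convV_prim// /sgV -primD//; [|exact: sg_cont|exact: conv_cont].
    apply: prim_ext => //; first by apply: cont0D; [exact: sg_cont|exact: conv_cont].
    by move=> s s0 _; exact: Hxi.
  have [D1 A1] := gen_sgV hG (A z0 + K z0) t0.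
  have [D2 A2] := gen_intro hG (convV_glim sgT cK t0).
  have [D3 A3] := genD hG D1 D2; split=> //.
  rewrite A3 A1 A2 Hxi// prim_lin//.
  have -> : prim xi t = sgV T t (A z0 + K z0) + convV T (K \o xi) t.
    rewrite convV_prim// /sgV -primD//; [|exact: sg_cont|exact: conv_cont].
    apply: prim_ext => //; first by apply: cont0D; [exact: sg_cont|exact: conv_cont].
    by move=> s s0 _; exact: Hxi.
  by lmod R.
exists (fun t => z0 + prim xi t), xi; split=> //.
- by rewrite prim0// addr0.
- apply: (@is_deriv0_ext _ _ (fun t => z0 + prim xi t) (fun t => 0 + xi t)) => //.
    by move=> t _; rewrite add0r.
  by apply: is_deriv0D; [exact: is_deriv0_cst|exact: prim_deriv].
- by move=> t t0; have [Dp _] := DA t t0; exact: (genD hG Dz0 Dp).1.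
- move=> t t0; have [Dp Ap] := DA t t0.
  by rewrite (genD hG Dz0 Dp).2 Ap (linD lK); lmod R.
Qed.

End Perturbation.

HB.instance Definition _ (R : realType) (m n : nat) := Complete.on 'M[R]_(m, n).

(** * Finite-dimensional spaces *)

Section LinearSets.
Variables (F : fieldType) (n : nat) (S : set 'rV[F]_n).
Hypotheses (S0 : S 0) (SZ : forall a u v, S u -> S v -> S (a *: u + v)).

(** Vectors of [S] are adjoined to a matrix until none is left outside its row space; [d] bounds the
    remaining codimension. This opens rank arguments to subspaces given by a property. *)
Lemma linear_set_rowspace : exists N : 'M[F]_n, forall x, S x <-> (x <= N)%MS.
Proof.
have [d] : exists d, (n - \rank (0%R : 'M[F]_n) <= d)%N by exists n; rewrite leq_subr.
have : forall x : 'rV_n, (x <= (0%R : 'M[F]_n))%MS -> S x.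
  by move=> x; rewrite submx0 => /eqP ->.
move=> H rk; move: H rk; move: (0 : 'M[F]_n) => N.
elim: d N => [|d IH] N good rk.
  exists N => x; split; last exact: good.
  move=> _; apply: submx_full; rewrite -col_leq_rank.
  by rewrite -subn_eq0 -leqn0.
have [H|/existsNP[x /not_implyP[Sx xN]]] := pselect (forall x, S x -> (x <= N)%MS).
  by exists N => x; split; [exact: H|exact: good].
apply: (IH (N + x)%MS).
  move=> y /sub_addsmxP[[u v] /= ->].
  rewrite addrC [v]mx11_scalar mul_scalar_mx; apply: SZ => //.
  by apply: good; exact: submxMl.
have : (\rank N < \rank (N + x)%MS)%N.
  apply: rank_ltmx; rewrite ltmxE addsmxSl /=; apply/negP => h; apply: xN.
  exact: submx_trans (addsmxSr _ _) h.
lia.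
Qed.
End LinearSets.

Section FiniteDimension.
Variable R : realType.

Lemma mx_norm_entry m n (x : 'M[R]_(m, n)) i j : `|x i j| <= `|x|.
Proof.
rewrite [leRHS]/Num.Def.normr /= mx_normrE; apply/bigmax_geP; right => /=.
by exists (i, j).
Qed.

Lemma mx_norm_le m n (x : 'M[R]_(m, n)) (e : R) : 0 <= e ->
  (forall i j, `|x i j| <= e) -> `|x| <= e.
Proof.
move=> e0 H; rewrite [leLHS]/Num.Def.normr /= mx_normrE; apply: bigmax_le => //= -[i j] _.
Qed.

Lemma rV_linear_bounded m (V : normedModType R) (f : 'rV[R]_m -> V) : is_linear f ->
  bounded_linear f.
Proof.
move=> lf; apply: (@bounded_linear_intro _ _ _ _ (\sum_i `|f (delta_mx 0 i)|)) => // x.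
rewrite {1}[x]row_sum_delta (lin_sum lf) mulr_suml.
apply: (le_trans (ler_norm_sum _ _ _)); apply: ler_sum => i _.
by rewrite (linZ lf) normrZ mulrC ler_wpM2l// mx_norm_entry.
Qed.

(** On the compact unit sphere the norms of the values of [f] form a closed set that misses 0, hence
    stays away from it. *)
Lemma rV_injective_bound m (V : normedModType R) (f : 'rV[R]_m -> V) : is_linear f ->
  (forall x, f x = 0 -> x = 0) ->
  exists2 c : R, 0 < c & forall x, `|x| <= c * `|f x|.
Proof.
move=> lf inj; have [_ cf] := rV_linear_bounded lf.
pose A := [set x : 'rV[R]_m | `|x| = 1].
have cA : compact A.
  apply: bounded_closed_compact.
    by exists 1; split; [exact: num_real|move=> y y1 x /= ->; exact: ltW].
  have := @preimage_closed _ _ (fun x : 'rV[R]_m => `|x| : R) [set x : R | x = 1].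
  by apply; [move=> x _; exact: norm_continuous|exact: closed_eq].
pose g := fun x => `|f x|.
have cg : continuous g.
  by move=> x; apply: continuous_comp; [exact: cf|exact: norm_continuous].
have cl : closed (g @` A).
  apply: compact_closed; first exact: Rhausdorff.
  by apply: continuous_compact => //; exact: continuous_subspaceT.
have : nbhs 0 (~` (g @` A)).
  apply: open_nbhs_nbhs; split; first exact: closed_openC.
  move=> [x /= x1 /normr0_eq0 /inj x0]; move: x1; rewrite /A /= x0 normr0 => /eqP.
  by rewrite eq_sym oner_eq0.
move=> /nbhs_ballP[d /= d0 H]; exists d^-1; first by rewrite invr_gt0.
move=> x; have [->|x0] := eqVneq x 0; first by rewrite normr0 mulr_ge0// invr_ge0 ltW.
have nx : 0 < `|x| by rewrite normr_gt0.
rewrite ler_pdivlMl// leNgt; apply/negP => h.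
apply: (H (g (`|x|^-1 *: x))).
  rewrite /ball /= sub0r normrN /g normr_id (linZ lf) normrZ normfV normr_id.
  by rewrite mulrC ltr_pdivrMr.
by exists (`|x|^-1 *: x) => //; rewrite /A /= normrZ normfV normr_id mulVf// gt_eqF.
Qed.

(* The range of an injective linear map out of a finite dimensional space is
   closed: otherwise [(x, a) |-> f x + a v] would still be injective. *)
Lemma rV_range_closed m (V : normedModType R) (f : 'rV[R]_m -> V) (v : V) : is_linear f ->
  (forall x, f x = 0 -> x = 0) ->
  (forall e : R, 0 < e -> exists x, `|v - f x| <= e) -> exists x, v = f x.
Proof.
move=> lf inj H; apply: contrapT => nv.
pose g (x : 'rV[R]_(m + 1)) := f (lsubmx x) + (rsubmx x 0 0) *: v.
have lg : is_linear g.
  by move=> a x y; rewrite /g !linearP /= !mxE lf; lmod R.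
have ig x : g x = 0 -> x = 0.
  rewrite /g; have [r0|r0] := eqVneq (rsubmx x 0 0) 0.
    rewrite r0 scale0r addr0 => /inj l0; rewrite -[x]hsubmxK l0.
    have -> : rsubmx x = 0 by apply/rowP => i; rewrite ord1 r0 mxE.
    by rewrite row_mx0.
  move=> h; exfalso; apply: nv; exists (- (rsubmx x 0 0)^-1 *: lsubmx x).
  rewrite (linZ lf); have -> : f (lsubmx x) = - (rsubmx x 0 0 *: v).
    by apply/eqP; rewrite -addr_eq0 h.
  by rewrite scalerN scaleNr opprK scalerA mulVf// scale1r.
have [c c0 Hc] := rV_injective_bound lg ig.
have [x Hx] := H (c^-1 / 2) ltac:(by rewrite divr_gt0// invr_gt0).
have := Hc (row_mx (- x) 1%:M).
have : `|1 : R| <= `|row_mx (- x) 1%:M : 'rV[R]_(m + 1)|.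
  apply: le_trans (mx_norm_entry _ 0 (rshift m 0)).
  by rewrite row_mxEr mxE eqxx.
rewrite /g row_mxKl row_mxKr mxE eqxx scale1r (linN lf) addrC normr1 => h1 h2.
have : c * `|v - f x| <= c * (c^-1 / 2) by rewrite ler_pM2l.
by rewrite mulrA divff ?gt_eqF// mul1r; lra.
Qed.

(** The spanning family may be linearly dependent; restricting the coefficients to a complement
    [N^C] of the relations [N] makes the parametrization injective. *)
Lemma findim_sub_param (V : normedModType R) (S : set V) : findim_sub S ->
  exists (m : nat) (f : 'rV[R]_m -> V), [/\ is_linear f, forall x, f x = 0 -> x = 0 &
    forall v, S v <-> exists x, v = f x].
Proof.
move=> [n [e He]].
pose g (c : 'rV[R]_n) := \sum_i c 0 i *: e i.
have lg : is_linear g.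
  move=> a x y; rewrite /g scaler_sumr -big_split; apply: eq_bigr => i _ /=.
  by rewrite !mxE scalerDl scalerA.
have [|a u v gu gv|N HN] := @linear_set_rowspace _ n [set c | g c = 0].
- exact: lin0.
- by rewrite /= lg gu gv scaler0 addr0.
pose C := row_base (N^C)%MS.
exists (\rank (N^C)%MS), (fun x => g (x *m C)); split.
- by move=> a x y; rewrite mulmxDl -scalemxAl lg.
- move=> x /HN xN.
  have xC : (x *m C <= N^C)%MS by rewrite (submx_trans (submxMl _ _))// eq_row_base.
  have : (x *m C <= N :&: N^C)%MS by rewrite sub_capmx xN.
  rewrite capmx_compl submx0 => /eqP xC0.
  by apply: (row_free_inj (row_base_free (N^C)%MS)); rewrite xC0 mul0mx.
- move=> v; rewrite He; split=> [[c ->]|[x ->]]; last first.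
    by exists (fun i => (x *m C) 0 i).
  pose r : 'rV[R]_n := \row_i c i.
  have : (r <= N + N^C)%MS by apply: submx_full; exact: addsmx_compl_full.
  move=> /sub_addsmxP[[u w] /= Hr].
  have : (w *m (N^C)%MS <= C)%MS by rewrite eq_row_base submxMl.
  move=> /submxP[x Hx]; exists x; rewrite -Hx.
  have -> : \sum_i c i *: e i = g r by apply: eq_bigr => i _; rewrite mxE.
  rewrite Hr (linD lg).
  have -> : g (u *m N) = 0 by apply/HN; exact: submxMl.
  by rewrite add0r.
Qed.

Lemma findim_linear_bounded (V W : normedModType R) (f : V -> W) : findim V ->
  is_linear f -> bounded_linear f.
Proof.
move=> /findim_sub_param[m [g [lg ig Hg]]] lf.
have [c c0 Hc] := rV_injective_bound lg ig.
have lfg : is_linear (f \o g) by move=> a x y /=; rewrite lg lf.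
have [M M0 HM] := bounded_linear_bound (rV_linear_bounded lfg).
apply: (@bounded_linear_intro _ _ _ _ (M * c)) => // v.
have [x ->] := (Hg v).1 Logic.I.
by apply: (le_trans (HM x)); rewrite -mulrA ler_pM2l.
Qed.

Lemma findim_dense_full (V : normedModType R) (S : set V) : findim V -> S 0 ->
  (forall a u v, S u -> S v -> S (a *: u + v)) ->
  (forall (v : V) (e : R), 0 < e -> exists2 u, S u & `|v - u| <= e) -> forall v, S v.
Proof.
move=> /findim_sub_param[m [g [lg ig Hg]]] S0 SZ dS v.
have [|a x y Sx Sy|N HN] := @linear_set_rowspace _ m [set c | S (g c)].
- by rewrite /= (lin0 lg).
- by rewrite /= lg; exact: SZ.
pose C := row_base N.
have [|x|e e0|x ->] := @rV_range_closed (\rank N) V (fun x => g (x *m C)) v.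
- by move=> a x y; rewrite mulmxDl -scalemxAl lg.
- by move=> /ig h; apply: (row_free_inj (row_base_free N)); rewrite h mul0mx.
- have [u Su Hu] := dS v e e0; have [y uy] := (Hg u).1 Logic.I.
  have : (y <= C)%MS by rewrite eq_row_base; apply/HN; rewrite /= -uy.
  by move=> /submxP[x Hx]; exists x; rewrite -Hx -uy.
- by apply/HN; rewrite (submx_trans (submxMl _ _))// eq_row_base.
Qed.

(** The domain is dense because [sgV T h v / h] tends to [v], and a dense subspace of a
    finite-dimensional space is everything. *)
Lemma findim_generator (V : completeNormedModType R) (D : set V) (A : V -> V) T :
  findim V -> generator D A T -> (forall v, D v) /\ bounded_linear A.
Proof.
move=> fV hG; have Dall : forall v, D v.
  apply: (@findim_dense_full V D fV (gen0 hG).1) => [a u v Du Dv|v e e0].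
    exact: (gen_lin hG a Du Dv).1.
  have [d d0 Hd] := is_deriv0_rderiv (sgV_deriv hG.1 v) (lexx 0) e0.
  have h0 : 0 < d / 2 by lra.
  exists ((d / 2)^-1 *: sgV T (d / 2) v).
    by apply: (genZ hG _ _).1; exact: (gen_sgV hG v (ltW h0)).1.
  have := Hd _ h0 ltac:(lra); rewrite add0r (sgV0 hG.1) (sg0 hG.1) subr0 => h.
  have -> : v - (d / 2)^-1 *: sgV T (d / 2) v = - (d / 2)^-1 *: (sgV T (d / 2) v - (d / 2) *: v).
    rewrite scaleNr scalerBr opprB scalerA mulVf ?scale1r// gt_eqF//.
  by rewrite normrZ normrN normfV (gtr0_norm h0) mulrC ler_pdivrMr.
split=> //; apply: findim_linear_bounded => // a u v.
exact: (gen_lin hG a (Dall u) (Dall v)).2.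
Qed.

(** If [z] is bounded by [c * expR (2 * k * s)], integrating the bound on [v] replaces [c] by the
    norm of [z 0] plus [c / 2]. Iteration converges to the fixed point, twice that norm. *)
Lemma gronwall (V : normedModType R) (z v : R -> V) (k a : R) : 0 < k -> cont0 z ->
  (forall s, 0 <= s -> s < a -> rderiv z s (v s)) ->
  (forall s, 0 <= s -> s < a -> `|v s| <= k * `|z s|) ->
  forall t, 0 <= t -> t <= a -> `|z t| <= 2 * `|z 0| * expR (2 * k * t).
Proof.
move=> k0 cz dz Hv; have [C C0 HC] := cont0_bounded a cz.
have K n t : 0 <= t -> t <= a -> `|z t| <= (2 * `|z 0| + C * 2^-1 ^+ n) * expR (2 * k * t).
  elim: n t => [|n IH] t t0 ta.
    rewrite expr0 mulr1; apply: (le_trans (HC t t0 ta)).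
    have : 1 <= expR (2 * k * t) by rewrite -expR0 ler_expR !mulr_ge0// ltW.
    move=> e1; rewrite -[C]mulr1; apply: ler_pM => //; first exact: ltW.
    by rewrite mulr1 lerDr mulr_ge0.
  set q := 2^-1 ^+ n in IH *.
  have q0 : 0 <= q by rewrite exprn_ge0.
  pose c := 2 * `|z 0| + C * q.
  have c0 : 0 <= c by rewrite addr_ge0// mulr_ge0// ltW.
  have := @mean_value_rderiv R V z v (fun s => c / 2 * expR (2 * k * s))
    (fun s => c / 2 * (2 * k * expR (2 * k * s))) 0 t cz.
  move=> /(_ (@is_deriv0Z R R^o (c / 2) _ _ (@is_deriv0_expR R (2 * k)))).
  move=> /(_ (lexx _) t0) h.
  have : `|z t - z 0| <= c / 2 * expR (2 * k * t) - c / 2 * expR (2 * k * 0).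
    apply: h => s s0 st; [by apply: dz => //; lra|].
    apply: (le_trans (Hv s s0 _)); first lra.
    have -> : c / 2 * (2 * k * expR (2 * k * s)) = k * (c * expR (2 * k * s)) by field.
    by rewrite ler_pM2l// IH//; lra.
  rewrite mulr0 expR0.
  have := ler_normD (z t - z 0) (z 0); rewrite subrK exprS -/q.
  have e1 : 1 <= expR (2 * k * t) by rewrite -expR0 ler_expR !mulr_ge0// ltW.
  have : `|z 0| * 1 <= `|z 0| * expR (2 * k * t) by rewrite ler_wpM2l.
  move: c0; rewrite /c; move: (expR _) e1 => E e1; lra.
move=> t t0 ta; apply/ler_addgt0Pr => e e0.
have C' : 0 <= C * expR (2 * k * t) by rewrite mulr_ge0// ?expR_ge0// ltW.
have [n h] := geometric_small C' e0.
apply: (le_trans (K n t t0 ta)); rewrite mulrDl lerD2l; lra.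
Qed.

(** [K] is a bounded perturbation of the zero generator, whose semigroup is constant. Uniqueness by
    [gronwall] gives linearity and the semigroup law. *)
Lemma bounded_generator (X : completeNormedModType R) (K : X -> X) : bounded_linear K ->
  exists T : R -> X -> X, generator setT K T.
Proof.
move=> bK; have lK := bK.1; have [k k0 Hk] := bounded_linear_bound bK.
have hG0 : generator setT (fun _ : X => 0) (fun _ x => x).
  split.
    split=> //.
    - move=> t _; apply: (@bounded_linear_intro _ _ _ _ 1) => // x.
      by rewrite mul1r.
    - by move=> x; exact: cont0_cst.
  move=> x; have H : (fun h : R => h^-1 *: (x - x)) @ 0^'+ --> (0 : X).
    by apply/gen_limP => e e0; exists 1 => // h h0 _; rewrite subrr scaler0 subr0 normr0 mulr_ge0// ltW.
  by split => //; split => // _; exists 0.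
have /choice[T HT] : forall x0 : X, exists z : R -> X, z 0 = x0 /\ is_deriv0 z (K \o z).
  move=> x0; have [z [z' [z0 _ dz _ Hz']]] := perturbed_solution hG0 bK (z0 := x0) Logic.I.
  exists z; split=> //; apply: is_deriv0_ext dz => // t t0.
  by rewrite Hz'// add0r.
have T0 x : T x 0 = x by case: (HT x).
have dT x : is_deriv0 (T x) (K \o T x) by case: (HT x).
have grow (z : R -> X) t : is_deriv0 z (K \o z) -> 0 <= t -> `|z t| <= 2 * `|z 0| * expR (2 * k * t).
  move=> dz t0; apply: (@gronwall _ z (K \o z) k t) => //.
  - exact: is_deriv0_cont dz.
  - by move=> s s0 _; exact: is_deriv0_rderiv dz s0.
  - by move=> s _ _ /=; exact: Hk.
have uniq (y z : R -> X) t : is_deriv0 y (K \o y) -> is_deriv0 z (K \o z) -> y 0 = z 0 ->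
    0 <= t -> y t = z t.
  move=> dy dz yz t0; apply/eqP; rewrite -subr_eq0 -normr_le0.
  have := grow (fun s => y s - z s) t _ t0; rewrite yz subrr normr0 mulr0 mul0r; apply.
  apply: is_deriv0_ext (is_deriv0B dy dz) => // s _ /=.
  by rewrite linB.
have linT t : 0 <= t -> is_linear (fun x => T x t).
  move=> t0 a u v; apply: (uniq (T (a *: u + v)) (fun t => a *: T u t + T v t)) => //.
    apply: (@is_deriv0_ext _ _ _ _ _ _ _ _ (is_deriv0D (@is_deriv0Z _ _ a _ _ (dT u)) (dT v))) => // s _ /=.
    by rewrite lK.
  by rewrite !T0.
exists (fun t x => T x t); split.
  split=> //.
  - move=> t t0; apply: (bounded_linear_intro (linT t t0) (M := 2 * expR (2 * k * t))) => x.
    by have := grow (T x) t (dT x) t0; rewrite T0 mulrAC.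
  - move=> s t x s0 t0.
    apply: (uniq (fun s => T x (s + t)) (T (T x t))) => //; last by rewrite add0r T0.
    apply/is_deriv0P => r r0 e e0.
    have [d d0 Hd] := (is_deriv0P _ _).1 (dT x) (r + t) ltac:(lra) e e0.
    exists d => // q q0 qr; have := Hd (q + t) ltac:(lra).
    have -> : q + t - (r + t) = q - r by lra.
    by move=> /(_ qr).
  - by move=> x; exact: is_deriv0_cont (dT x).
move=> x.
have H : (fun h : R => h^-1 *: (T x h - x)) @ 0^'+ --> K x.
  apply/(@gen_limP R X (fun t x => T x t)) => e e0; have [d d0 Hd] := is_deriv0_rderiv (dT x) (lexx 0) e0.
  by exists d => // h h0 hd; have := Hd h h0 hd; rewrite add0r /= T0.
by split=> //; split=> // _; exists (K x).
Qed.

End FiniteDimension.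

(** * The Hahn-Banach theorem *)

Section HahnBanach.
Variables (R : realType) (Y : normedModType R) (c : R).
Hypothesis c0 : 0 <= c.

(* Graphs of linear functionals of norm at most [c] defined on a subspace. *)
Definition linear_graph (G : set (Y * R)) := [/\ G (0, 0),
  forall a p q, G p -> G q -> G (a *: p.1 + q.1, a * p.2 + q.2) &
  forall p, G p -> `|p.2| <= c * `|p.1|].

(** A value [s] at [y0] is admissible when it lies above the bounds collected in [E] and below those
    of [s2]. By [ub] each lower bound is below each upper one, so the supremum of [E] serves. *)
Lemma linear_graph_extend G y0 : linear_graph G ->
  exists H s, [/\ linear_graph H, G `<=` H & H (y0, s)].
Proof.
move=> [G0 GL Gc].
pose E := [set - (c * `|p.1 + y0|) - p.2 | p in G].
have ub p q : G p -> G q -> - (c * `|p.1 + y0|) - p.2 <= c * `|q.1 + y0| - q.2.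
  move=> Gp Gq; have := Gc _ (GL (-1) p q Gp Gq) => /=.
  rewrite mulN1r scaleN1r => h.
  have := ler_norm (- (- p.2 + q.2)); rewrite normrN => h2.
  have : `|- p.1 + q.1| <= `|p.1 + y0| + `|q.1 + y0|.
    have -> : - p.1 + q.1 = (q.1 + y0) - (p.1 + y0) by lmod R.
    by apply: (le_trans (ler_normB _ _)); rewrite addrC.
  move=> h3; have : c * `|- p.1 + q.1| <= c * (`|p.1 + y0| + `|q.1 + y0|).
    by rewrite ler_wpM2l.
  have := ler_norm (- p.2 + q.2).
  lra.
have supE : has_sup E.
  split; first by exists (- (c * `|0 + y0|) - 0), (0, 0).
  by exists (c * `|0 + y0| - 0) => _ [p Gp <-]; exact: (ub p (0, 0)).
pose s := sup E.
have s1 p : G p -> - (c * `|p.1 + y0|) - p.2 <= s.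
  by move=> Gp; apply: ub_le_sup; [case: supE|exists p].
have s2 p : G p -> s <= c * `|p.1 + y0| - p.2.
  by move=> Gp; apply: ge_sup; [case: supE|move=> _ [q Gq <-]; exact: ub].
have sb p : G p -> `|p.2 + s| <= c * `|p.1 + y0|.
  by move=> Gp; have := s1 p Gp; have := s2 p Gp; rewrite ler_norml => ? ?; apply/andP; split; lra.
exists [set q | exists a p, G p /\ q = (p.1 + a *: y0, p.2 + a * s)], s; split.
- split.
  + by exists 0, (0, 0); split => //=; rewrite scale0r mul0r !addr0.
  + move=> a _ _ [b [p [Gp ->]]] [d [q [Gq ->]]] /=.
    exists (a * b + d), (a *: p.1 + q.1, a * p.2 + q.2); split; first exact: GL.
    by congr (_, _) => /=; [lmod R|ring].
  + move=> _ [a [p [Gp ->]]] /=; have [->|a0] := eqVneq a 0.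
      by rewrite scale0r mul0r !addr0; exact: Gc.
    have := sb _ (GL a^-1 p (0, 0) Gp G0) => /=; rewrite !addr0 => h.
    have -> : p.2 + a * s = a * (a^-1 * p.2 + s) by rewrite mulrDr mulVKf.
    have -> : p.1 + a *: y0 = a *: (a^-1 *: p.1 + y0).
      by rewrite scalerDr scalerA divff// scale1r.
    by rewrite normrM normrZ mulrCA ler_wpM2l.
- by move=> p Gp; exists 0, p; split=> //; rewrite scale0r mul0r !addr0; case: p {Gp}.
- by exists 1, (0, 0); split=> //=; rewrite scale1r mul1r !add0r.
Qed.

Lemma hahn_banach G : linear_graph G -> exists f : Y -> R,
  [/\ is_linear (W := R^o) f, forall y, `|f y| <= c * `|y| & forall p, G p -> f p.1 = p.2].
Proof.
(* Uniting with [G] makes the union of the empty chain admissible for Zorn's lemma. *)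
move=> lG; pose P H := linear_graph (H `|` G).
have [|A [PA maxA]] := @Zorn_bigcup _ P.
  move=> F FP tot; have [[H0 FH0]|F0] := pselect (exists H, F H); last first.
    rewrite /P (_ : _ `|` G = G)//; apply/seteqP; split=> [x [[H FH]|]//|x Gx]; last by right.
    by exfalso; apply: F0; exists H.
  have both p q : (\bigcup_(X in F) X `|` G) p -> (\bigcup_(X in F) X `|` G) q ->
      exists2 H, F H & (H `|` G) p /\ (H `|` G) q.
    move=> [[H FH Hp]|Gp] [[K FK Kq]|Gq].
    - have [HK|KH] := tot H K FH FK.
        by exists K => //; split; left => //; exact: HK.
      by exists H => //; split; left => //; exact: KH.
    - by exists H => //; split; [left|right].
    - by exists K => //; split; [right|left].
    - by exists H0 => //; split; right.
  have sub H x : F H -> (H `|` G) x -> (\bigcup_(X in F) X `|` G) x.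
    by move=> FH [Hx|Gx]; [left; exists H|right].
  split.
  - by right; case: lG.
  - move=> a p q Up Uq; have [H FH [Hp Hq]] := both p q Up Uq.
    by apply: (sub H) => //; case: (FP H FH) => _ h _; exact: h.
  - move=> p Up; have [H FH [Hp _]] := both p p Up Up.
    by case: (FP H FH) => _ _; exact.
have tot y : exists s, (A `|` G) (y, s).
  have [H [s [lH AH Hs]]] := linear_graph_extend y PA.
  have [AGs|nAGs] := pselect ((A `|` G) (y, s)); first by exists s.
  exfalso; apply: (maxA H).
    split; first by move=> x Ax; apply: AH; left.
    by move=> HA; apply: nAGs; left; exact: HA.
  rewrite /P (_ : H `|` G = H)//; apply/seteqP; split=> [x [//|Gx]|x]; last by left.
  by apply: AH; right.
have [f Hf] := choice tot; have [A0 AL Ac] := PA.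
(* Single-valuedness comes from the norm bound: the difference of two values at [y] is a value at
   0. *)
have uniq y r s : (A `|` G) (y, r) -> (A `|` G) (y, s) -> r = s.
  move=> h1 h2; have := Ac _ (AL (-1) _ _ h1 h2) => /=.
  rewrite scaleN1r addNr normr0 mulr0 normr_le0 mulN1r addrC subr_eq0 => /eqP.
  by [].
exists f; split.
- by move=> a u v; apply: (uniq _ _ _ (Hf _)); exact: (AL a _ _ (Hf u) (Hf v)).
- by move=> y; exact: (Ac _ (Hf y)).
- by move=> [y r] Gy; apply: (uniq y) => //; right.
Qed.

End HahnBanach.

(** The coordinates of [x] are bounded functionals of [f x], and Hahn-Banach extends them to [Y].
    The observer needs this, since its injection acts on arbitrary outputs. *)
Lemma findim_left_inverse (R : realType) (Y : normedModType R) m (f : 'rV[R]_m -> Y) :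
  is_linear f -> (forall x, f x = 0 -> x = 0) ->
  exists p : Y -> 'rV[R]_m, bounded_linear p /\ forall x, p (f x) = x.
Proof.
move=> lf inj; have [c c0 Hc] := rV_injective_bound lf inj.
have /choice[g Hg] : forall i : 'I_m, exists g : Y -> R,
   [/\ is_linear (W := R^o) g, forall y, `|g y| <= c * `|y| & forall x, g (f x) = x 0 i].
  move=> i; have [|g [lg bg Hg]] := @hahn_banach R Y c (ltW c0) [set p | exists x, p = (f x, x 0 i)].
    split.
    - by exists 0; rewrite (lin0 lf) mxE.
    - by move=> a _ _ [x ->] [y ->]; exists (a *: x + y); rewrite /= lf !mxE.
    - by move=> _ [x ->] /=; apply: le_trans (Hc x); exact: mx_norm_entry.
  by exists g; split=> // x; apply: (Hg (f x, x 0 i)); exists x.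
exists (fun y => \row_i g i y); split; last first.
  by move=> x; apply/rowP => i; rewrite mxE; case: (Hg i).
apply: (@bounded_linear_intro _ _ _ _ c).
  by move=> a u v; apply/rowP => i; rewrite !mxE; case: (Hg i) => lg _ _; exact: lg.
move=> y; apply: mx_norm_le => [|i j]; first by rewrite mulr_ge0// ltW.
by rewrite mxE; case: (Hg j).
Qed.

(** * Decay on the half line *)

Section SemigroupDecay.
Variables (R : realType) (X : completeNormedModType R) (T : R -> X -> X).
Hypothesis sgT : C0_semigroup T.

Lemma sg_decay (tau : R) : 0 < tau -> (forall x, `|T tau x| <= 2^-1 * `|x|) ->
  exists M b : R, [/\ 0 < M, 0 < b &
    forall t x, 0 <= t -> `|T t x| <= M * expR (- b * t) * `|x|].
Proof.
move=> tau0 H; have [M M0 HM] := sg_bounded sgT tau.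
have l2 : 0 < ln 2 :> R by rewrite ln_gt0// ltr1n.
(* After [n] full periods the bound is [M * 2^-1 ^+ n] with [n > t / tau - 1]; the factor 2 pays for
   the incomplete period. *)
exists (2 * M), (ln 2 / tau); split; [lra|exact: divr_gt0|].
move=> t x t0; pose n := Num.trunc (t / tau).
have /andP[nt tn] : n%:R <= t / tau < n.+1%:R by apply: truncn_itv; rewrite divr_ge0// ltW.
have K k s : 0 <= s -> s <= tau -> `|T (k%:R * tau + s) x| <= M * 2^-1 ^+ k * `|x|.
  move=> s0 st; elim: k => [|k IH]; first by rewrite mul0r add0r expr0 mulr1; exact: HM.
  rewrite -natr1 mulrDl mul1r addrAC addrC sgD//; [|lra|].
    rewrite exprS; apply: (le_trans (H _)).
    have : 2^-1 * `|T (k%:R * tau + s) x| <= 2^-1 * (M * 2^-1 ^+ k * `|x|) by rewrite ler_pM2l ?invr_gt0.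
    by move: (2^-1 ^+ k) => q; lra.
  by rewrite addr_ge0// mulr_ge0// ltW.
have := K n (t - n%:R * tau); rewrite subrKC => /(_ _ _)/le_trans; apply.
- by rewrite subr_ge0 -ler_pdivlMr.
- by move: tn; rewrite ltr_pdivrMr// -natr1 mulrDl mul1r; lra.
rewrite ler_wpM2r// [2 * M]mulrC -mulrA ler_pM2l// [2 * _]mulrC.
have -> : 2^-1 ^+ n = expR (- (n%:R * ln 2)) :> R.
  by rewrite expRN expRM_natl lnK ?posrE// exprVn.
have -> : expR (- (ln 2 / tau) * t) * 2 = expR (- (ln 2 / tau) * t + ln 2) :> R.
  by rewrite expRD lnK ?posrE.
rewrite ler_expR.
have -> : - (ln 2 / tau) * t + ln 2 = - (t / tau - 1) * ln 2 by field; rewrite gt_eqF.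
rewrite mulNr lerN2 ler_pM2r//; move: tn; rewrite -natr1; lra.
Qed.

End SemigroupDecay.

Section Product.
Variable R : realType.

Lemma is_deriv0M (V : normedModType R) (a a' : R -> R) (x x' : R -> V) :
  is_deriv0 (V := R) a a' -> is_deriv0 x x' ->
  is_deriv0 (fun t => a t *: x t) (fun t => a' t *: x t + a t *: x' t).
Proof.
move=> da dx; apply/is_deriv0P => t t0 e e0.
have ca := is_deriv0_cont da.
have [d1 d10 H1] := (is_deriv0P _ _).1 da t t0 (e / 3 / (`|x t| + 1)) ltac:(by rewrite !divr_gt0// ltr_wpDl).
have [d2 d20 H2] := (is_deriv0P _ _).1 dx t t0 (e / 3 / (`|a t| + 1)) ltac:(by rewrite !divr_gt0// ltr_wpDl).
have [d3 d30 H3] := (cont0P _).1 ca t t0 (Num.min 1 (e / 3 / (`|x' t| + 1)))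
  ltac:(by rewrite lt_min ltr01 !divr_gt0// ltr_wpDl).
exists (Num.min d1 (Num.min d2 d3)); first by rewrite !lt_min d10 d20.
move=> s s0; rewrite !lt_min => /and3P[/(H1 s s0) h1 /(H2 s s0) h2 /(H3 s s0)].
rewrite le_min => /andP[h3 h4].
have -> : a s *: x s - a t *: x t - (s - t) *: (a' t *: x t + a t *: x' t) =
   a s *: (x s - x t - (s - t) *: x' t) + (a s - a t - (s - t) * a' t) *: x t
   + ((a s - a t) * (s - t)) *: x' t by lmod R.
move: h1 h2; rewrite /GRing.scale /=.
set p := x s - x t - _; set q := a s - a t - _ => h1 h2.
have as_ : `|a s| <= `|a t| + 1 by have := ler_normD (a s - a t) (a t); rewrite subrK; lra.
have k1 : `|a s *: p| <= e / 3 * `|s - t|.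
  rewrite normrZ; apply: (@le_trans _ _ ((`|a t| + 1) * (e / 3 / (`|a t| + 1) * `|s - t|))).
    by apply: ler_pM.
  by rewrite mulrA [X in X * _]mulrC divfK// gt_eqF// ltr_wpDl.
have k2 : `|q *: x t| <= e / 3 * `|s - t|.
  rewrite normrZ; apply: (@le_trans _ _ ((e / 3 / (`|x t| + 1) * `|s - t|) * (`|x t| + 1))).
    by apply: ler_pM => //; lra.
  by rewrite mulrAC divfK// gt_eqF// ltr_wpDl.
have k3 : `|((a s - a t) * (s - t)) *: x' t| <= e / 3 * `|s - t|.
  rewrite normrZ normrM mulrAC ler_wpM2r//.
  apply: (@le_trans _ _ ((e / 3 / (`|x' t| + 1)) * (`|x' t| + 1))).
    by apply: ler_pM => //; lra.
  by rewrite divfK// gt_eqF// ltr_wpDl.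
have := ler_normD (a s *: p + q *: x t) (((a s - a t) * (s - t)) *: x' t).
have := ler_normD (a s *: p) (q *: x t).
lra.
Qed.

Definition vanishes (V : normedModType R) (x : R -> V) := forall e : R, 0 < e ->
  exists2 a : R, 0 <= a & forall t, a <= t -> `|x t| <= e.

Lemma vanishes_lin (V W : normedModType R) (f : V -> W) x : bounded_linear f ->
  vanishes x -> vanishes (f \o x).
Proof.
move=> /bounded_linear_bound[M M0 HM] vx e e0.
have [a a0 Ha] := vx (e / M) ltac:(exact: divr_gt0).
exists a => // t /Ha h; apply: (le_trans (HM _)).
by move: h; rewrite ler_pdivlMr// mulrC.
Qed.

Lemma vanishesD (V : normedModType R) (x y : R -> V) : vanishes x -> vanishes y ->
  vanishes (fun t => x t + y t).
Proof.
move=> vx vy e e0; have [a a0 Ha] := vx (e / 2) ltac:(lra).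
have [b b0 Hb] := vy (e / 2) ltac:(lra).
exists (Num.max a b); first by rewrite le_max a0.
move=> t; rewrite ge_max => /andP[/Ha h1 /Hb h2].
by apply: (le_trans (ler_normD _ _)); lra.
Qed.

Lemma vanishes_ext (V : normedModType R) (x y : R -> V) :
  (forall t, 0 <= t -> x t = y t) -> vanishes x -> vanishes y.
Proof.
move=> xy vx e e0; have [a a0 Ha] := vx e e0; exists a => // t at_.
by rewrite -xy; [exact: Ha|exact: le_trans at_].
Qed.

(** Multiplied by [expR t], the equation says that [expR t *: x t] has derivative [expR t *: g t].
    Past a time [a] after which [g] is small, [x] is bounded by a decaying term plus that
    smallness. *)
Lemma vanishes_damped (V : normedModType R) (x g : R -> V) :
  is_deriv0 x (fun t => - x t + g t) -> vanishes g -> vanishes x.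
Proof.
move=> dx vg e e0.
have [a a0 Ha] := vg (e / 2) ltac:(lra).
have E := @is_deriv0_expR R 1.
have dp := is_deriv0M E dx.
have K t : a <= t -> `|x t| <= expR (- (t - a)) * `|x a| + e / 2.
  move=> at_.
  have := @mean_value_rderiv R V _ _ (fun s => e / 2 * expR (1 * s)) (fun s => e / 2 * (1 * expR (1 * s))) a t
    (is_deriv0_cont dp) (@is_deriv0Z R R^o (e / 2) _ _ E) a0 at_.
  rewrite !mul1r => h.
  have {}h : `|expR t *: x t - expR a *: x a| <= e / 2 * expR t - e / 2 * expR a.
    apply: h => s as_ st; first by apply: is_deriv0_rderiv dp _; lra.
    rewrite !mul1r -scalerDr addNKr normrZ ger0_norm ?expR_ge0// mulrC.
    by rewrite ler_wpM2r ?expR_ge0// Ha.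
  have et := expR_gt0 t; have ea := expR_gt0 a.
  have : `|expR t *: x t| <= expR a * `|x a| + e / 2 * expR t.
    have := ler_normD (expR t *: x t - expR a *: x a) (expR a *: x a).
    rewrite subrK [`|expR a *: _|]normrZ (gtr0_norm ea).
    have : 0 <= e / 2 * expR a by rewrite mulr_ge0// ltW//; lra.
    lra.
  rewrite normrZ (gtr0_norm et) => hh; rewrite -(ler_pM2l et) mulrDr.
  have -> : - (t - a) = a - t by ring.
  have -> : expR t * (expR (a - t) * `|x a|) = expR a * `|x a|.
    by rewrite mulrA -expRD; congr (expR _ * _); ring.
  by rewrite [expR t * (e / 2)]mulrC.
pose k := 2 * (`|x a| + 1) / e.
have k0 : 0 < k by rewrite divr_gt0// mulr_gt0// ltr_wpDl.
exists (a + k); first by rewrite addr_ge0// ltW.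
move=> t kt; apply: (le_trans (K t ltac:(lra))).
suff : expR (- (t - a)) * `|x a| <= e / 2 by lra.
rewrite expRN mulrC ler_pdivrMr ?expR_gt0//.
have h1 : k <= expR (t - a) by apply: le_trans (expR_ge1Dx _); lra.
have : e / 2 * k <= e / 2 * expR (t - a) by rewrite ler_pM2l//; lra.
have -> : e / 2 * k = `|x a| + 1 by rewrite /k; field; rewrite gt_eqF.
lra.
Qed.

End Product.

(** * Stabilization of matrices by feedback *)

Section MatrixExponential.
Variable R : realType.

Lemma mulmx_norm m n p (A : 'M[R]_(m, n)) (B : 'M[R]_(n, p)) :
  `|A *m B| <= n%:R * `|A| * `|B|.
Proof.
apply: mx_norm_le => [|i j]; first by rewrite !mulr_ge0.
rewrite mxE; apply: (le_trans (ler_norm_sum _ _ _)).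
have -> : n%:R * `|A| * `|B| = \sum_(k < n) `|A| * `|B|.
  by rewrite sumr_const card_ord -mulrA mulr_natl.
by apply: ler_sum => k _; rewrite normrM ler_pM// mx_norm_entry.
Qed.

Lemma mulmxr_blin m n p (B : 'M[R]_(n, p)) : bounded_linear (fun A : 'M[R]_(m, n) => A *m B).
Proof.
apply: (@bounded_linear_intro _ _ _ _ (n%:R * `|B|)) => [a u v|A].
  by rewrite mulmxDl -scalemxAl.
by apply: (le_trans (mulmx_norm _ _)); rewrite mulrAC.
Qed.

Lemma mulmxl_blin m n p (A : 'M[R]_(m, n)) : bounded_linear (fun B : 'M[R]_(n, p) => A *m B).
Proof.
apply: (@bounded_linear_intro _ _ _ _ (n%:R * `|A|)) => [a u v|B].
  by rewrite mulmxDr -scalemxAr.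
exact: mulmx_norm.
Qed.

Lemma trmx_blin m n : bounded_linear (fun A : 'M[R]_(m, n) => A^T).
Proof.
apply: (@bounded_linear_intro _ _ _ _ 1) => [a u v|A].
  by rewrite linearP.
rewrite mul1r; apply: mx_norm_le => // i j; rewrite mxE; exact: mx_norm_entry.
Qed.

(** The matrix exponential as the orbit of the identity under the semigroup generated by right
    multiplication. States are row vectors, so matrices act from the right. *)
Lemma expm_exists m (A : 'M[R]_m) : exists P : R -> 'M[R]_m,
  P 0 = 1%:M /\ is_deriv0 P (fun t => P t *m A).
Proof.
have [T hT] := bounded_generator (X := 'M[R]_(m, m)) (mulmxr_blin m A).
exists (fun t => T t 1%:M); split; first exact: (sg0 hT.1).
apply: is_deriv0_ext (orbit_deriv hT (x := 1%:M) Logic.I) => // t t0.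
by have [_ ->] := gen_sg hT (x := 1%:M) t0 Logic.I.
Qed.

Definition expm m (A : 'M[R]_m) : R -> 'M[R]_m := sval (cid (expm_exists A)).

Lemma expm0 m (A : 'M[R]_m) : expm A 0 = 1%:M.
Proof. by rewrite /expm; case: cid => P []. Qed.

Lemma expm_deriv m (A : 'M[R]_m) : is_deriv0 (expm A) (fun t => expm A t *m A).
Proof. by rewrite /expm; case: cid => P []. Qed.

Arguments expm_deriv {m} A.

Lemma expm_unique m p (A : 'M[R]_m) (x : R -> 'M[R]_(p, m)) t :
  is_deriv0 x (fun t => x t *m A) -> 0 <= t -> x t = x 0 *m expm A t.
Proof.
move=> dx t0; apply/eqP; rewrite -subr_eq0 -normr_le0.
pose z t := x t - x 0 *m expm A t.
have dz : is_deriv0 z (fun t => z t *m A).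
  apply: (@is_deriv0_ext _ _ _ _ _ _ _ _ (is_deriv0B dx (is_deriv0_lin (mulmxl_blin m (x 0)) (expm_deriv A)))) => // s _ /=.
  by rewrite /z mulmxBl mulmxA.
have [k k0 Hk] := bounded_linear_bound (mulmxr_blin p A).
have := @gronwall R _ z (fun t => z t *m A) k t k0 (is_deriv0_cont dz) _ _ t t0 (lexx _).
have -> : z 0 = 0 by rewrite /z expm0 mulmx1 subrr.
rewrite normr0 mulr0 mul0r; apply=> s s0 _ //.
exact: is_deriv0_rderiv dz s0.
Qed.

Lemma expm_comm m (A : 'M[R]_m) t : 0 <= t -> A *m expm A t = expm A t *m A.
Proof.
move=> t0.
have := @expm_unique m m A (fun t => expm A t *m A) t _ t0; rewrite expm0 mul1mx => ->//.
by apply: (@is_deriv0_ext _ _ _ _ _ _ _ _ (is_deriv0_lin (mulmxr_blin m A) (expm_deriv A))).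
Qed.

Lemma expm_tr m (A : 'M[R]_m) t : 0 <= t -> expm A^T t = (expm A t)^T.
Proof.
move=> t0; have := @expm_unique m m A^T (fun t => (expm A t)^T) t _ t0.
rewrite expm0 trmx1 mul1mx => ->//.
apply: (@is_deriv0_ext _ _ _ _ _ _ _ _ (is_deriv0_lin (trmx_blin m m) (expm_deriv A))) => // s s0 /=.
by rewrite -expm_comm// trmx_mul.
Qed.

Lemma expm_intertwine m n (A : 'M[R]_m) (B : 'M[R]_n) (q : 'M[R]_(m, n)) t :
  A *m q = q *m B -> 0 <= t -> expm A t *m q = q *m expm B t.
Proof.
move=> Aq t0; have := @expm_unique n m B (fun t => expm A t *m q) t _ t0.
rewrite expm0 mul1mx; apply.
apply: (@is_deriv0_ext _ _ _ _ _ _ _ _ (is_deriv0_lin (mulmxr_blin m q) (expm_deriv A))) => // s s0 /=.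
by rewrite -!mulmxA Aq.
Qed.

Lemma expm_generator m (A : 'M[R]_m) :
  generator setT (fun x : 'rV[R]_m => x *m A) (fun t x => x *m expm A t).
Proof.
have [T hT] := bounded_generator (X := 'rV[R]_m) (mulmxr_blin 1 A).
have TE t x : 0 <= t -> T t x = x *m expm A t.
  move=> t0; rewrite (@expm_unique m 1 A (fun t => T t x) t)// ?(sg0 hT.1)//.
  apply: is_deriv0_ext (orbit_deriv hT (x := x) Logic.I) => // s s0.
  by have [_ <-] := gen_sg hT (x := x) s0 Logic.I.
split.
  split.
  - by move=> t _; exact: mulmxr_blin.
  - by move=> x; rewrite expm0 mulmx1.
  - by move=> s t x s0 t0; rewrite -!TE ?(sgD hT.1)// addr_ge0.
  - by move=> x; apply: cont0_ext (sg_cont hT.1 x) => t t0; exact: TE.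
move=> x.
have H : (fun h : R => h^-1 *: (x *m expm A h - x)) @ 0^'+ --> x *m A.
  apply/(@gen_limP R _ (fun t x => x *m expm A t)) => e e0.
  have [d d0 Hd] := genP hT (x := x) Logic.I e0.
  by exists d => // h h0 hd; rewrite -TE; [exact: Hd|exact: ltW].
by split=> //; split=> // _; exists (x *m A).
Qed.

(** At some time [expm A] has operator norm at most one half, so [sg_decay] applies; the divisor
    [m + 1] absorbs the dimension factor of [mulmx_norm]. *)
Lemma expm_decay m (A : 'M[R]_m) : vanishes (expm A) -> exists M b : R,
  [/\ 0 < M, 0 < b & forall t (x : 'rV[R]_m), 0 <= t -> `|x *m expm A t| <= M * expR (- b * t) * `|x|].
Proof.
move=> vA; have m0 : 0 < m%:R + 1 :> R by rewrite ltr_wpDl.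
have [a a0 Ha] := vA (2^-1 / (m%:R + 1)) ltac:(by rewrite divr_gt0// invr_gt0).
apply: (@sg_decay R 'rV[R]_m (fun t x => x *m expm A t) (expm_generator A).1 (a + 1)).
  by rewrite ltr_wpDl.
move=> x; apply: (le_trans (mulmx_norm _ _)); rewrite mulrAC ler_wpM2r//.
have := Ha (a + 1) ltac:(by rewrite lerDl); rewrite ler_pdivlMr// => h.
apply: le_trans h; rewrite mulrC ler_wpM2l//; lra.
Qed.

Lemma vanishes_rows m n (P : R -> 'M[R]_(m, n)) :
  (forall i, vanishes (fun t => row i (P t))) -> vanishes P.
Proof.
move=> H e e0.
have /choice[a Ha] : forall i, exists a : R, 0 <= a /\ forall t, a <= t -> `|row i (P t)| <= e.
  by move=> i; have [a a0 Ha] := H i e e0; exists a.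
exists (\big[Num.max/0]_i a i); first by apply/bigmax_geP; left.
move=> t at_; apply: mx_norm_le => [|i j]; first exact: ltW.
have ait : a i <= t by apply: le_trans at_; apply/bigmax_geP; right; exists i.
apply: le_trans ((Ha i).2 t ait); apply: le_trans (mx_norm_entry _ 0 j).
by rewrite mxE.
Qed.

(* Deadbeat design: the invariant subspace [N] of [A + 1 + K B] on which the
   feedback forces decay is enlarged one vector at a time; when this stops, a
   dimension count shows that [N] contains the range of [B]. *)
Definition steered m p (A : 'M[R]_m) (B : 'M[R]_(p, m)) (N : 'M[R]_m) (K : 'M[R]_(m, p)) :=
  ((N *m (A + 1%:M + K *m B))%R <= N)%MS /\
  forall x g : R -> 'rV[R]_m, is_deriv0 x (fun t => x t *m (A + K *m B) + g t) ->
    vanishes g -> (forall t, 0 <= t -> (x t <= N)%MS) -> vanishes x.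

(** [K] is altered only in the direction [xi], so that [F' = A + 1 + K' B] sends [N + xi] into [N]
    while nothing changes on [N]. Then [y = x F'] stays in [N] and decays because [N] is steered,
    and [x' = - x + y + g] is a damped equation with vanishing input. *)
Lemma steered_extend m p (A : 'M[R]_m) (B : 'M[R]_(p, m)) N K (xi : 'rV[R]_m) (c : 'rV[R]_p) :
  steered A B N K -> ~~ (xi <= N)%MS -> ((xi *m (A + 1%:M) + c *m B)%R <= N)%MS ->
  exists K', steered A B (N + xi)%MS K'.
Proof.
move=> [NF HN] xiN xiA.
have /rV0Pn[j qj] : xi *m cokermx N != 0 by rewrite -submxE.
(* A linear functional that vanishes on [N] and equals 1 at [xi]. *)
pose d : 'cV[R]_m := ((xi *m cokermx N) 0 j)^-1 *: (cokermx N *m delta_mx j 0).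
have Nd : N *m d = 0 by rewrite /d -scalemxAr (mulmxA N) mulmx_coker mul0mx scaler0.
have xid : xi *m d = 1%:M.
  rewrite /d -scalemxAr (mulmxA xi (cokermx N)); move: (xi *m cokermx N) qj => w qj.
  by rewrite -colE; apply/rowP => i; rewrite ord1 !mxE mulVf.
pose K' := K + d *m (c - xi *m K).
have NK' : N *m K' = N *m K by rewrite mulmxDr mulmxA Nd mul0mx addr0.
have xiK' : xi *m K' = c by rewrite mulmxDr mulmxA xid mul1mx addrC subrK.
have NF' : ((N *m (A + 1%:M + K' *m B))%R <= N)%MS.
  by move: NF; rewrite !mulmxDr !mulmxA NK'.
have allF' (v : 'rV[R]_m) : (v <= N + xi)%MS -> ((v *m (A + 1%:M + K' *m B))%R <= N)%MS.
  move=> /sub_addsmxP[[a b] /= ->]; rewrite mulmxDl -!mulmxA.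
  apply: addmx_sub; first exact: submx_trans (submxMl _ _) NF'.
  by apply: submx_trans (submxMl _ _) _; rewrite mulmxDr mulmxA xiK'.
exists K'; split.
  apply/row_subP => i; rewrite row_mul.
  by apply: submx_trans (allF' _ (row_sub _ _)) (addsmxSl _ _).
move=> x g dx vg xN.
pose F' := A + 1%:M + K' *m B; pose y t := x t *m F'.
have FE : A + K' *m B = F' - 1%:M by rewrite /F' addrAC addrK.
have yN t : 0 <= t -> (y t <= N)%MS by move=> t0; exact: allF' (xN t t0).
have vy : vanishes y.
  apply: (HN y (fun t => g t *m F')) => //.
  - apply: (@is_deriv0_ext _ _ _ _ _ _ _ _ (is_deriv0_lin (mulmxr_blin 1 F') dx)) => // t t0 /=.
    rewrite mulmxDl; congr (_ + _).
    have /submxP[z zE] := yN t t0.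
    have -> : y t *m (A + K *m B) = y t *m (A + K' *m B).
      by rewrite zE !mulmxDr; congr (_ + _); rewrite -!mulmxA; congr (_ *m _); rewrite !mulmxA NK'.
    by rewrite /y FE -!mulmxA; congr (_ *m _); rewrite mulmxBl mulmxBr mul1mx mulmx1.
  - exact: (vanishes_lin (mulmxr_blin 1 F') vg).
apply: (@vanishes_damped _ _ x (fun t => y t + g t)); last exact: vanishesD.
apply: (@is_deriv0_ext _ _ _ _ _ _ _ _ dx) => // t t0.
by rewrite FE mulmxBr mulmx1 /y; lmod R.
Qed.

Lemma steered_exists m p (A : 'M[R]_m) (B : 'M[R]_(p, m)) : exists N K,
  [/\ steered A B N K, (B <= N)%MS & (N *m A <= N)%MS].
Proof.
suff [N [K [sNK H]]] : exists N K, steered A B N K /\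
    forall (xi : 'rV_m) (c : 'rV_p), ((xi *m (A + 1%:M) + c *m B)%R <= N)%MS -> (xi <= N)%MS.
  have BN : (B <= N)%MS.
    (* The preimage of [N + B] under [A + 1] has dimension at least that of [N + B]. Maximality puts
       it inside [N], which forces [B] into [N]. *)
    have kN : (kermx ((A + 1%:M)%R *m cokermx (N + B)%MS) <= N)%MS.
      apply/row_subP => i; set xi := row i _.
      have : xi *m ((A + 1%:M) *m cokermx (N + B)%MS) = 0 by apply/sub_kermxP; exact: row_sub.
      rewrite mulmxA => /eqP; rewrite -submxE => /sub_addsmxP[[a b] /= E].
      apply: (H xi (- b)); rewrite E mulNmx addrK; exact: submxMl.
    have := mxrankS kN; rewrite mxrank_ker.
    have := mxrankM_maxr (A + 1%:M) (cokermx (N + B)%MS); rewrite mxrank_coker => h1 h2.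
    have NB := addsmxSl N B.
    have le := rank_leq_col (N + B)%MS.
    have : (\rank (N + B)%MS <= \rank N)%N by apply: leq_trans h2; rewrite -(subKn le); exact: leq_sub2l.
    have := mxrank_leqif_sup NB; move=> [h3 h4] h5.
    have : \rank N == \rank (N + B)%MS by rewrite eqn_leq h3.
    by rewrite h4; exact: submx_trans (addsmxSr _ _).
  exists N, K; split=> //; case: sNK => + _.
  rewrite !mulmxDr mulmx1 mulmxA => NF.
  have -> : N *m A = N *m A + N + N *m K *m B - (N + N *m K *m B) by rewrite -(addrA (N *m A)) addrK.
  apply: addmx_sub => //; rewrite eqmx_opp; apply: addmx_sub => //.
  exact: submx_trans (submxMl _ _) BN.
have s0 : steered A B 0 0.
  split; first by rewrite mul0mx sub0mx.
  move=> x g _ _ H e e0; exists 0 => // t t0.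
  by have := H t t0; rewrite submx0 => /eqP ->; rewrite normr0 ltW.
have [d] : exists d, (m - \rank (0%R : 'M[R]_m) <= d)%N by exists m; rewrite leq_subr.
move: s0; move: (0 : 'M[R]_m) (0 : 'M[R]_(m, p)) => N K.
elim: d N K => [|d IH] N K sNK rk.
  exists N, K; split=> // xi c _; apply: submx_full; rewrite -col_leq_rank.
  by rewrite -subn_eq0 -leqn0.
have [H|] := pselect (forall (xi : 'rV_m) (c : 'rV_p), ((xi *m (A + 1%:M) + c *m B)%R <= N)%MS -> (xi <= N)%MS).
  by exists N, K.
move=> /existsNP[xi /existsNP[c /not_implyP[h1 /negP h2]]].
have [K' sK'] := steered_extend sNK h2 h1.
apply: (IH _ K' sK').
have : (\rank N < \rank (N + xi)%MS)%N.
  apply: rank_ltmx; rewrite ltmxE addsmxSl /=; apply/negP => h; move/negP: h2; apply.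
  exact: submx_trans (addsmxSr _ _) h.
lia.
Qed.

(** The hypothesis is Hautus's condition without eigenvalues: a quotient of the dynamics that the
    input does not reach must decay by itself. It is applied to the quotient by the steered subspace
    [N], which contains the range of [B]; the component in [N] sees the quotient only as a vanishing
    input. *)
Theorem stabilizing_feedback m p (A : 'M[R]_m) (B : 'M[R]_(p, m)) :
  (forall q A' : 'M[R]_m, A *m q = q *m A' -> B *m q = 0 ->
     vanishes (fun t => expm A t *m q)) ->
  exists K : 'M[R]_(m, p), vanishes (expm (A + K *m B)).
Proof.
move=> H; have [N [K [[NF HN] BN NA]]] := steered_exists A B.
(* [q] projects along [N], so [v *m q] represents the class of [v] modulo [N]. *)
exists K; pose q := proj_mx (N^C)%MS N.
have cap : (N^C :&: N)%MS = 0 by rewrite capmxC capmx_compl.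
have Nq : N *m q = 0 by apply: proj_mx_0.
have q1 : ((1%:M - q)%R <= N)%MS.
  rewrite -[X in 1%:M - X]mul1mx; apply: proj_mx_compl_sub; apply: submx_full.
  by rewrite addsmxC; exact: addsmx_compl_full.
clearbody q.
have ann k (Z : 'M[R]_(k, m)) : (Z <= N)%MS -> Z *m q = 0.
  by move=> /submxP[z ->]; rewrite -mulmxA Nq mulmx0.
have Aq : A *m q = q *m (A *m q).
  apply/eqP; rewrite -subr_eq0 -[X in X - _]mul1mx -mulmxBl mulmxA; apply/eqP/ann.
  have /submxP[z ->] := q1; rewrite -mulmxA; exact: submx_trans (submxMl _ _) NA.
have Bq : B *m q = 0 by exact: ann.
have vq := H q (A *m q) Aq Bq.
have dE := expm_deriv (A + K *m B).
apply: vanishes_rows => i.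
pose x t := row i (expm (A + K *m B) t).
have xE t : x t = delta_mx 0 i *m expm (A + K *m B) t by rewrite -rowE.
have dx : is_deriv0 x (fun t => x t *m (A + K *m B)).
  apply: (@is_deriv0_ext _ _ _ _ _ _ _ _ (is_deriv0_lin (mulmxl_blin m (delta_mx 0 i : 'rV[R]_m)) dE)) => t t0 /=.
    by rewrite xE.
  by rewrite mulmxA xE.
have xq t : 0 <= t -> x t *m q = x 0 *m (expm A t *m q).
  move=> t0; rewrite (expm_intertwine Aq t0) mulmxA.
  apply: (@expm_unique _ _ _ (fun t => x t *m q)) => //.
  apply: (@is_deriv0_ext _ _ _ _ _ _ _ _ (is_deriv0_lin (mulmxr_blin 1 q) dx)) => // s s0 /=.
  by rewrite mulmxDr mulmxDl !mulmxA -[x s *m K *m B *m q]mulmxA Bq mulmx0 addr0 -!mulmxA -Aq.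
have vxq : vanishes (fun t => x t *m q).
  apply: vanishes_ext (vanishes_lin (mulmxl_blin m (x 0)) vq) => t t0 /=.
  by rewrite xq.
pose y t := x t *m (1%:M - q).
have yN t : (y t <= N)%MS by exact: submx_trans (submxMl _ _) q1.
have vy : vanishes y.
  apply: (HN y (fun t => x t *m q *m (A + K *m B) *m (1%:M - q))) => //; last first.
    apply: (vanishes_lin (mulmxr_blin 1 (1%:M - q))).
    exact: (vanishes_lin (mulmxr_blin 1 (A + K *m B)) vxq).
  apply: (@is_deriv0_ext _ _ _ _ _ _ _ _ (is_deriv0_lin (mulmxr_blin 1 (1%:M - q)) dx)) => // t t0 /=.
  have E : y t *m (A + K *m B) *m (1%:M - q) = y t *m (A + K *m B).
    rewrite mulmxBr mulmx1 ann ?subr0//.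
    have -> : A + K *m B = A + 1%:M + K *m B - 1%:M by rewrite addrAC addrK.
    rewrite mulmxBr mulmx1; apply: addmx_sub; last by rewrite eqmx_opp.
    by have /submxP[z ->] := yN t; rewrite -mulmxA; exact: submx_trans (submxMl _ _) NF.
  by rewrite -[y t *m _]E -!mulmxDl /y -mulmxDr subrK mulmx1.
apply: vanishes_ext (vanishesD vy vxq) => t t0.
by rewrite /y -mulmxDr subrK mulmx1.
Qed.

End MatrixExponential.
Arguments expm_deriv {R m} A.

(** * Projections of a Schauder subspace-basis *)

Section FindimSub.
Variables (R : realType) (V : normedModType R).

Lemma findim_sub_lin (S : set V) : findim_sub S ->
  S 0 /\ forall a u v, S u -> S v -> S (a *: u + v).
Proof.
move=> [n [e He]]; split.
  by apply/He; exists (fun _ => 0); rewrite big1// => i _; rewrite scale0r.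
move=> a u v /He[c ->] /He[d ->]; apply/He; exists (fun i => a * c i + d i).
by rewrite scaler_sumr -big_split; apply: eq_bigr => i _ /=; rewrite scalerDl scalerA.
Qed.

Lemma findim_sub_closed (S : set V) (v : V) : findim_sub S ->
  (forall e : R, 0 < e -> exists2 u, S u & `|v - u| <= e) -> S v.
Proof.
move=> /findim_sub_param[m [f [lf inj Hf]]] H; apply/Hf.
apply: rV_range_closed => // e e0; have [u Su Hu] := H e e0.
by have [x ux] := (Hf u).1 Su; exists x; rewrite -ux.
Qed.

Lemma findim_sub_add (S1 S2 S : set V) : findim_sub S1 -> findim_sub S2 ->
  (forall v, S v <-> exists u w, [/\ S1 u, S2 w & v = u + w]) -> findim_sub S.
Proof.
move=> [n1 [e1 H1]] [n2 [e2 H2]] HS.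
exists (n1 + n2)%N, (fun i => match fintype.split i with inl j => e1 j | inr k => e2 k end).
move=> v; rewrite HS; split.
  move=> [u [w [/H1[c ->] /H2[d ->] ->]]].
  exists (fun i => match fintype.split i with inl j => c j | inr k => d k end).
  rewrite big_split_ord /=; congr (_ + _); apply: eq_bigr => i _.
    by rewrite -[lshift n2 i]/(unsplit (inl i)) unsplitK.
  by rewrite -[rshift n1 i]/(unsplit (inr i)) unsplitK.
move=> [c ->]; exists (\sum_i c (lshift n2 i) *: e1 i), (\sum_i c (rshift n1 i) *: e2 i).
split; [by apply/H1; exists (fun i => c (lshift n2 i))|by apply/H2; exists (fun i => c (rshift n1 i))|].
rewrite big_split_ord /=; congr (_ + _); apply: eq_bigr => i _.
  by rewrite -[lshift n2 i]/(unsplit (inl i)) unsplitK.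
by rewrite -[rshift n1 i]/(unsplit (inr i)) unsplitK.
Qed.

End FindimSub.

Section Schauder.
Variables (R : realType) (X : completeNormedModType R) (Xs : nat -> set X).
Hypothesis hb : schauder_subspace_basis Xs.

Definition coord (x : X) : nat -> X := sval (cid (hb.2 x)).

Lemma coord_in x j : Xs j (coord x j).
Proof. by rewrite /coord; case: cid => c [[]]. Qed.

Lemma coord_cvg x : series (coord x) n @[n --> \oo] --> x.
Proof. by rewrite /coord; case: cid => c [[]]. Qed.

Arguments coord_cvg x : clear implicits.

Lemma coord_unique x c : (forall j, Xs j (c j)) ->
  (forall e : R, 0 < e -> exists N, forall n, (N <= n)%N -> `|x - \sum_(j < n) c j| <= e) ->
  coord x = c.
Proof.
move=> cX cx; rewrite /coord; case: cid => d [[d1 d2] dU] /=; apply: dU; split=> //.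
apply/cvgrPdist_le => e e0; have [N HN] := cx e e0; exists N => // n /= Nn.
by rewrite /series /= big_mkord; exact: HN.
Qed.

Definition head_proj n x := \sum_(j < n) coord x j.

Lemma head_proj_cvg x (e : R) : 0 < e ->
  exists N, forall n, (N <= n)%N -> `|x - head_proj n x| <= e.
Proof.
move=> e0; have /cvgrPdist_le /(_ e e0) [N _ HN] := coord_cvg x.
by exists N => n Nn; have := HN n Nn; rewrite /series /= big_mkord.
Qed.

Let Xs_lin j := findim_sub_lin (hb.1 j).

Lemma coord_lin a x y j : coord (a *: x + y) j = a *: coord x j + coord y j.
Proof.
rewrite (@coord_unique (a *: x + y) (fun j => a *: coord x j + coord y j))//.
  by move=> i; apply: (Xs_lin i).2; exact: coord_in.
move=> e e0; have a1 : 0 < `|a| + 1 by rewrite ltr_wpDl.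
have [N1 H1] := head_proj_cvg x (e := e / 2 / (`|a| + 1)) ltac:(by rewrite !divr_gt0).
have [N2 H2] := head_proj_cvg y (e := e / 2) ltac:(lra).
exists (maxn N1 N2) => n; rewrite geq_max => /andP[/H1 h1 /H2 h2].
have -> : a *: x + y - \sum_(i < n) (a *: coord x i + coord y i) =
   a *: (x - head_proj n x) + (y - head_proj n y).
  by rewrite big_split -scaler_sumr /= /head_proj; lmod R.
apply: (le_trans (ler_normD _ _)); rewrite normrZ.
have : `|a| * `|x - head_proj n x| <= (`|a| + 1) * (e / 2 / (`|a| + 1)).
  by apply: ler_pM => //; lra.
rewrite [X in _ <= X]mulrC divfK ?gt_eqF//; lra.
Qed.

Lemma head_proj_lin n : is_linear (head_proj n).
Proof.
move=> a x y; rewrite /head_proj scaler_sumr -big_split.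
by apply: eq_bigr => i _; exact: coord_lin.
Qed.

Lemma coord_block j y i : Xs j y -> coord y i = if i == j then y else 0.
Proof.
move=> yj; rewrite (@coord_unique y (fun i => if i == j then y else 0))//.
  by move=> k; case: eqP => [->//|_]; exact: (Xs_lin k).1.
move=> e e0; exists j.+1 => n jn.
rewrite (bigD1 (Ordinal jn))//= eqxx big1 ?addr0 ?subrr ?normr0 ?ltW//.
by move=> k /negbTE; rewrite -val_eqE /= => ->.
Qed.

Lemma coord_sum (I : Type) (r : seq I) (F : I -> X) j :
  coord (\sum_(i <- r) F i) j = \sum_(i <- r) coord (F i) j.
Proof. by apply: (@lin_sum _ _ _ (fun x => coord x j)) => a x y; exact: coord_lin. Qed.

Lemma coord_head_proj n x j : coord (head_proj n x) j = if (j < n)%N then coord x j else 0.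
Proof.
rewrite /head_proj coord_sum; case: ltnP => jn.
  rewrite (bigD1 (Ordinal jn))//= (coord_block _ (coord_in x j)) eqxx big1 ?addr0//.
  move=> i ij; rewrite (coord_block _ (coord_in x i)) eq_sym.
  by move: ij; rewrite -val_eqE /= => /negbTE ->.
rewrite big1// => i _; rewrite (coord_block _ (coord_in x i)).
by case: eqP => // ji; move: (ltn_ord i); rewrite -ji ltnNge jn.
Qed.

Lemma head_proj_comp m n x : (m <= n)%N ->
  head_proj m (head_proj n x) = head_proj m x /\ head_proj n (head_proj m x) = head_proj m x.
Proof.
move=> mn; split.
  apply: eq_bigr => i _; rewrite coord_head_proj.
  by rewrite (leq_trans (ltn_ord i) mn).
rewrite {1}/head_proj (eq_bigr (fun i : 'I_n => if (i < m)%N then coord x i else 0)).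
  rewrite -big_mkcond /= -(big_mkord (fun i => (i < m)%N) (coord x)).
  by rewrite /head_proj -[RHS](big_mkord xpredT (coord x)) [RHS](big_nat_widen _ _ _ _ _ mn).
by move=> i _; rewrite coord_head_proj.
Qed.

Lemma head_proj_findim n : findim_sub [set x | head_proj n x = x].
Proof.
elim: n => [|n IH].
  exists 0%N, (fun _ => 0) => x; rewrite /head_proj /= big_ord0; split=> [<-|[c ->]].
    by exists (fun _ => 0); rewrite big_ord0.
  by rewrite big_ord0.
apply: (findim_sub_add IH (hb.1 n)) => x; split=> [|[u [w [/= hu wn ->]]]].
  rewrite /= {1}/head_proj big_ord_recr /= => hx.
  exists (head_proj n x), (coord x n); split.
  - by case: (head_proj_comp x (leqnn n)).
  - exact: coord_in.
  - by rewrite -[LHS]hx.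
rewrite /= (linD (head_proj_lin _)); congr (_ + _).
  by rewrite -{1}hu (head_proj_comp u (leqnSn n)).2.
rewrite /head_proj (bigD1 (Ordinal (ltnSn n)))//= (coord_block _ wn) eqxx big1 ?addr0//.
by move=> i; rewrite -val_eqE /= (coord_block _ wn) => /negbTE ->.
Qed.

(* Open mapping argument for the norm [sup_n |head_proj n x|], which is complete. *)
Lemma head_proj_approx : exists2 K : R, 0 < K & forall (y : X) (e : R), 0 < e ->
  exists2 b, (forall n, `|head_proj n b| <= K * `|y|) & `|y - b| <= e.
Proof.
(* These sets cover [X], so by Baire the closure of one of them contains a ball; differences of its
   points approximate a ball around the origin at twice the bound. *)
pose B (N : nat) := [set x : X | forall n, `|head_proj n x| <= N%:R].
have BU x : exists N, B N x.
  have [N0 HN0] := head_proj_cvg x ltr01.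
  pose c := \sum_(n < N0) `|head_proj n x| + (`|x| + 1).
  exists (Num.trunc c).+1 => n; apply: (@le_trans _ _ c); last exact/ltW/truncnS_gt.
  have s0 (P : pred 'I_N0) : 0 <= \sum_(n < N0 | P n) `|head_proj n x| by apply: sumr_ge0.
  have [nN|Nn] := ltnP n N0.
    rewrite /c (bigD1 (Ordinal nN))//= -addrA lerDl addr_ge0// addr_ge0//.
  have := HN0 n Nn; have := ler_normB x (x - head_proj n x); rewrite subKr.
  have := s0 xpredT; rewrite /c; lra.
have [N [x0 [r r0 Hr]]] : exists N x0, exists2 r : R, 0 < r & ball x0 r `<=` closure (B N).
  apply: contrapT => H.
  have : dense (\bigcap_i (~` closure (B i))).
    apply: Baire => i; split; first by apply: closed_openC; exact: closed_closure.
    move=> O [x Ox] oO; apply: contrapT => h; apply: H; exists i, x.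
    have /nbhs_ballP[r /= r0 Hr] : nbhs x O by apply: open_nbhs_nbhs.
    exists r => // y /Hr Oy; apply: contrapT => ny; apply: h.
    by exists y; split.
  move=> /(_ setT) []; [by exists 0|exact: openT|move=> x [_ hx]].
  have [i Bi] := BU x; exact: (hx i Logic.I (subset_closure Bi)).
have approx z : `|z| < r -> forall e : R, 0 < e ->
    exists2 b, (forall n, `|head_proj n b| <= 2 * N%:R) & `|z - b| <= e.
  move=> zr e e0.
  have cl w : ball x0 r w -> exists2 b, B N b & `|w - b| <= e / 2.
    move=> /Hr /(_ (ball w (e / 2))) [|b [Bb wb]].
      by apply/nbhs_ballP; exists (e / 2) => //=; lra.
    by exists b => //; move: wb; rewrite -ball_normE /= => /ltW.
  have [|b1 B1 h1] := cl (x0 + z).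
    by rewrite -ball_normE /= opprD addNKr normrN.
  have [|b2 B2 h2] := cl x0; first exact: ballxx.
  exists (b1 - b2).
    move=> n; rewrite (linB (head_proj_lin n)).
    have := B1 n; have := B2 n; have := ler_normB (head_proj n b1) (head_proj n b2); lra.
  have -> : z - (b1 - b2) = (x0 + z - b1) - (x0 - b2) by lmod R.
  by apply: (le_trans (ler_normB _ _)); lra.
exists (4 * (N%:R + 1) / r); first by rewrite divr_gt0// mulr_gt0// ltr_wpDl.
move=> y e e0; have [->|y0] := eqVneq y 0.
  exists 0; last by rewrite subrr normr0 ltW.
  by move=> n; rewrite (lin0 (head_proj_lin n)) !normr0 mulr0.
have ny : 0 < `|y| by rewrite normr_gt0.
pose a := r / 2 / `|y|.
have a0 : 0 < a by rewrite !divr_gt0.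
have [|b Hb hb'] := approx (a *: y) _ (a * e) ltac:(exact: mulr_gt0).
  by rewrite normrZ gtr0_norm// /a divfK ?gt_eqF//; lra.
exists (a^-1 *: b).
  move=> n; rewrite (linZ (head_proj_lin n)) normrZ normfV (gtr0_norm a0).
  rewrite mulrC ler_pdivrMr//; apply: (le_trans (Hb n)).
  have -> : 4 * (N%:R + 1) / r * `|y| * a = 2 * (N%:R + 1) by rewrite /a; field; rewrite !gt_eqF.
  lra.
have -> : y - a^-1 *: b = a^-1 *: (a *: y - b).
  by rewrite scalerBr scalerA mulVf ?scale1r// gt_eqF.
by rewrite normrZ normfV (gtr0_norm a0) mulrC ler_pdivrMr// mulrC.
Qed.

Lemma head_proj_bound : exists2 c : R, 0 < c & forall n x, `|head_proj n x| <= c * `|x|.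
Proof.
have [K K0 HK] := head_proj_approx.
exists (2 * K); first by rewrite mulr_gt0.
move=> m x; have [->|x0] := eqVneq x 0.
  by rewrite (lin0 (head_proj_lin m)) !normr0 mulr0.
have nx : 0 < `|x| by rewrite normr_gt0.
have half n : 0 < 2^-1 ^+ n :> R by rewrite exprn_gt0// invr_gt0.
have /choice[f Hf] : forall p : X * R, exists b, 0 < p.2 ->
    (forall n, `|head_proj n b| <= K * `|p.1|) /\ `|p.1 - b| <= p.2.
  move=> [y e] /=; have [e0|e0] := ltP 0 e; last by exists 0; lra.
  by have [b b1 b2] := HK y e e0; exists b.
pose y := fix y (k : nat) := if k is j.+1 then y j - f (y j, 2^-1 ^+ j.+1 * `|x|) else x.
pose b k := f (y k, 2^-1 ^+ k.+1 * `|x|).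
have pos k : 0 < 2^-1 ^+ k * `|x| by rewrite mulr_gt0.
have yk k : `|y k| <= 2^-1 ^+ k * `|x|.
  case: k => [|k]; first by rewrite expr0 mul1r.
  by have [_] := Hf (y k, 2^-1 ^+ k.+1 * `|x|) (pos k.+1).
have bk k n : `|head_proj n (b k)| <= K * `|x| * 2^-1 ^+ k.
  have [h _] := Hf (y k, 2^-1 ^+ k.+1 * `|x|) (pos k.+1).
  by apply: (le_trans (h n)); rewrite /= -mulrA ler_pM2l// [X in _ <= X]mulrC; exact: yk.
pose w k := \sum_(i < k) b i.
have xw k : x - w k = y k.
  elim: k => [|k IH]; first by rewrite /w big_ord0 subr0.
  by rewrite /w big_ord_recr /= opprD addrA -/(w k) IH.
have c0 : 0 <= K * `|x| by rewrite mulr_ge0// ltW.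
have /choice[s Hs] : forall n, exists l, forall k, `|head_proj n (w k) - l| <= 2 * (K * `|x|) * 2^-1 ^+ k.
  move=> n; apply: (@cauchy_geo R X (fun k => head_proj n (w k))) => // k.
  by rewrite /w big_ord_recr /= (linD (head_proj_lin n)) addrC addKr.
have s0 : s 0%N = 0.
  apply/eqP; rewrite -normr_le0; apply/ler_addgt0Pr => e e0; rewrite add0r.
  have [k hk] := @geometric_small R (2 * (K * `|x|)) e ltac:(lra) e0; apply: le_trans hk.
  by have := Hs 0%N k; rewrite /head_proj big_ord0 sub0r normrN.
have cE : coord x = fun j => s j.+1 - s j.
  apply: coord_unique.
    move=> j; apply: findim_sub_closed (hb.1 j) _ => e e0.
    have [k hk] := @geometric_small R (4 * (K * `|x|)) e ltac:(lra) e0.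
    exists (coord (w k) j); first exact: coord_in.
    have -> : s j.+1 - s j - coord (w k) j = (head_proj j (w k) - s j) - (head_proj j.+1 (w k) - s j.+1).
      by rewrite {2}/head_proj big_ord_recr /= -/(head_proj j (w k)); lmod R.
    apply: le_trans (ler_normB _ _) _; have := Hs j k; have := Hs j.+1 k; lra.
  move=> e e0.
  have [k1 hk1] := @geometric_small R (2 * (K * `|x|)) (e / 3) ltac:(lra) ltac:(lra).
  have [k2 hk2] := @geometric_small R `|x| (e / 3) ltac:(lra) ltac:(lra).
  pose k := maxn k1 k2.
  have mono (C : R) i : 0 <= C -> (i <= k)%N -> C * 2^-1 ^+ k <= C * 2^-1 ^+ i.
    by move=> C0 ik; rewrite ler_wpM2l// ler_wiXn2l//; lra.
  have h1 := mono (2 * (K * `|x|)) k1 ltac:(lra) (leq_maxl _ _).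
  have h2 := mono `|x| k2 (normr_ge0 _) (leq_maxr _ _).
  have [N HN] := head_proj_cvg (w k) (e := e / 3) ltac:(lra).
  exists N => n Nn.
  have -> : \sum_(j < n) (s j.+1 - s j) = s n.
    by rewrite -(big_mkord xpredT (fun j => s j.+1 - s j)) telescope_sumr// s0 subr0.
  have -> : x - s n = (x - w k) + (w k - head_proj n (w k)) + (head_proj n (w k) - s n) by lmod R.
  have := ler_normD (x - w k + (w k - head_proj n (w k))) (head_proj n (w k) - s n).
  have := ler_normD (x - w k) (w k - head_proj n (w k)).
  have := HN n Nn; have := Hs n k; have := yk k; rewrite -xw mulrC.
  lra.
have -> : head_proj m x = s m.
  by rewrite /head_proj cE -(big_mkord xpredT (fun j => s j.+1 - s j)) telescope_sumr// s0 subr0.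
have := Hs m 0%N; rewrite /w big_ord0 (lin0 (head_proj_lin m)) sub0r normrN expr0; lra.
Qed.

Lemma head_proj_blin n : bounded_linear (head_proj n).
Proof.
have [c c0 Hc] := head_proj_bound.
exact: (bounded_linear_intro (head_proj_lin n) (Hc n)).
Qed.

Section Adapted.
Variable T : R -> X -> X.
Hypotheses (sgT : C0_semigroup T) (hadapt : adapted Xs T).

(** By invariance and continuity, [T t] maps the expansion of [x] term by term to an expansion of
    [T t x], and expansions are unique. *)
Lemma head_proj_sg n t x : 0 <= t -> head_proj n (T t x) = T t (head_proj n x).
Proof.
move=> t0; rewrite /head_proj (lin_sum (sg_lin sgT t0)); apply: eq_bigr => j _.
rewrite (@coord_unique (T t x) (fun j => T t (coord x j)))//.
  by move=> i; apply: hadapt => //; exact: coord_in.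
have [M M0 HM] := bounded_linear_bound (sg_blin sgT t0).
move=> e e0; have [N HN] := head_proj_cvg x (e := e / M) ltac:(exact: divr_gt0).
exists N => k Nk; have := HN k Nk.
rewrite -(lin_sum (sg_lin sgT t0)) -(linB (sg_lin sgT t0)) ler_pdivlMr// mulrC.
exact: le_trans (HM _).
Qed.

End Adapted.
End Schauder.

(** * The range of a bounded projection as a Banach space *)

Section ProjectionRange.
Variables (R : realType) (X : completeNormedModType R) (p : X -> X).
Hypotheses (bp : bounded_linear p) (pp : forall x, p (p x) = p x).

(** The range as the set of fixed points. The two proofs are parameters of the type so that the
    instances declared below, which depend on them, can be found from the type. *)
Definition prange (_ : bounded_linear p) (_ : forall x, p (p x) = p x) : Type :=
  {x : X | x \in [set x | p x = x]}.
Local Notation W := (prange bp pp).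

Definition pincl (w : W) : X := val w.

Lemma pinclK (w : W) : p (pincl w) = pincl w.
Proof. by have := valP w; rewrite inE. Qed.

Lemma pproj_subproof x : p x \in [set x | p x = x]. Proof. by rewrite inE /= pp. Qed.
Definition pproj (x : X) : W := exist _ (p x) (pproj_subproof x).

Lemma pincl_proj x : pincl (pproj x) = p x. Proof. by []. Qed.
Lemma pincl_inj : injective pincl. Proof. exact: val_inj. Qed.
Lemma pproj_incl w : pproj (pincl w) = w. Proof. by apply: pincl_inj; exact: pinclK. Qed.

HB.instance Definition _ := Choice.copy (prange bp pp) {x : X | x \in [set x | p x = x]}.

Let lp : is_linear p := bp.1.
Let add (u v : W) : W := pproj (pincl u + pincl v).
Let opp (u : W) : W := pproj (- pincl u).
Let zero : W := pproj 0.
Let scale (a : R) (u : W) : W := pproj (a *: pincl u).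

Let addE u v : pincl (add u v) = pincl u + pincl v.
Proof. by rewrite pincl_proj (linD lp) !pinclK. Qed.
Let oppE u : pincl (opp u) = - pincl u.
Proof. by rewrite pincl_proj (linN lp) pinclK. Qed.
Let zeroE : pincl zero = 0. Proof. by rewrite pincl_proj (lin0 lp). Qed.
Let scaleE a u : pincl (scale a u) = a *: pincl u.
Proof. by rewrite pincl_proj (linZ lp) pinclK. Qed.

Lemma prange_addA : associative add.
Proof. by move=> u v w; apply: pincl_inj; rewrite !addE addrA. Qed.
Lemma prange_addC : commutative add.
Proof. by move=> u v; apply: pincl_inj; rewrite !addE addrC. Qed.
Lemma prange_add0 : left_id zero add.
Proof. by move=> u; apply: pincl_inj; rewrite addE zeroE add0r. Qed.
Lemma prange_addN : left_inverse zero opp add.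
Proof. by move=> u; apply: pincl_inj; rewrite addE zeroE oppE addNr. Qed.

HB.instance Definition _ := GRing.isZmodule.Build (prange bp pp)
  prange_addA prange_addC prange_add0 prange_addN.

Lemma prange_scaleA a b (v : W) : scale a (scale b v) = scale (a * b) v.
Proof. by apply: pincl_inj; rewrite !scaleE scalerA. Qed.
Lemma prange_scale1 : left_id 1 scale.
Proof. by move=> v; apply: pincl_inj; rewrite scaleE scale1r. Qed.
Lemma prange_scaleDr : right_distributive scale +%R.
Proof. by move=> a u v; apply: pincl_inj; rewrite scaleE !addE !scaleE scalerDr. Qed.
Lemma prange_scaleDl (v : W) : {morph scale^~ v : a b / a + b}.
Proof. by move=> a b; apply: pincl_inj; rewrite addE !scaleE scalerDl. Qed.

HB.instance Definition _ := GRing.Zmodule_isLmodule.Build R (prange bp pp)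
  prange_scaleA prange_scale1 prange_scaleDr prange_scaleDl.

Lemma pincl_lin : is_linear pincl.
Proof. by move=> a u v; rewrite [LHS]addE scaleE. Qed.

Lemma pproj_lin : is_linear pproj.
Proof. by move=> a u v; apply: pincl_inj; rewrite pincl_lin !pincl_proj lp. Qed.

Let norm (u : W) : R := `|pincl u|.

Lemma prange_normD u v : norm (u + v) <= norm u + norm v.
Proof. by rewrite /norm (linD pincl_lin); exact: ler_normD. Qed.
Lemma prange_normZ a u : norm (a *: u) = `|a| * norm u.
Proof. by rewrite /norm (linZ pincl_lin) normrZ. Qed.
Lemma prange_norm0 u : norm u = 0 -> u = 0.
Proof. by move/normr0_eq0 => u0; apply: pincl_inj; rewrite u0 (lin0 pincl_lin). Qed.

HB.instance Definition _ := Lmodule_isNormed.Build R (prange bp pp)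
  prange_normD prange_normZ prange_norm0.

Lemma prange_normE (u : W) : `|u| = `|pincl u|. Proof. by []. Qed.

Lemma prange_complete (F : set_system W) : ProperFilter F -> cauchy F -> cvg F.
Proof.
move=> FF Fc.
have cF : cauchy (pincl @ F).
  apply/cauchy_ballP => e e0; have /cauchy_ballP /(_ e e0) := Fc.
  move=> [[A B] /= [FA FB] H]; exists (pincl @` A, pincl @` B) => /=.
    by split; [apply: filterS FA => x Ax|apply: filterS FB => x Bx]; exists x.
  move=> [_ _] /= [[a Aa <-] [b Bb <-]]; have := H (a, b) (conj Aa Bb).
  by rewrite -!ball_normE /= prange_normE (linB pincl_lin).
have /cvg_ex[l Hl] : cvg (pincl @ F) by apply/cauchy_cvgP.
have pl : p l = l.
  have h1 : (p \o pincl) x @[x --> F] --> p l by apply: cvg_comp Hl _; exact: bp.2.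
  have h2 : (p \o pincl) = pincl by apply/funext => x /=; exact: pinclK.
  rewrite h2 in h1; exact: cvg_unique h1 Hl.
apply/cvg_ex; exists (pproj l); apply/cvgrPdist_le => e e0.
have /cvgrPdist_le /(_ e e0) := Hl; apply: filterS => x hx.
by rewrite prange_normE (linB pincl_lin) pincl_proj pl.
Qed.

HB.instance Definition _ := Uniform_isComplete.Build (prange bp pp) prange_complete.

Lemma pincl_blin : bounded_linear pincl.
Proof.
by apply: (@bounded_linear_intro _ _ _ _ 1) => [|u]; [exact: pincl_lin|rewrite mul1r].
Qed.

Lemma pproj_blin : bounded_linear pproj.
Proof.
have [M M0 HM] := bounded_linear_bound bp.
by apply: (@bounded_linear_intro _ _ _ _ M) => [|u]; [exact: pproj_lin|exact: HM].
Qed.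

Variables (D : set X) (A : X -> X) (T : R -> X -> X).
Hypotheses (hG : generator D A T) (pT : forall t x, 0 <= t -> p (T t x) = T t (p x)).
Let sgT : C0_semigroup T := hG.1.

Definition rdom : set W := [set w | D (pincl w)].
(** The outer projection only serves to land in the range: it changes nothing on the domain, nor in
    [rsg] at nonnegative times. *)
Definition rgen (w : W) : W := pproj (A (pincl w)).
Definition rsg (t : R) (w : W) : W := pproj (T t (pincl w)).

Lemma pincl_sg t w : 0 <= t -> pincl (rsg t w) = T t (pincl w).
Proof. by move=> t0; rewrite pincl_proj pT// pinclK. Qed.

Lemma gen_proj x : D x -> D (p x) /\ A (p x) = p (A x).
Proof.
move=> Dx; apply: (gen_intro hG) => e e0.
have [M M0 HM] := bounded_linear_bound bp.
have [d d0 Hd] := genP hG Dx (e := e / M) ltac:(exact: divr_gt0).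
exists d => // h h0 hd; rewrite -pT; last exact: ltW.
rewrite -(linB lp) -(linZ lp) -(linB lp); apply: (le_trans (HM _)).
by have := Hd h h0 hd; rewrite mulrAC ler_pdivlMr// mulrC.
Qed.

Lemma pincl_gen w : D (pincl w) -> pincl (rgen w) = A (pincl w).
Proof. by move=> Dw; rewrite pincl_proj -(gen_proj Dw).2 pinclK. Qed.

Lemma restricted_generator : generator rdom rgen rsg.
Proof.
split.
  split.
  - move=> t t0; have [M M0 HM] := bounded_linear_bound (sg_blin sgT t0).
    apply: (@bounded_linear_intro _ _ _ _ M) => [a u v|u].
      by apply: pincl_inj; rewrite pincl_lin !pincl_sg// pincl_lin (sg_lin sgT t0).
    by rewrite !prange_normE pincl_sg.
  - by move=> x; apply: pincl_inj; rewrite pincl_sg// sg0.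
  - move=> s t x s0 t0; apply: pincl_inj; rewrite !pincl_sg ?addr_ge0//.
    by rewrite (sgD sgT).
  - move=> x; apply/cont0P => t t0 e e0.
    have [d d0 Hd] := (cont0P _).1 (sg_cont sgT (pincl x)) t t0 e e0.
    exists d => // s s0 st; rewrite prange_normE (linB pincl_lin) !pincl_sg//.
    exact: Hd.
have lim x l : glim rsg x l <-> glim T (pincl x) (pincl l).
  split=> H e e0; have [d d0 Hd] := H e e0; exists d => // h h0 hd; have := Hd h h0 hd.
    by rewrite prange_normE !(linB pincl_lin) (linZ pincl_lin) pincl_sg//; exact: ltW.
  by rewrite prange_normE !(linB pincl_lin) (linZ pincl_lin) pincl_sg//; exact: ltW.
move=> x; split.
  split=> [Dx|[l /gen_limP /lim Hl]].
    by exists (rgen x); apply/gen_limP/lim; rewrite pincl_gen//; exact: (genP hG Dx).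
  exact: (gen_intro hG Hl).1.
by move=> Dx; apply/gen_limP/lim; rewrite pincl_gen//; exact: (genP hG Dx).
Qed.

End ProjectionRange.

(** * Forced response and output of an exponentially stable semigroup *)

Section ExponentialDecay.
Variable R : realType.

Lemma expR_small (K b e : R) : 0 < b -> 0 < e -> exists2 a : R, 0 <= a &
  forall t, a <= t -> K * expR (- b * t) <= e.
Proof.
move=> b0 e0; pose a := `|K| / e / b.
have a0 : 0 <= a by rewrite !divr_ge0// ltW.
exists a => // t at_; have E := expR_gt0 (b * t).
rewrite mulNr expRN ler_pdivrMr//.
have h : `|K| <= e * (b * t).
  have : e * (b * a) <= e * (b * t) by rewrite !ler_pM2l.
  have -> : `|K| = e * (b * a) by rewrite /a; field; rewrite !gt_eqF.
  by [].
have := expR_ge1Dx (b * t); have := ler_norm K => h2 h3.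
have : e * (b * t) <= e * expR (b * t) by rewrite ler_pM2l//; lra.
lra.
Qed.

Variables (X : completeNormedModType R) (D : set X) (A : X -> X) (T : R -> X -> X).
Hypothesis hG : generator D A T.
Let sgT : C0_semigroup T := hG.1.
Variables (M b : R).
Hypotheses (M0 : 0 < M) (b0 : 0 < b).
Hypothesis HT : forall t x, 0 <= t -> `|T t x| <= M * expR (- b * t) * `|x|.

(** The integral of [expR (- b * (t - s)) * expR (- c * s)] over [[0, t]] is at most
    [expR (- c * t) / (b - c)]. The forcing is controlled before [t] only, which permits a bootstrap
    on a bounded interval. *)
Lemma forced_decay (z f : R -> X) (t phi c : R) : cont0 z -> 0 <= t -> 0 <= phi -> c < b ->
  (forall s, 0 <= s -> D (z s)) ->
  (forall s, 0 <= s -> rderiv z s (A (z s) + f s)) ->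
  (forall s, 0 <= s -> s < t -> `|f s| <= phi * expR (- c * s)) ->
  `|z t| <= M * (`|z 0| + phi / (b - c)) * expR (- c * t).
Proof.
move=> cz t0 p0 cb Dz dz Hf.
have bc0 : 0 < b - c by lra.
pose k := M * phi / (b - c) * expR (- b * t).
have k0 : 0 <= k by rewrite !mulr_ge0 ?expR_ge0 ?invr_ge0 ?(ltW M0)// ltW.
have := @duhamel R X D A T hG z f t cz t0 Dz dz (fun s => k * expR ((b - c) * s))
  (fun s => k * ((b - c) * expR ((b - c) * s))).
move=> /(_ (@is_deriv0Z R R^o k _ _ (@is_deriv0_expR R (b - c)))) h.
have {}h : `|z t - T t (z 0)| <= k * expR ((b - c) * t) - k * expR ((b - c) * 0).
  apply: h => s s0 st; apply: (le_trans (HT _ _)); first lra.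
  have E : expR (- b * t) * expR ((b - c) * s) = expR (- b * (t - s)) * expR (- c * s).
    by rewrite -!expRD; congr expR; ring.
  have -> : k * ((b - c) * expR ((b - c) * s)) = M * expR (- b * (t - s)) * (phi * expR (- c * s)).
    rewrite (_ : k * _ = M * phi * (expR (- b * t) * expR ((b - c) * s))).
      by rewrite E; ring.
    by rewrite /k; field; lra.
  by rewrite ler_wpM2l ?Hf// mulr_ge0 ?expR_ge0// ltW.
have e1 : k * expR ((b - c) * t) = M * (phi / (b - c)) * expR (- c * t).
  by rewrite /k -[LHS]mulrA -expRD; congr (_ * expR _); [field; lra|ring].
have h2 := HT (z 0) t0.
have e2 : expR (- b * t) <= expR (- c * t) by rewrite ler_expR ler_wpM2r//; lra.
have h3 : M * expR (- b * t) * `|z 0| <= M * expR (- c * t) * `|z 0|.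
  by rewrite ler_wpM2r// ler_pM2l.
have := ler_normD (z t - T t (z 0)) (T t (z 0)); rewrite subrK.
have : 0 <= k * expR ((b - c) * 0) by rewrite mulr_ge0// expR_ge0.
move: h; rewrite e1 mulrDr [(_ + _) * expR _]mulrDl => h4 h5 h6.
have -> : M * `|z 0| * expR (- c * t) = M * expR (- c * t) * `|z 0| by ring.
lra.
Qed.

(* [Ct] is [- C] composed with the improper integral of [T s] over
   [s >= 0], that is, [C] composed with the inverse of [A]. *)
Lemma output_factor (Y : completeNormedModType R) (C : X -> Y) : graph_bounded D A C ->
  exists Ct : X -> Y, bounded_linear Ct /\ forall x, D x -> C x = Ct (A x).
Proof.
move=> [lC [Mc0 HC0]]; pose Mc := `|Mc0| + 1.
have Mcp : 0 < Mc by rewrite ltr_wpDl.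
have HC x : D x -> `|C x| <= Mc * (`|x| + `|A x|).
  move=> Dx; apply: (le_trans (HC0 x Dx)); rewrite ler_wpM2r ?addr_ge0//.
  by rewrite /Mc; have := ler_norm Mc0; lra.
have D0 := (gen0 hG).1.
have C0 : C 0 = 0 by have /eqP := lC 1 0 0 D0 D0; rewrite !scale1r addr0 -subr_eq0 opprD addrA subrr sub0r oppr_eq0 => /eqP.
have CB x y : D x -> D y -> C (x - y) = C x - C y.
  by move=> Dx Dy; rewrite addrC -scaleN1r lC// scaleN1r addrC.
(* [sgV T n x] is Cauchy in the graph norm, since [A] maps it to [T n x - x], so [u n x] converges.
   At [A x] in place of [x] the limit is [- C x], because there [u n] is [C (T n x - x)]. *)
pose u (n : nat) x := C (sgV T n%:R x).
have Du n x := gen_sgV hG x (ler0n R n).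
have Vd m n x : (m <= n)%N -> `|sgV T n%:R x - sgV T m%:R x| <= M / b * expR (- b * m%:R) * `|x|.
  move=> mn; pose k := - (M * `|x| / b).
  have := @prim_bound R X (fun s => T s x) (fun s => k * expR (- b * s)) (fun s => k * (- b * expR (- b * s)))
    m%:R n%:R (sg_cont sgT x) (@is_deriv0Z R R^o k _ _ (@is_deriv0_expR R (- b))) (ler0n _ _).
  rewrite ler_nat => /(_ mn) /(_ _)/le_trans; apply.
    move=> s ms sn; have s0 : 0 <= s by exact: le_trans ms.
    apply: (le_trans (HT _ s0)); rewrite le_eqVlt; apply/orP; left; apply/eqP.
    by rewrite /k; field; rewrite gt_eqF.
  have -> : k * expR (- b * n%:R) - k * expR (- b * m%:R) = M / b * expR (- b * m%:R) * `|x| -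
    M / b * expR (- b * n%:R) * `|x| by rewrite /k; field; rewrite gt_eqF.
  by rewrite lerBlDr lerDl !mulr_ge0 ?expR_ge0 ?invr_ge0// ltW.
pose K := Mc * (M / b + 2 * M).
have K0 : 0 < K.
  have : 0 < M / b by rewrite divr_gt0.
  by move=> h; rewrite /K mulr_gt0// addr_gt0// mulr_gt0.
have ud m n x : (m <= n)%N -> `|u n x - u m x| <= K * expR (- b * m%:R) * `|x|.
  move=> mn; have [D1 A1] := Du n x; have [D2 A2] := Du m x.
  rewrite /u -CB//; apply: (le_trans (HC _ (genB hG D1 D2).1)).
  rewrite (genB hG D1 D2).2 A1 A2.
  have -> : T n%:R x - x - (T m%:R x - x) = T n%:R x - T m%:R x by lmod R.
  have h1 := Vd m n x mn.
  have h2 := HT x (ler0n R n); have h3 := HT x (ler0n R m).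
  have h4 : M * expR (- b * n%:R) * `|x| <= M * expR (- b * m%:R) * `|x|.
    by rewrite ler_wpM2r// ler_pM2l// ler_expR !mulNr lerN2 ler_pM2l// ler_nat.
  have h5 := ler_normB (T n%:R x) (T m%:R x).
  rewrite /K -!mulrA ler_pM2l// mulrDl !mulrA; lra.
have /choice[L HL] : forall x, exists l, forall e : R, 0 < e -> exists N, forall n, (N <= n)%N -> `|u n x - l| <= e.
  move=> x; apply: cauchy_seq => e e0.
  have [a a0 Ha] := expR_small (K * `|x|) b0 e0.
  exists (Num.trunc a).+1 => n m.
  wlog mn : n m / (m <= n)%N => [H Nn Nm|Nn Nm].
    by case: (leqP m n) => [|/ltnW] mn; [|rewrite distrC]; exact: H.
  apply: (le_trans (ud _ _ x mn)); rewrite mulrAC; apply: Ha.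
  by rewrite ltW// (lt_le_trans (truncnS_gt _))// ler_nat.
have uniq x l : (forall e : R, 0 < e -> exists N, forall n, (N <= n)%N -> `|u n x - l| <= e) -> L x = l.
  move=> H; apply/eqP; rewrite -subr_eq0 -normr_le0; apply/ler_addgt0Pr => e e0; rewrite add0r.
  have [N1 H1] := H (e / 2) ltac:(lra); have [N2 H2] := HL x (e / 2) ltac:(lra).
  have := H1 (maxn N1 N2) (leq_maxl _ _); have := H2 (maxn N1 N2) (leq_maxr _ _).
  have := ler_normB (u (maxn N1 N2) x - l) (u (maxn N1 N2) x - L x).
  have -> : u (maxn N1 N2) x - l - (u (maxn N1 N2) x - L x) = L x - l by lmod R.
  lra.
have lL : is_linear L.
  move=> a x y; apply: uniq => e e0; have a1 : 0 < `|a| + 1 by rewrite ltr_wpDl.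
  have [N1 H1] := HL x (e / 2 / (`|a| + 1)) ltac:(by rewrite !divr_gt0).
  have [N2 H2] := HL y (e / 2) ltac:(lra).
  exists (maxn N1 N2) => n; rewrite geq_max => /andP[/H1 h1 /H2 h2].
  rewrite /u (sgV_lin sgT (ler0n _ n)) lC; [|exact: (Du n x).1|exact: (Du n y).1].
  have -> : a *: C (sgV T n%:R x) + C (sgV T n%:R y) - (a *: L x + L y) =
    a *: (u n x - L x) + (u n y - L y) by rewrite /u; lmod R.
  apply: (le_trans (ler_normD _ _)); rewrite normrZ.
  have : `|a| * `|u n x - L x| <= (`|a| + 1) * (e / 2 / (`|a| + 1)) by apply: ler_pM => //; lra.
  rewrite [X in _ <= X]mulrC divfK ?gt_eqF//; lra.
have bL : bounded_linear (fun x => - L x).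
  apply: (@bounded_linear_intro _ _ _ _ K) => [a x y|x]; first by rewrite lL; lmod R.
  rewrite normrN; apply/ler_addgt0Pr => e e0; have [N HN] := HL x e e0.
  have := HN N (leqnn _); have := ud 0%N N x (leq0n _).
  rewrite mulr0 expR0 mulr1 [u 0%N x]/u (sgV0 sgT) C0 subr0.
  have := ler_normB (u N x) (u N x - L x); rewrite subKr; lra.
exists (fun x => - L x); split=> // x Dx.
rewrite (uniq (A x) (- C x)) ?opprK// => e e0.
pose k := Mc * (M * `|x| + M * `|A x|).
have [a a0 Ha] := expR_small k b0 e0.
exists (Num.trunc a).+1 => n Nn.
have n0 := ler0n R n; have [Dn An] := gen_sg hG n0 Dx.
rewrite /u (sgV_gen hG n0 Dx) CB// subrK.
apply: (le_trans (HC _ Dn)); rewrite An.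
have := Ha n%:R ltac:(by rewrite ltW// (lt_le_trans (truncnS_gt _))// ler_nat).
apply: le_trans; rewrite /k -mulrA ler_pM2l//.
have := HT x n0; have := HT (A x) n0; lra.
Qed.

End ExponentialDecay.

Lemma shifted_generator (R : realType) (X : completeNormedModType R) (D : set X) (A : X -> X)
  (T : R -> X -> X) (l : R) : generator D A T ->
  generator D (fun x => A x - l *: x) (fun t x => expR (- l * t) *: T t x).
Proof.
move=> hG; have sgT := hG.1.
have cE : cont0 (V := R) (fun t => expR (- l * t)) by exact: is_deriv0_cont (@is_deriv0_expR R (- l)).
pose S := fun (t : R) x => expR (- l * t) *: T t x.
have sgS : C0_semigroup S.
  split.
  - move=> t t0; have [M M0 HM] := bounded_linear_bound (sg_blin sgT t0).
    apply: (@bounded_linear_intro _ _ _ _ (expR (- l * t) * M)) => [a u v|x].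
      by rewrite /S (sg_lin sgT t0); lmod R.
    by rewrite normrZ (gtr0_norm (expR_gt0 _)) -mulrA ler_pM2l ?expR_gt0.
  - by move=> x; rewrite /S mulr0 expR0 scale1r sg0.
  - move=> s t x s0 t0; rewrite /S (linZ (sg_lin sgT s0)) scalerA -expRD (sgD sgT)//.
    by congr (expR _ *: _); ring.
  - by move=> x; apply: cont0Z => //; exact: sg_cont.
(* Used for [T] with [- l] and for [S] with [l], which gives both inclusions between the domains. *)
have key (m : R) (P : R -> X -> X) x y : C0_semigroup P -> glim P x y ->
    glim (fun t x => expR (m * t) *: P t x) x (y + m *: x).
  move=> sgP H e e0.
  have [d1 d10 H1] := H (e / 4) ltac:(lra).
  have nx : 0 < `|x| + 1 by rewrite ltr_wpDl.
  have [d2 d20 H2] := is_deriv0_rderiv (@is_deriv0_expR R m) (lexx 0) (e := e / 4 / (`|x| + 1)) ltac:(by rewrite !divr_gt0).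
  have ny : 0 < `|y| + 1 by rewrite ltr_wpDl.
  have cm : cont0 (V := R) (fun t => expR (m * t)) by exact: is_deriv0_cont (@is_deriv0_expR R m).
  have [d3 d30 H3] := (cont0P _).1 cm 0 (lexx _) (Num.min 1 (e / 4 / (`|y| + 1)))
    ltac:(by rewrite lt_min ltr01 !divr_gt0).
  exists (Num.min d1 (Num.min d2 d3)); first by rewrite !lt_min d10 d20.
  move=> h h0; rewrite !lt_min => /and3P[/(H1 h h0) h1 /(H2 h h0) h2 h3].
  have := H3 h (ltW h0); rewrite subr0 (gtr0_norm h0) => /(_ h3).
  move: h2; rewrite add0r mulr0 expR0 mulr1 le_min => h2 /andP[h4 h5].
  have -> : expR (m * h) *: P h x - x - h *: (y + m *: x) =
    expR (m * h) *: (P h x - x - h *: y) + (expR (m * h) - 1 - h * m) *: x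
    + (h * (expR (m * h) - 1)) *: y by lmod R.
  have k1 : `|expR (m * h) *: (P h x - x - h *: y)| <= 2 * (e / 4 * h).
    rewrite normrZ; apply: ler_pM => //.
    by have := ler_normD (expR (m * h) - 1) 1; rewrite subrK normr1; lra.
  have k2 : `|(expR (m * h) - 1 - h * m) *: x| <= e / 4 * h.
    rewrite normrZ; apply: (@le_trans _ _ (e / 4 / (`|x| + 1) * h * (`|x| + 1))).
      by apply: ler_pM => //; lra.
    by rewrite mulrAC divfK// gt_eqF.
  have k3 : `|(h * (expR (m * h) - 1)) *: y| <= e / 4 * h.
    rewrite normrZ normrM (gtr0_norm h0).
    apply: (@le_trans _ _ (h * (e / 4 / (`|y| + 1)) * (`|y| + 1))).
      by apply: ler_pM => //; [by rewrite mulr_ge0// ltW|rewrite ler_pM2l|lra].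
    by rewrite -mulrA divfK ?gt_eqF// mulrC.
  have := ler_normD (expR (m * h) *: (P h x - x - h *: y) + (expR (m * h) - 1 - h * m) *: x) ((h * (expR (m * h) - 1)) *: y).
  have := ler_normD (expR (m * h) *: (P h x - x - h *: y)) ((expR (m * h) - 1 - h * m) *: x).
  lra.
have fwd x y : glim T x y -> glim S x (y - l *: x).
  by move=> /(key (- l) _ _ _ sgT); rewrite scaleNr.
have bwd x y : glim S x y -> glim T x (y + l *: x).
  move=> /(key l _ _ _ sgS) H e e0; have [d d0 Hd] := H e e0.
  exists d => // h h0 hd; have := Hd h h0 hd.
  by rewrite /S scalerA -expRD mulNr addrN expR0 scale1r.
split=> // x; split.
  split=> [Dx|[y /gen_limP /bwd Hy]].
    by exists (A x - l *: x); apply/(@gen_limP R X S)/fwd; exact: (genP hG Dx).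
  exact: (gen_intro hG Hy).1.
by move=> Dx; apply/(@gen_limP R X S)/fwd; exact: (genP hG Dx).
Qed.

(** * Heads and tails of the system *)

Section HeadTail.
Variables (R : realType) (X : completeNormedModType R).
Variables (D : set X) (A : X -> X) (T : R -> X -> X) (Xs : nat -> set X).
Hypotheses (hG : generator D A T) (hb : schauder_subspace_basis Xs) (ha : adapted Xs T).
Let sgT : C0_semigroup T := hG.1.
Local Notation Q := (head_proj hb).

Lemma head_proj_idem n x : Q n (Q n x) = Q n x.
Proof. by case: (head_proj_comp hb x (leqnn n)). Qed.

Lemma prange_findim (p : X -> X) (bp : bounded_linear p) (pp : forall x, p (p x) = p x) :
  findim_sub [set x | p x = x] -> findim (prange bp pp).
Proof.
move=> [n [e He]]; exists n, (fun i => pproj bp pp (e i)) => w; split=> // _.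
have [c Hc] := (He (pincl w)).1 (pinclK w).
exists c; rewrite -(pproj_incl w) Hc (lin_sum (pproj_lin bp pp)).
by apply: eq_bigr => i _; rewrite (linZ (pproj_lin bp pp)).
Qed.

Lemma head_domain n x : Q n x = x -> D x.
Proof.
move=> Qx; have pT t y : 0 <= t -> Q n (T t y) = T t (Q n y) by exact: (head_proj_sg hb sgT ha).
have rG := restricted_generator (head_proj_blin hb n) (head_proj_idem n) hG pT.
have [+ _] := findim_generator (prange_findim _ _ (head_proj_findim hb n)) rG.
by move=> /(_ (pproj _ _ x)); rewrite /rdom /= pincl_proj Qx.
Qed.

Lemma head_matrix n : exists m (iota : 'rV[R]_m -> X) (rho : X -> 'rV[R]_m) (Ah : 'M[R]_m),
  [/\ bounded_linear iota, bounded_linear rho, forall c, rho (iota c) = c,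
      forall x, iota (rho x) = Q n x &
      (forall c, D (iota c) /\ A (iota c) = iota (c *m Ah)) /\
      (forall x, D x -> rho (A x) = rho x *m Ah)].
Proof.
have [m [f [lf inj Hf]]] := findim_sub_param (head_proj_findim hb n).
have [k k0 Hk] := rV_injective_bound lf inj.
have [c c0 Hc] := head_proj_bound hb.
have /choice[g Hg] : forall x, exists v, Q n x = f v.
  by move=> x; apply/Hf; exact: head_proj_idem.
have finj u v : f u = f v -> u = v.
  by move=> uv; apply/eqP; rewrite -subr_eq0; apply/eqP/inj; rewrite (linB lf) uv subrr.
have Qf v : Q n (f v) = f v by apply/Hf; exists v.
have gf v : g (f v) = v by apply: finj; rewrite -Hg Qf.
have lg : is_linear g by move=> a x y; apply: finj; rewrite lf -!Hg (head_proj_lin hb n).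
have Df v : D (f v) by apply: (@head_domain n); exact: Qf.
have pT t y : 0 <= t -> Q n (T t y) = T t (Q n y) by exact: (head_proj_sg hb sgT ha).
have AQ x : D x -> D (Q n x) /\ A (Q n x) = Q n (A x).
  exact: (gen_proj (head_proj_blin hb n) hG pT).
pose Ah : 'M[R]_m := \matrix_i g (A (f (delta_mx 0 i))).
have Ahf v : A (f v) = f (v *m Ah).
  have QA w : D w -> Q n w = w -> Q n (A w) = A w by move=> Dw Qw; rewrite -(AQ w Dw).2 Qw.
  have lAf : is_linear (fun v => A (f v)).
    by move=> a x y; rewrite lf (gen_lin hG a (Df x) (Df y)).2.
  rewrite {1}[v]row_sum_delta (lin_sum lAf) mulmx_sum_row (lin_sum lf).
  apply: eq_bigr => i _; rewrite (linZ lAf) (linZ lf) rowK -Hg QA//; exact: Qf.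
exists m, f, g, Ah; split=> //.
- exact: rV_linear_bounded.
- apply: (@bounded_linear_intro _ _ _ _ (k * c)) => // x.
  by apply: (le_trans (Hk _)); rewrite -Hg -mulrA ler_pM2l.
- split=> [//|x Dx]; apply: finj; rewrite -Hg -(AQ x Dx).2 Hg; exact: Ahf.
Qed.

Definition tail_proj n x := x - Q n x.

Lemma tail_proj_blin n : bounded_linear (tail_proj n).
Proof.
have [c c0 Hc] := head_proj_bound hb.
apply: (@bounded_linear_intro _ _ _ _ (1 + c)) => [a u v|x].
  by rewrite /tail_proj (head_proj_lin hb n); lmod R.
by apply: (le_trans (ler_normB _ _)); rewrite mulrDl mul1r lerD2l.
Qed.

Lemma tail_proj_idem n x : tail_proj n (tail_proj n x) = tail_proj n x.
Proof. by rewrite /tail_proj (linB (head_proj_lin hb n)) head_proj_idem subrr subr0. Qed.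

Lemma tail_proj_sg n t x : 0 <= t -> tail_proj n (T t x) = T t (tail_proj n x).
Proof.
move=> t0; rewrite /tail_proj (head_proj_sg hb sgT ha)//.
by rewrite (linB (sg_lin sgT t0)).
Qed.

Definition tail n := prange (tail_proj_blin n) (tail_proj_idem n).

Lemma tail_generator n : generator (X := tail n)
  (@rdom _ _ _ (tail_proj_blin n) (tail_proj_idem n) D)
  (@rgen _ _ _ (tail_proj_blin n) (tail_proj_idem n) A)
  (@rsg _ _ _ (tail_proj_blin n) (tail_proj_idem n) T).
Proof. by apply: restricted_generator => // t x; exact: tail_proj_sg. Qed.

(** Strong convergence of the tails to 0 becomes uniform on a finite-dimensional space, since it has
    to be ensured at finitely many basis vectors. *)
Lemma tail_proj_small (V : normedModType R) (f : V -> X) : findim V -> is_linear f ->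
  forall e : R, 0 < e -> exists N, forall n v, (N <= n)%N -> `|tail_proj n (f v)| <= e * `|v|.
Proof.
move=> /findim_sub_param[k [g [lg inj Hg]]] lf e e0.
have [c c0 Hc] := rV_injective_bound lg inj.
pose e' := e / c / (k%:R + 1).
have k1 : 0 < k%:R + 1 :> R by rewrite ltr_wpDl.
have e'0 : 0 < e' by rewrite !divr_gt0.
have /choice[N HN] : forall i : 'I_k, exists N, forall n, (N <= n)%N -> `|tail_proj n (f (g (delta_mx 0 i)))| <= e'.
  by move=> i; exact: head_proj_cvg.
exists (\max_i N i) => n v Nn.
have [x ->] := (Hg v).1 Logic.I.
have lt := (tail_proj_blin n).1.
have lc : is_linear (fun x => tail_proj n (f (g x))) by move=> a u w; rewrite lg lf lt.
rewrite {1}[x]row_sum_delta (lin_sum lc).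
apply: (le_trans (ler_norm_sum _ _ _)).
apply: (@le_trans _ _ (\sum_(i < k) `|x| * e')).
  apply: ler_sum => i _; rewrite (linZ lc) normrZ; apply: ler_pM => //.
    exact: mx_norm_entry.
  by apply: HN; apply: leq_trans Nn; exact: leq_bigmax.
rewrite sumr_const card_ord -mulr_natr.
have : k%:R * e' <= e / c.
  have : (k%:R + 1) * e' = e / c by rewrite /e' mulrC divfK// gt_eqF.
  by rewrite mulrDl mul1r; lra.
move=> h; apply: (@le_trans _ _ (`|x| * (e / c))).
  by rewrite -mulrA ler_wpM2l// mulrC.
have : `|x| * (e / c) <= c * `|g x| * (e / c) by rewrite ler_wpM2r// ltW// divr_gt0.
by move=> /le_trans; apply; rewrite le_eqVlt; apply/orP; left; apply/eqP; field; rewrite gt_eqF.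
Qed.

(** [kappa] may grow arbitrarily fast: [tau] is fixed first, making [M * expR (- b * tau)] at most a
    quarter, and then [e], making [e * kappa tau] at most a quarter. The estimate is assumed for
    finite expansions only, as these are known to lie in the domain. *)
Lemma tail_stable (M b : R) (kappa : R -> R) : 0 < b ->
  (forall e : R, 0 < e -> exists N, forall t x, 0 <= t -> Q N x = 0 ->
     (exists k, Q k x = x) -> `|T t x| <= (M * expR (- b * t) + e * kappa t) * `|x|) ->
  exists n M' b', [/\ 0 < M', 0 < b' & forall t (w : tail n), 0 <= t ->
    `|@rsg _ _ _ (tail_proj_blin n) (tail_proj_idem n) T t w| <= M' * expR (- b' * t) * `|w|].
Proof.
move=> b0 H.
have [a a0 Ha] := expR_small M b0 (e := 4^-1) ltac:(by rewrite invr_gt0).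
pose tau := a + 1; have tau0 : 0 < tau by rewrite ltr_wpDl.
pose e := 4^-1 / (`|kappa tau| + 1).
have kp : 0 < `|kappa tau| + 1 by rewrite ltr_wpDl.
have e0 : 0 < e by rewrite divr_gt0// invr_gt0.
have [n Hn] := H e e0; exists n.
have half x : Q n x = 0 -> (exists k, Q k x = x) -> `|T tau x| <= 2^-1 * `|x|.
  move=> Qx Qk; apply: (le_trans (Hn tau x (ltW tau0) Qx Qk)); rewrite ler_wpM2r//.
  have h1 := Ha tau ltac:(rewrite /tau; lra).
  have : e * kappa tau <= e * (`|kappa tau| + 1).
    by rewrite ler_pM2l//; have := ler_norm (kappa tau); lra.
  by rewrite /e [X in _ <= X]divfK ?gt_eqF//; lra.
have [|M' [b' [M'0 b'0 Hb]]] := @sg_decay R (tail n) _ (tail_generator n).1 tau tau0; last first.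
  by exists M', b'.
move=> w.
rewrite !prange_normE pincl_sg; [|by move=> t x; exact: tail_proj_sg|exact: ltW].
have Qw : Q n (pincl w) = 0.
  by have := pinclK w; rewrite /tail_proj => /eqP; rewrite -subr_eq0 addrAC subrr sub0r oppr_eq0 => /eqP.
apply/ler_addgt0Pr => d d0.
have [K K0 HK] := bounded_linear_bound (sg_blin sgT (ltW tau0)).
have K1 : 0 < K + 1 by lra.
have [N HN] := head_proj_cvg hb (pincl w) (e := d / (K + 1)) ltac:(exact: divr_gt0).
pose k := maxn N n; have h1 := HN k (leq_maxl _ _).
(* Truncation at [k >= n] gives a finite expansion that still has no component in the first [n]
   blocks, so [half] applies. *)
pose y := Q k (pincl w).
have Qy : Q n y = 0 by rewrite /y (head_proj_comp hb (pincl w) (leq_maxr N n)).1.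
have hy := half y Qy (ex_intro _ k (head_proj_idem k _)).
have h2 := HK (pincl w - y).
have h3 : (K + 1) * `|pincl w - y| <= d by move: h1; rewrite ler_pdivlMr// mulrC.
have := ler_normD (T tau (pincl w - y)) (T tau y).
rewrite -(linD (sg_lin sgT (ltW tau0))) subrK.
have := ler_normB (pincl w) (pincl w - y); rewrite subKr.
have := normr_ge0 (pincl w - y).
lra.
Qed.

End HeadTail.

(** * Existence of closed-loop trajectories *)

Section ProductComplete.
Variables (R : realType) (X W : completeNormedModType R).

HB.instance Definition _ := Pointed.on (X * W)%type.
HB.instance Definition _ := PointedUniform.on (X * W)%type.

Lemma prod_complete (F : set_system (X * W)) : ProperFilter F -> cauchy F -> cvg F.
Proof.
move=> FF Fc.
have c1 : cauchy (fst @ F).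
  apply/cauchy_ballP => e e0; have /cauchy_ballP /(_ e e0) := Fc.
  move=> [[A B] /= [FA FB] H]; exists (fst @` A, fst @` B) => /=.
    by split; [apply: filterS FA => x Ax|apply: filterS FB => x Bx]; exists x.
  move=> [_ _] /= [[a Aa <-] [b Bb <-]].
  by have [] := H (a, b) (conj Aa Bb).
have c2 : cauchy (snd @ F).
  apply/cauchy_ballP => e e0; have /cauchy_ballP /(_ e e0) := Fc.
  move=> [[A B] /= [FA FB] H]; exists (snd @` A, snd @` B) => /=.
    by split; [apply: filterS FA => x Ax|apply: filterS FB => x Bx]; exists x.
  move=> [_ _] /= [[a Aa <-] [b Bb <-]].
  by have [] := H (a, b) (conj Aa Bb).
have /cvg_ex[l1 H1] : cvg (fst @ F) by apply/cauchy_cvgP.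
have /cvg_ex[l2 H2] : cvg (snd @ F) by apply/cauchy_cvgP.
apply/cvg_ex; exists (l1, l2).
have := cvg_pair H1 H2.
rewrite (_ : (fun x : X * W => (x.1, x.2)) = id); last by apply: funext => -[].
by apply; exact: _.
Qed.

HB.instance Definition _ := Uniform_isComplete.Build (X * W)%type prod_complete.
End ProductComplete.

Section BoundedLinearOps.
Variable R : realType.
Implicit Types U V W : normedModType R.

Lemma blin_comp U V W (f : V -> W) (g : U -> V) : bounded_linear f -> bounded_linear g ->
  bounded_linear (f \o g).
Proof.
move=> [lf cf] [lg cg]; split; first by move=> a u v /=; rewrite lg lf.
by move=> x; apply: continuous_comp; [exact: cg|exact: cf].
Qed.

Lemma blinD V W (f g : V -> W) : bounded_linear f -> bounded_linear g ->
  bounded_linear (fun x => f x + g x).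
Proof.
move=> [lf cf] [lg cg]; split; first by move=> a u v /=; rewrite lg lf; lmod R.
by move=> x; apply: cvgD; [exact: cf|exact: cg].
Qed.

Lemma blinZ V W (f : V -> W) (k : R) : bounded_linear f ->
  bounded_linear (fun x => k *: f x).
Proof.
move=> [lf cf]; split; first by move=> a u v /=; rewrite lf; lmod R.
by move=> x; apply: cvgZr; exact: cf.
Qed.

Lemma blinN V W (f : V -> W) : bounded_linear f -> bounded_linear (fun x => - f x).
Proof.
move=> bf; rewrite (_ : (fun x => _) = fun x => (-1) *: f x); first exact: blinZ.
by apply/funext => x; rewrite scaleN1r.
Qed.

Lemma blin_fst V W : bounded_linear (@fst V W).
Proof. by split=> // x; exact: cvg_fst. Qed.

Lemma blin_snd V W : bounded_linear (@snd V W).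
Proof. by split=> // x; exact: cvg_snd. Qed.

Lemma blin_pair U V W (f : U -> V) (g : U -> W) : bounded_linear f -> bounded_linear g ->
  bounded_linear (fun x => (f x, g x)).
Proof.
move=> [lf cf] [lg cg]; split; first by move=> a u v /=; rewrite lg lf.
by move=> x; apply: cvg_pair; [exact: cf|exact: cg].
Qed.

Lemma cont0_pair V W (f : R -> V) (g : R -> W) : cont0 f -> cont0 g ->
  cont0 (fun t => (f t, g t)).
Proof.
move=> /subspace_continuousP cf /subspace_continuousP cg.
by apply/subspace_continuousP => t tI; apply: cvg_pair; [exact: cf|exact: cg].
Qed.

Lemma blin_id V : bounded_linear (@idfun V).
Proof. by split=> // x; exact: cvg_id. Qed.

Lemma cont0_output (X Y : normedModType R) (D : set X) (A : X -> X) (C : X -> Y) (x : R -> X) :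
  graph_bounded D A C -> (forall a b, D a -> D b -> D (a - b) /\ A (a - b) = A a - A b) ->
  (forall t, 0 <= t -> D (x t)) -> cont0 x -> cont0 (fun t => A (x t)) ->
  cont0 (fun t => C (x t)).
Proof.
move=> [lC [M HM]] DB Dx /cont0P cx /cont0P cAx; apply/cont0P => t t0 e e0.
have M1 : 0 < `|M| + 1 by rewrite ltr_wpDl.
have [d1 d10 H1] := cx t t0 (e / 2 / (`|M| + 1)) ltac:(by rewrite !divr_gt0).
have [d2 d20 H2] := cAx t t0 (e / 2 / (`|M| + 1)) ltac:(by rewrite !divr_gt0).
exists (Num.min d1 d2); first by rewrite lt_min d10.
move=> s s0; rewrite lt_min => /andP[/(H1 s s0) h1 /(H2 s s0) h2].
have [D1 A1] := DB _ _ (Dx s s0) (Dx t t0).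
have -> : C (x s) - C (x t) = C (x s - x t).
  have := lC (-1) (x t) (x s) (Dx t t0) (Dx s s0); rewrite !scaleN1r => h.
  by rewrite addrC -h addrC.
apply: (le_trans (HM _ D1)); rewrite A1.
apply: (@le_trans _ _ ((`|M| + 1) * (e / 2 / (`|M| + 1) + e / 2 / (`|M| + 1)))).
  apply: (@le_trans _ _ ((`|M| + 1) * (`|x s - x t| + `|A (x s) - A (x t)|))).
    by rewrite ler_wpM2r ?addr_ge0//; have := ler_norm M; lra.
  by rewrite ler_pM2l// lerD.
by rewrite mulrC mulrDl divfK ?gt_eqF//; lra.
Qed.

End BoundedLinearOps.

Section ClosedLoop.
Variables (R : realType) (X W Y : completeNormedModType R).
Variables (D : set X) (A : X -> X) (T : R -> X -> X) (C : X -> Y).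
Variables (b : W -> X) (E : W -> W) (F : Y -> W).
Hypotheses (hG : generator D A T) (hC : graph_bounded D A C).
Hypotheses (bb : bounded_linear b) (bE : bounded_linear E) (bF : bounded_linear F).
Let sgT : C0_semigroup T := hG.1.

(** With [l] one above the growth exponent [w] the shifted semigroup decays at rate 1, so
    [output_factor] applies to [A - l], whose graph norm is equivalent to that of [A]. *)
Lemma output_factor_shift : exists (l : R) (Ct : X -> Y), bounded_linear Ct /\
  forall x, D x -> C x = Ct (A x - l *: x).
Proof.
have [M [w [M1 w0 HT]]] := sg_growth sgT.
have M0 : 0 < M by exact: lt_le_trans M1.
pose l := w + 1; exists l.
have sG := shifted_generator l hG.
apply: (@output_factor R X D _ _ sG M 1 M0 ltr01).
  move=> t x t0; rewrite normrZ (gtr0_norm (expR_gt0 _)).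
  have -> : M * expR (- 1 * t) * `|x| = expR (- l * t) * (M * expR (w * t) * `|x|).
    rewrite (_ : - 1 * t = - l * t + w * t); first by rewrite expRD; ring.
    by rewrite /l; ring.
  by rewrite ler_pM2l ?expR_gt0// HT.
case: hC => lC [k Hk]; split=> //; exists (`|k| * (1 + l)) => x Dx.
have l1 : 1 <= 1 + l by rewrite /l; lra.
apply: (le_trans (Hk x Dx)).
apply: (@le_trans _ _ (`|k| * (`|x| + `|A x|))).
  by rewrite ler_wpM2r ?addr_ge0// ler_norm.
rewrite -mulrA ler_wpM2l//.
have := ler_normD (A x - l *: x) (l *: x); rewrite subrK normrZ (ger0_norm (_ : 0 <= l)); last lra.
have : `|A x - l *: x| * 1 <= `|A x - l *: x| * (1 + l) by rewrite ler_wpM2l.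
lra.
Qed.

Lemma product_generator : generator (X := (X * W)%type) [set z | D z.1]
  (fun z => (A z.1, 0)) (fun t z => (T t z.1, z.2)).
Proof.
pose S := fun (t : R) (z : X * W) => (T t z.1, z.2).
have nE (u : X) (v : W) : `|(u, v)| = Num.max `|u| `|v| by [].
have limE z l m : glim S z (l, m) <-> glim T z.1 l /\ m = 0.
  have SE h : S h z - z - h *: (l, m) = (T h z.1 - z.1 - h *: l, - (h *: m)).
    by case: z => z1 z2 /=; congr (_, _) => /=; lmod R.
  split=> [H|[H ->] e e0].
    split=> [e e0|].
      have [d d0 Hd] := H e e0; exists d => // h h0 hd.
      by have := Hd h h0 hd; rewrite SE nE ge_max => /andP[].
    apply/eqP; rewrite -normr_le0; apply/ler_addgt0Pr => e e0; rewrite add0r.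
    have [d d0 Hd] := H e e0; have := Hd (d / 2) ltac:(lra) ltac:(lra).
    rewrite SE nE ge_max => /andP[_]; rewrite normrN normrZ gtr0_norm; last lra.
    by rewrite mulrC ler_pM2r//; lra.
  have [d d0 Hd] := H e e0; exists d => // h h0 hd.
  have -> : S h z - z - h *: (l, 0) = (T h z.1 - z.1 - h *: l, 0).
    by case: z {H Hd SE} => z1 z2 /=; congr (_, _) => /=; lmod R.
  by rewrite nE ge_max Hd//= normr0 mulr_ge0// ltW.
split.
  split.
  - move=> t t0; apply: blin_pair; last exact: blin_snd.
    by apply: (@blin_comp _ _ _ _ (T t) fst); [exact: sg_blin|exact: blin_fst].
  - by move=> [z1 z2]; rewrite sg0.
  - by move=> s t [z1 z2] s0 t0 /=; rewrite (sgD sgT).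
  - move=> [z1 z2] /=; apply: cont0_pair; [exact: sg_cont|exact: cont0_cst].
move=> z; split.
  split=> [Dz|[[l m] /(@gen_limP R _ S) /limE [Hl _]]].
    by exists (A z.1, 0); apply/(@gen_limP R _ S)/limE; split=> //; exact: (genP hG Dz).
  exact: (gen_intro hG Hl).1.
by move=> Dz; apply/(@gen_limP R _ S)/limE; split=> //; exact: (genP hG Dz).
Qed.

(* In the coordinates [(x, w - F Ct x)], where [C = Ct (A - l)], the closed loop
   is a bounded perturbation of the generator [A (+) 0]. *)
Lemma closed_loop_exists (x0 : X) : D x0 -> exists (x x' : R -> X) (w w' : R -> W),
  [/\ x 0 = x0, w 0 = 0,
      [/\ cont0 x', is_deriv0 x x', forall t, 0 <= t -> D (x t) &
          forall t, 0 <= t -> x' t = A (x t) + b (w t)]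
      & [/\ cont0 w', is_deriv0 w w' & forall t, 0 <= t -> w' t = E (w t) + F (C (x t))]].
Proof.
move=> Dx0; have [l [Ct [bCt CtE]]] := output_factor_shift.
pose H := F \o Ct.
have bH : bounded_linear H by exact: blin_comp.
pose wf (z : X * W) := z.2 + H z.1.
have bw : bounded_linear wf.
  apply: blinD; first exact: blin_snd.
  exact: (blin_comp bH (blin_fst X W)).
(* For [v = w - H x] the derivative is [E w + F (C x) - H (A x + b w)], and [F (C x)] is
   [H (A x) - l *: H x], so the unbounded term [H (A x)] cancels. The map [wf] recovers [w]. *)
pose K (z : X * W) : X * W := (b (wf z), E (wf z) + (- (l *: H z.1) + - H (b (wf z)))).
have bK : bounded_linear K.
  apply: blin_pair; first exact: (blin_comp bb bw).
  apply: blinD; first exact: (blin_comp bE bw).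
  apply: blinD.
    by apply/blinN/blinZ; exact: (blin_comp bH (blin_fst X W)).
  apply: blinN; exact: (blin_comp bH (blin_comp bb bw)).
(* The second component [- H x0] makes the controller state zero at time 0. *)
have [z [z' [z0 cz' dz Dz Hz']]] := perturbed_solution product_generator bK (z0 := (x0, - H x0)) Dx0.
have d1 := is_deriv0_lin (blin_fst X W) dz.
have dw := is_deriv0_lin bw dz.
exists (fun t => (z t).1), (fun t => (z' t).1), (wf \o z), (wf \o z'); split.
- by rewrite z0.
- by rewrite /= /wf z0 /= addNr.
- split=> //.
  + exact: (cont0_comp cz' (blin_fst X W).2).
  + by move=> t t0; rewrite Hz'.
- split=> //; first exact: (cont0_comp cz' bw.2).
  move=> t t0 /=; rewrite {1}/wf Hz'//= CtE; last exact: Dz.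
  have -> : F (Ct (A (z t).1 - l *: (z t).1)) = H (A (z t).1) - l *: H (z t).1.
    by rewrite -[LHS]/(H _) (linB bH.1) (linZ bH.1).
  by rewrite (linD bH.1); lmod R.
Qed.

End ClosedLoop.

Section SystemFacts.
Variables (R : realType) (U X Y : completeNormedModType R).
Variables (D : set X) (A : X -> X) (T : R -> X -> X) (B : U -> X) (C : X -> Y).
Hypotheses (hG : generator D A T) (hC : graph_bounded D A C).
Let sgT : C0_semigroup T := hG.1.

Lemma cvg_norm_vanishes (V : normedModType R) (x : R -> V) :
  ((fun t => `|x t|) @ +oo --> (0 : R)) <-> vanishes x.
Proof.
split=> [/cvgrPdist_le H e e0|H].
  have [a [_ Ha]] := H e e0; exists (Num.max 0 (a + 1)); first by rewrite le_max lexx.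
  move=> t; rewrite ge_max => /andP[_ at_]; have := Ha t ltac:(lra).
  by rewrite sub0r normrN normr_id.
apply/cvgrPdist_le => e e0; have [a a0 Ha] := H e e0.
exists a; split; first exact: num_real.
by move=> t at_; rewrite sub0r normrN normr_id; apply: Ha; exact: ltW.
Qed.

Lemma output_cont (x : R -> X) : (forall t, 0 <= t -> D (x t)) -> cont0 x ->
  cont0 (fun t => A (x t)) -> cont0 (fun t => C (x t)).
Proof. by apply: (cont0_output hC) => a b; exact: (genB hG). Qed.

Lemma graph_boundedB a b : D a -> D b -> C (a - b) = C a - C b.
Proof.
by move=> Da Db; have := hC.1 (-1) b a Db Da; rewrite !scaleN1r addrC => ->; rewrite addrC.
Qed.

Lemma graph_boundedD a b : D a -> D b -> C (a + b) = C a + C b.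
Proof. by move=> Da Db; have := hC.1 1 a b Da Db; rewrite !scale1r. Qed.

Hypothesis hB : bounded_linear B.

Lemma sys_free_orbit x0 : D x0 ->
  Sys D A B C (fun _ => 0, fun t => T t x0, fun t => C (T t x0)).
Proof.
move=> Dx0; have Dt t : 0 <= t -> D (T t x0) by move=> t0; exact: (gen_sg hG t0 Dx0).1.
have cA : cont0 (fun t => A (T t x0)).
  apply: cont0_ext (sg_cont sgT (A x0)) => t t0.
  by rewrite (gen_sg hG t0 Dx0).2.
split=> //.
- exact: cont0_cst.
- by split=> //; split=> //; exact: sg_cont.
- exists (fun t => T t (A x0)); split; first exact: sg_cont.
  split; first exact: (orbit_deriv hG Dx0).
  by move=> t t0; rewrite (gen_sg hG t0 Dx0).2 (lin0 hB.1) addr0.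
- by apply: output_cont => //; exact: sg_cont.
Qed.

Lemma sys_free x y t : Sys D A B C (fun _ => 0, x, y) -> 0 <= t -> x t = T t (x 0).
Proof.
move=> [_ [Dx [cx _]] [x' [cx' [dx Hx']]] _ _] t0.
apply/eqP; rewrite -subr_eq0 -normr_le0.
have := @duhamel R X D A T hG x (fun _ => 0) t cx t0 Dx _ (fun _ => 0) (fun _ => 0).
rewrite subr0; apply.
- by move=> s s0; rewrite addr0; have := is_deriv0_rderiv dx s0; rewrite Hx'// (lin0 hB.1) addr0.
- exact: (@is_deriv0_cst R R^o).
- move=> s s0 st; rewrite lin0 ?normr0//; apply: (sg_lin sgT); lra.
Qed.

End SystemFacts.

(** * Splitting off the finite unstable part *)

Section Decomposition.
Variables (R : realType) (U X Y : completeNormedModType R).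
Variables (D : set X) (A : X -> X) (T : R -> X -> X) (B : U -> X) (C : X -> Y).
Hypotheses (hG : generator D A T) (hB : bounded_linear B) (hC : graph_bounded D A C).
Variables (Xs : nat -> set X) (hb : schauder_subspace_basis Xs) (ha : adapted Xs T).
Let sgT : C0_semigroup T := hG.1.

Local Notation tp n := (tail_proj_blin hb n).
Local Notation ti n := (@tail_proj_idem R X Xs hb n).
Local Notation tincl n := (@pincl R X _ (tp n) (ti n)).
Local Notation tdom n := (@rdom R X _ (tp n) (ti n) D).
Local Notation tgen n := (@rgen R X _ (tp n) (ti n) A).
Local Notation tsg n := (@rsg R X _ (tp n) (ti n) T).

Lemma tail_sys_data n : sys_data (X := tail hb n) (tdom n)
  (tgen n) (pproj (tp n) (ti n) \o B) (fun w : tail hb n => C (tincl n w)).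
Proof.
have tpT t x : 0 <= t -> tail_proj hb n (T t x) = T t (tail_proj hb n x).
  exact: (tail_proj_sg hG hb ha).
split.
- by exists (tsg n); exact: (tail_generator hG hb ha).
- exact: (blin_comp (pproj_blin _ _) hB).
- case: hC => lC [M HM]; split.
    by move=> a u v Du Dv; rewrite (pincl_lin (bp := tp n)) lC.
  by exists M => w Dw; rewrite !prange_normE (pincl_gen hG tpT Dw); exact: HM.
Qed.

(** Head and tail projections commute with [A], so [x |-> (rho x, pj x)] splits the equation into
    two. The head output is continuous because [C] is bounded on the head, and the tail output is
    the difference. *)
Lemma finite_unstable_part_of_tail n (M b : R) : 0 < b ->
  (forall t (w : tail hb n), 0 <= t ->
    `|tsg n t w| <= M * expR (- b * t) * `|w|) ->
  finite_unstable_part (Sys D A B C).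
Proof.
move=> b0 Hw.
have [m [iota [rho [Ah [bi br rK iQ [Ai Ar]]]]]] := head_matrix hG hb ha n.
have tpT t x : 0 <= t -> tail_proj hb n (T t x) = T t (tail_proj hb n x).
  exact: (tail_proj_sg hG hb ha).
have lpi := pincl_lin (bp := tp n) (pp := ti n).
pose pj : X -> tail hb n := pproj (tp n) (ti n).
have bpj : bounded_linear pj by exact: pproj_blin.
have Ptp x : D x -> D (tail_proj hb n x) /\ A (tail_proj hb n x) = tail_proj hb n (A x).
  exact: (gen_proj (tp n) hG tpT).
have split_x x : x = iota (rho x) + tincl n (pj x) by rewrite iQ /tail_proj addrC subrK.
have rpi (w : tail hb n) : rho (tincl n w) = 0.
  have pw := pinclK w; have : rho (tail_proj hb n (tincl n w)) = rho (tincl n w) by rewrite pw.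
  by rewrite /tail_proj (linB br.1) -iQ rK subrr.
have ii c : pj (iota c) = 0.
  apply: pincl_inj; rewrite (lin0 lpi) pincl_proj /tail_proj.
  by have := iQ (iota c); rewrite rK => <-; rewrite subrr.
pose Cu c := C (iota c).
have lCu : is_linear Cu.
  by move=> a u v; rewrite /Cu bi.1 hC.1//; [exact: (Ai u).1|exact: (Ai v).1].
have bCu := rV_linear_bounded lCu.
have sdata := tail_sys_data n.
have [_ bBs hCs] := sdata.
have gS := tail_generator hG hb ha n.
exists 'rV[R]_m, (tail hb n), setT, (fun c => c *m Ah), (rho \o B), Cu,
  (tdom n), (tgen n), (pj \o B), (fun w => C (tincl n w)).
split=> //.
- exists m, (fun i => delta_mx 0 i) => x; split=> // _.
  by exists (x 0); exact: row_sum_delta.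
- split.
  + exists (fun t x => x *m expm Ah t); exact: expm_generator.
  + exact: (blin_comp br hB).
  + split; first by move=> a u v _ _; exact: lCu.
    have [k k0 Hk] := bounded_linear_bound bCu; exists k => x _.
    by apply: (le_trans (Hk x)); rewrite ler_pM2l// lerDl.
- exists b; split=> //; exists M => x y Sx t t0.
  by rewrite (sys_free gS bBs Sx t0); exact: Hw.
exists (fun x => (rho x, pj x)); split.
  split; first exact: blin_pair.
  exists (fun cw => iota cw.1 + pincl cw.2); split.
    apply: (blinD (blin_comp bi (blin_fst _ _)) (blin_comp (pincl_blin (tp n) (ti n)) (blin_snd _ _))).2.
  split; first by move=> x; rewrite /= -split_x.
  move=> [c w] /=; congr (_, _).
    by rewrite (linD br.1) rK rpi addr0.
  by rewrite (linD bpj.1) ii add0r; exact: pproj_incl.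
move=> u x y; split.
- move=> [cu [Dx [cx cAx]] [x' [cx' [dx Hx']]] cy Hy].
  have crx : cont0 (rho \o x) by exact: (cont0_comp cx br.2).
  pose y1 t := C (iota (rho (x t))).
  have cy1 : cont0 y1 by exact: (cont0_comp crx bCu.2).
  exists y1, (fun t => y t - y1 t); split; last split.
  + split=> //.
    * split=> //; split=> //.
      exact: (cont0_comp crx (mulmxr_blin 1 Ah).2).
    * exists (rho \o x'); split; first exact: (cont0_comp cx' br.2).
      split; first exact: (is_deriv0_lin br dx).
      by move=> t t0 /=; rewrite Hx'// (linD br.1) (Ar _ (Dx t t0)).
  + have cpx : cont0 (pj \o x) by exact: (cont0_comp cx bpj.2).
    split=> //.
    * split; first by move=> t t0; rewrite /rdom /=; exact: (Ptp _ (Dx t t0)).1.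
      split=> //; apply: (cont0_ext _ (cont0_comp cAx bpj.2)) => t t0 /=.
      apply: pincl_inj; rewrite !pincl_proj (Ptp _ (Dx t t0)).2.
      by rewrite (ti n).
    * exists (pj \o x'); split; first exact: (cont0_comp cx' bpj.2).
      split; first exact: (is_deriv0_lin bpj dx).
      move=> t t0 /=; rewrite Hx'// (linD bpj.1); congr (_ + _).
      apply: pincl_inj; rewrite !pincl_proj (Ptp _ (Dx t t0)).2.
      by rewrite (ti n).
    * exact: cont0B.
    * move=> t t0; rewrite Hy// /y1 -(graph_boundedB hC); [|exact: Dx|exact: (Ai _).1].
      by rewrite {1}(split_x (x t)) addrC addKr.
  + by apply/funext => t; rewrite addrC subrK.
- move=> [y1 [y2 [[cu [_ [cxu _]] [xu' [cxu' [dxu Hxu']]] cy1 Hy1]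
    [[_ [Dxs [cxs cAxs]] [xs' [cxs' [dxs Hxs']]] cy2 Hy2] ->]]]].
  have bpi := pincl_blin (tp n) (ti n).
  have xE t : iota (rho (x t)) + tincl n (pj (x t)) = x t by rewrite -split_x.
  (* Membership in the domain is recovered from the tail component, because every head vector lies
     in the domain. *)
  have AE t : 0 <= t -> D (x t) /\ A (x t) = iota (rho (x t) *m Ah) + tincl n (tgen n (pj (x t))).
    move=> t0; have [D1 A1] := Ai (rho (x t)); have D2 := Dxs t t0.
    have [D3 A3] := genD hG D1 D2; rewrite xE in D3 A3; split=> //.
    by rewrite A3 A1 (pincl_gen hG tpT D2).
  have cx : cont0 x.
    apply: (@cont0_ext _ _ (fun t => iota (rho (x t)) + tincl n (pj (x t)))).
      by move=> t _; exact: xE.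
    exact: (cont0D (cont0_comp cxu bi.2) (cont0_comp cxs bpi.2)).
  split=> //.
  + split; first by move=> t t0; exact: (AE t t0).1.
    split=> //; apply: (@cont0_ext _ _ (fun t => iota (rho (x t) *m Ah) + tincl n (tgen n (pj (x t))))).
      by move=> t t0; rewrite (AE t t0).2.
    apply: cont0D; last exact: (cont0_comp cAxs bpi.2).
    exact: (cont0_comp (cont0_comp cxu (mulmxr_blin 1 Ah).2) bi.2).
  + exists (fun t => iota (xu' t) + tincl n (xs' t)); split.
      exact: (cont0D (cont0_comp cxu' bi.2) (cont0_comp cxs' bpi.2)).
    split.
      apply: (@is_deriv0_ext _ _ _ _ _ _ _ _ (is_deriv0D (is_deriv0_lin bi dxu) (is_deriv0_lin bpi dxs))) => //.
    move=> t t0; rewrite Hxu'// Hxs'// (AE t t0).2 (linD bi.1) (linD lpi).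
    by rewrite /= addrACA; congr (_ + _); rewrite -split_x.
  + exact: cont0D.
  + move=> t t0; rewrite Hy1// Hy2// /Cu -(graph_boundedD hC).
    * by rewrite /= xE.
    * exact: (Ai _).1.
    * exact: Dxs.
Qed.

End Decomposition.

(** * Necessity *)

Section Necessity.
Variables (R : realType) (U X Y W : completeNormedModType R).
Variables (D : set X) (A : X -> X) (T : R -> X -> X) (B : U -> X) (C : X -> Y).
Hypotheses (hG : generator D A T) (hB : bounded_linear B) (hC : graph_bounded D A C).
Variables (Xs : nat -> set X) (hb : schauder_subspace_basis Xs) (ha : adapted Xs T).
Variables (DE : set W) (E : W -> W) (F : Y -> W) (G : W -> U).
Hypotheses (fW : findim W) (hE : sys_data DE E F G).
Hypothesis hst : exp_stable (Close (comp_rel (Sys D A B C) (Sys DE E F G))).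
Let sgT : C0_semigroup T := hG.1.

Let nE (u : X) (v : W) : `|(u, v)| = Num.max `|u| `|v|. Proof. by []. Qed.

Lemma controller_bounded : [/\ forall w, DE w, bounded_linear E, bounded_linear F & bounded_linear G].
Proof.
case: hE => [[TE gE] bF [lG _]]; have [DEall bE] := findim_generator fW gE.
by split=> //; apply: findim_linear_bounded => // a u v; exact: lG.
Qed.

(** Exponential stability speaks only of trajectories that exist. Here one is provided from every
    [(x0, 0)] with [x0] in the domain, and the norm of the pair bounds plant and controller states
    separately. *)
Lemma closed_loop_decay : exists M b : R, [/\ 0 < M, 0 < b &
  forall x0, D x0 -> exists (x x' : R -> X) (w : R -> W),
  [/\ x 0 = x0,
      [/\ cont0 x', is_deriv0 x x', forall t, 0 <= t -> D (x t) &
          forall t, 0 <= t -> x' t = A (x t) + B (G (w t))],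
      cont0 w,
      Sys D A B C (G \o w, x, fun t => C (x t)) &
      forall t, 0 <= t -> `|x t| <= M * expR (- b * t) * `|x0| /\
        `|w t| <= M * expR (- b * t) * `|x0| ]].
Proof.
have [DEall bE bF bG] := controller_bounded.
have [b [b0 [M HM]]] := hst.
exists (`|M| + 1), b; split=> //.
move=> x0 Dx0.
have [x [x' [w [w' [x00 w0 [cx' dx Dx Hx'] [cw' dw Hw']]]]]] :=
  closed_loop_exists hG hC (blin_comp hB bG) bE bF Dx0.
have cx := is_deriv0_cont dx; have cw := is_deriv0_cont dw.
have cGw : cont0 (G \o w) by exact: (cont0_comp cw bG.2).
have cAx : cont0 (fun t => A (x t)).
  apply: (@cont0_ext _ _ (fun t => x' t - B (G (w t)))).
    by move=> t t0; rewrite Hx'//= addrK.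
  by apply: cont0B => //; exact: (cont0_comp cGw hB.2).
have S1 : Sys D A B C (G \o w, x, fun t => C (x t)).
  split=> //; first by exists x'.
  exact: (output_cont hG hC Dx cx cAx).
exists x, x', w; split=> // t t0.
have : `|(x t, w t)| <= M * expR (- b * t) * `|(x 0, w 0)|.
  apply: (HM (fun t => (x t, w t)) (fun _ => 0) _ t t0); split=> //; split=> //.
  exists (G \o w), (fun t => C (x t)); split=> //.
  case: S1 => _ _ _ cy _; split=> //.
  - by split=> //; split=> //; exact: (cont0_comp cw bE.2).
  - by exists w'.
rewrite x00 w0 => h.
have : `|(x t, w t)| <= (`|M| + 1) * expR (- b * t) * `|x0|.
  apply: (le_trans h); rewrite [X in _ * X](_ : _ = `|x0|); last first.
    by rewrite nE normr0 max_l.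
  rewrite ler_wpM2r// ler_wpM2r ?expR_ge0//; have := ler_norm M; lra.
by rewrite nE ge_max => /andP[].
Qed.

Lemma stabilizable_of_closed_loop : stabilizable (Sys D A B C).
Proof.
have [M [b [M0 b0 H]]] := closed_loop_decay.
move=> O [z Oz] oO.
have /nbhs_ballP[r /= r0 Hr] : nbhs z O by apply: open_nbhs_nbhs.
have [N HN] := head_proj_cvg hb z (e := r / 2) ltac:(lra).
pose x0 := head_proj hb N z.
have Dx0 : D x0 by exact: (head_domain hG ha (head_proj_idem hb N z)).
exists x0; split.
  by apply: Hr; rewrite -ball_normE /=; have := HN N (leqnn _); rewrite -/x0; lra.
have [x [x' [w [x00 _ _ S1 dec]]]] := H x0 Dx0.
exists (G \o w), x, (fun t => C (x t)); split=> //; split=> //.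
apply/cvg_norm_vanishes => e e0.
have [a a0 Ha] := expR_small (M * `|x0|) b0 e0.
exists a => // t at_; apply: (le_trans (dec t ltac:(lra)).1).
by rewrite mulrAC; exact: Ha.
Qed.

Lemma detectable_of_closed_loop : detectable (Sys D A B C).
Proof.
move=> x Sx; have [DEall bE bF bG] := controller_bounded.
have [b [b0 [M HM]]] := hst.
apply/cvg_norm_vanishes => e e0.
have [a a0 Ha] := expR_small (M * `|(x 0, 0 : W)|) b0 e0.
exists a => // t at_; have t0 : 0 <= t by lra.
apply: (@le_trans _ _ `|(x t, 0 : W)|).
  by rewrite nE le_max lexx.
apply: le_trans (Ha t at_).
rewrite mulrAC; apply: (HM (fun t => (x t, 0)) (fun _ => 0) _ t t0); split=> //; split=> //.
exists (fun _ => 0), (fun _ => 0); split=> //; split=> //.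
- exact: cont0_cst.
- split=> //; split; first exact: cont0_cst.
  by rewrite /=; exact: cont0_cst.
- exists (fun _ => 0); split; first exact: cont0_cst.
  split; first exact: is_deriv0_cst.
  by move=> s s0; rewrite (lin0 bE.1) (lin0 bF.1) addr0.
- exact: cont0_cst.
- by move=> s s0; rewrite (lin0 bG.1).
Qed.

Lemma finite_unstable_part_of_closed_loop : finite_unstable_part (Sys D A B C).
Proof.
have [DEall bE bF bG] := controller_bounded.
have [M [b [M0 b0 H]]] := closed_loop_decay.
have [c c0 Hc] := head_proj_bound hb.
have [M1 [w1 [M11 w10 HT]]] := sg_growth sgT.
have M1p : 0 < M1 by exact: lt_le_trans M11.
have tpT n t x : 0 <= t -> tail_proj hb n (T t x) = T t (tail_proj hb n x).
  exact: (tail_proj_sg hG hb ha).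
(* [(1 + c) * M] bounds the tail of the closed-loop state. The last function is the Duhamel bound:
   growth of the semigroup on [[0, t]], times the bound [M] on the controller state, times the
   length [t]. *)
have [|n [M' [b' [M'0 b'0 Hw]]]] := @tail_stable R X D A T Xs hG hb ha ((1 + c) * M) b
    (fun t => M1 * expR (w1 * t) * M * t) b0; last first.
  exact: (finite_unstable_part_of_tail hG hB hC ha b'0 Hw).
move=> e e0.
have bBG := blin_comp hB bG.
have [N HN] := tail_proj_small hb fW bBG.1 e0.
exists N => t x0 t0 Qx0 [k Qk].
have Dx0 : D x0 by exact: (head_domain hG ha Qk).
have [x [x' [w [x00 [cx' dx Dx Hx'] cw _ dec]]]] := H x0 Dx0.
have bt := tail_proj_blin hb N.
have Ptp y : D y -> D (tail_proj hb N y) /\ A (tail_proj hb N y) = tail_proj hb N (A y).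
  exact: (gen_proj bt hG (tpT N)).
pose z := tail_proj hb N \o x.
have dz := is_deriv0_lin bt dx.
pose k0 := M1 * expR (w1 * t) * (e * (M * `|x0|)).
have := @duhamel R X D A T hG z (fun s => tail_proj hb N (B (G (w s)))) t (is_deriv0_cont dz) t0 _ _
  (fun s => k0 * s) (fun s => k0 * 1) (@is_deriv0Z R R^o k0 _ _ (@is_deriv0_id R)).
move=> /(_ _ _ _) h.
have {}h : `|z t - T t (z 0)| <= k0 * t - k0 * 0.
  apply: h => s s0.
  - exact: (Ptp _ (Dx s s0)).1.
  - have := is_deriv0_rderiv dz s0; rewrite /= Hx'// (linD bt.1) -(Ptp _ (Dx s s0)).2.
    by [].
  - move=> st; rewrite mulr1; apply: (le_trans (HT _ _ _)); first lra.
    apply: ler_pM => //; first by rewrite mulr_ge0 ?expR_ge0// ltW.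
      by rewrite ler_pM2l// ler_expR ler_wpM2l//; lra.
    apply: (le_trans (HN N (w s) (leqnn _))); rewrite ler_pM2l//.
    apply: (le_trans (dec s s0).2); rewrite ler_wpM2r// -[leRHS]mulr1 ler_pM2l//.
    by rewrite -expR0 ler_expR mulNr oppr_le0 mulr_ge0// ltW.
have z0 : z 0 = x0 by rewrite /z /= x00 /tail_proj Qx0 subr0.
move: h; rewrite z0 mulr0 subr0 => h.
have h2 : `|z t| <= (1 + c) * M * expR (- b * t) * `|x0|.
  apply: (@le_trans _ _ ((1 + c) * `|x t|)).
    rewrite /z /= /tail_proj mulrDl mul1r; apply: (le_trans (ler_normB _ _)).
    by rewrite lerD2l.
  by rewrite -!mulrA ler_pM2l ?addr_gt0// mulrA; exact: (dec t t0).1.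
have := ler_normB (z t) (z t - T t x0); rewrite subKr => h3.
have -> : ((1 + c) * M * expR (- b * t) + e * (M1 * expR (w1 * t) * M * t)) * `|x0| =
  (1 + c) * M * expR (- b * t) * `|x0| + k0 * t by rewrite /k0; ring.
lra.
Qed.

End Necessity.

(** * Sufficiency *)

Section Cascade.
Variables (R : realType) (U X Y : completeNormedModType R).
Variables (D : set X) (A : X -> X) (T : R -> X -> X) (B : U -> X) (C : X -> Y).
Hypotheses (hG : generator D A T) (hB : bounded_linear B) (hC : graph_bounded D A C).
Variables (Xs : nat -> set X) (hb : schauder_subspace_basis Xs) (ha : adapted Xs T).
Variable n : nat.
Local Notation tp := (tail_proj_blin hb n).
Local Notation ti := (@tail_proj_idem R X Xs hb n).
Local Notation tincl := (@pincl R X _ tp ti).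
Local Notation tgen := (@rgen R X _ tp ti A).
Local Notation tsg := (@rsg R X _ tp ti T).

Variables (MT bT : R).
Hypotheses (MT0 : 0 < MT) (bT0 : 0 < bT).
Hypothesis HT : forall t (w : tail hb n), 0 <= t -> `|tsg t w| <= MT * expR (- bT * t) * `|w|.

Variables (m : nat) (iota : 'rV[R]_m -> X) (rho : X -> 'rV[R]_m) (Ah : 'M[R]_m).
Hypotheses (bi : bounded_linear iota) (br : bounded_linear rho).
Hypothesis rK : forall c, rho (iota c) = c.
Hypothesis iQ : forall x, iota (rho x) = head_proj hb n x.
Hypothesis Ai : forall c, D (iota c) /\ A (iota c) = iota (c *m Ah).
Hypothesis Ar : forall x, D x -> rho (A x) = rho x *m Ah.

Variables (kap : 'rV[R]_m -> U) (L : Y -> 'rV[R]_m) (AK AL : 'M[R]_m).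
Hypotheses (bkap : bounded_linear kap) (bL : bounded_linear L).
Hypothesis hK : forall c, rho (B (kap c)) = c *m (AK - Ah).
Hypothesis hL : forall c, c *m Ah - L (C (iota c)) = c *m AL.
Hypotheses (vAK : vanishes (expm AK)) (vAL : vanishes (expm AL)).

(** Here [r] is the observation error and [p] its forcing. Along the chain [p], tail of [r], head of
    [r], head of [x], each member is driven by its predecessors with a fixed gain; the loop closes
    through [p], driven by [rho x - rho r] with gain [e]. The tail of [x] is driven by the input and
    feeds nothing back. *)
Lemma cascade : exists Cw Cr b : R, [/\ 0 < Cw, 0 < Cr, 0 < b &
  forall (e : R) (x x' r r' p : R -> X), 0 <= e -> Cw * e <= 2^-1 ->
    is_deriv0 x x' -> (forall t, 0 <= t -> D (x t)) ->
    (forall t, 0 <= t -> x' t = A (x t) + B (kap (rho (x t) - rho (r t)))) ->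
    is_deriv0 r r' -> (forall t, 0 <= t -> D (r t)) ->
    (forall t, 0 <= t -> r' t = A (r t) + (p t - iota (L (C (r t))))) ->
    (forall t, 0 <= t -> rho (p t) = 0) ->
    (forall t, 0 <= t -> `|p t| <= e * `|rho (x t) - rho (r t)|) ->
    forall t, 0 <= t ->
      `|x t| <= Cr * (`|x 0| + `|r 0|) * expR (- b * t) /\
      `|r t| <= Cr * (`|x 0| + `|r 0|) * expR (- b * t)].
Proof.
have tpT t x : 0 <= t -> tail_proj hb n (T t x) = T t (tail_proj hb n x).
  exact: (tail_proj_sg hG hb ha).
have gS := tail_generator hG hb ha n.
pose pj : X -> tail hb n := pproj tp ti.
have bpj : bounded_linear pj by exact: pproj_blin.
have Ptp x : D x -> D (tail_proj hb n x) /\ A (tail_proj hb n x) = tail_proj hb n (A x).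
  exact: (gen_proj tp hG tpT).
have lpi := pincl_lin (bp := tp) (pp := ti).
have split_x x : x = iota (rho x) + tincl (pj x) by rewrite iQ /tail_proj addrC subrK.
have ii c : pj (iota c) = 0.
  apply: pincl_inj; rewrite (lin0 lpi) pincl_proj /tail_proj.
  by have := iQ (iota c); rewrite rK => <-; rewrite subrr.
have Dpj x : D x -> D (tincl (pj x)) by move=> Dx; exact: (Ptp x Dx).1.
have pjA x : D x -> pj (A x) = tgen (pj x).
  by move=> Dx; apply: pincl_inj; rewrite !pincl_proj (Ptp x Dx).2 ti.
have [_ _ hCs] := tail_sys_data hG hB hC hb ha n.
have [Ct [bCt CtE]] := output_factor gS MT0 bT0 HT hCs.
have [MK [bK [MK0 bK0 HK]]] := expm_decay vAK.
have [ML [bLL [ML0 bL0 HL]]] := expm_decay vAL.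
have bLC := blin_comp bL bCt.
pose Lt := L \o Ct; have lLt : is_linear Lt := bLC.1.
have [kp kp0 Hkp] := bounded_linear_bound bpj.
have [kr kr0 Hkr] := bounded_linear_bound br.
have [k1 k10 Hk1] := bounded_linear_bound (blin_comp (mulmxr_blin 1 AL) bLC).
have [k2 k20 Hk2] := bounded_linear_bound bLC.
have [k3 k30 Hk3] := bounded_linear_bound (mulmxr_blin 1 (AK - Ah)).
have [k4 k40 Hk4] := bounded_linear_bound (blin_comp bpj (blin_comp hB bkap)).
have [ki ki0 Hki] := bounded_linear_bound bi.
(* Strictly below the three decay rates, as [forced_decay] requires. Its bound gives [Cz], [Ct'],
   [Cx] and [Cs] their shape: initial value plus forcing divided by the gap to [b]. *)
pose b := Num.min bT (Num.min bK bLL) / 2.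
have mn0 : 0 < Num.min bT (Num.min bK bLL) by rewrite !lt_min bT0 bK0.
have b0 : 0 < b by rewrite divr_gt0.
have bm : b < Num.min bT (Num.min bK bLL) by rewrite /b; lra.
move: bm; rewrite !lt_min => /and3P[bbT bbK bbL].
have iT : 0 < (bT - b)^-1 by rewrite invr_gt0; lra.
have iK : 0 < (bK - b)^-1 by rewrite invr_gt0; lra.
have iL : 0 < (bLL - b)^-1 by rewrite invr_gt0; lra.
pose Cz := MT * (kp + kp / (bT - b)).
pose Ct' := ML * (kr + k2 * kp + (k1 * Cz + k2 * kp) / (bLL - b)).
pose Ce := Ct' + k2 * Cz.
pose Cx := MK * (kr + k3 * Ce / (bK - b)).
pose Cw := Cx + Ce.
pose Cs := MT * (kp + k4 * (2 * Cw) / (bT - b)).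
pose Cr := ki * (2 * Ce) + 2 * Cz + (ki * (2 * Cx) + Cs).
have Cz0 : 0 < Cz by rewrite !(mulr_gt0, addr_gt0).
have Ct0 : 0 < Ct' by rewrite !(mulr_gt0, addr_gt0).
have Ce0 : 0 < Ce by rewrite !(mulr_gt0, addr_gt0).
have Cx0 : 0 < Cx by rewrite !(mulr_gt0, addr_gt0).
have Cw0 : 0 < Cw by rewrite addr_gt0.
have Cs0 : 0 < Cs by rewrite !(mulr_gt0, addr_gt0).
have Cr0 : 0 < Cr by rewrite !(mulr_gt0, addr_gt0).
exists Cw, Cr, b; split=> // e x x' r r' p e0 Cwe dx Dx Hx' dr Dr Hr' rp0 Hp.
pose I := `|x 0| + `|r 0|.
have I0 : 0 <= I by rewrite addr_ge0.
pose w0 t := rho (x t) - rho (r t).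
pose E t := expR (- b * t); have E0 t : 0 < E t by exact: expR_gt0.
have dxh := is_deriv0_lin br dx; have drh := is_deriv0_lin br dr.
have dz := is_deriv0_lin bpj dr; have dxt := is_deriv0_lin bpj dx.
have dLz := is_deriv0_lin bLC dz.
have det := is_deriv0D drh dLz.
(* The head of [r] is driven by [L C] of the tail, which is unbounded in [z]. Since [C] there is
   [Ct] of the generator, this term is [Lt] of the derivative of [z] up to a multiple of [p], and
   adding [Lt z] removes it. *)
pose z t := pj (r t); pose et t := rho (r t) + Lt (z t).
have x0I : `|x 0| <= I by rewrite lerDl.
have r0I : `|r 0| <= I by rewrite lerDr.
have zE t : 0 <= t -> pj (r' t) = tgen (z t) + pj (p t).
  move=> t0; rewrite Hr'// (linD bpj.1) pjA; last exact: Dr.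
  by rewrite (linB bpj.1) ii subr0.
have CrE t : 0 <= t -> L (C (r t)) = L (C (iota (rho (r t)))) + Lt (tgen (z t)).
  move=> t0; rewrite {1}(split_x (r t)) (graph_boundedD hC); [|exact: (Ai _).1|exact/Dpj/Dr].
  rewrite (linD bL.1); congr (_ + _); congr L.
  by rewrite -[RHS]CtE//; exact/Dpj/Dr.
(* One passage around the loop: a bound [d] on [w0] bounds every component by a constant times
   [I + e * d]. *)
have bnd tau d : 0 <= tau -> 0 <= d -> (forall s, 0 <= s -> s <= tau -> `|w0 s| <= d * E s) ->
    forall s, 0 <= s -> s <= tau -> [/\ `|z s| <= Cz * (I + e * d) * E s,
      `|rho (r s)| <= Ce * (I + e * d) * E s & `|rho (x s)| <= Cx * (I + e * d) * E s].
  move=> tau0 d0 Hd; set J := I + e * d.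
  have J0 : 0 <= J by rewrite addr_ge0// mulr_ge0.
  have IJ : I <= J by rewrite lerDl mulr_ge0.
  have dJ : e * d <= J by rewrite lerDr.
  have Hpp s : 0 <= s -> s <= tau -> `|pj (p s)| <= kp * J * E s.
    move=> s0 st; apply: (le_trans (Hkp _)); rewrite -mulrA ler_pM2l//.
    apply: (le_trans (Hp s s0)); apply: (@le_trans _ _ (e * (d * E s))).
      by rewrite ler_wpM2l//; exact: Hd.
    by rewrite mulrA ler_wpM2r// ltW.
  have z0J : `|z 0| <= kp * J.
    by apply: (le_trans (Hkp _)); rewrite ler_pM2l//; exact: le_trans IJ.
  have Hz s : 0 <= s -> s <= tau -> `|z s| <= Cz * J * E s.
    move=> s0 st.
    have := @forced_decay R _ _ _ _ gS MT bT MT0 HT z (fun s => pj (p s)) s (kp * J) b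
      (is_deriv0_cont dz) s0 _ bbT _ _ _.
    move=> /(_ _ _ _ _)/le_trans; apply.
    - by rewrite mulr_ge0// ltW.
    - by move=> q q0; exact/Dpj/Dr.
    - by move=> q q0; have := is_deriv0_rderiv dz q0; rewrite /= zE.
    - by move=> q q0 qs; apply: Hpp => //; lra.
    rewrite -/(E s) ler_pM2r// /Cz -[leRHS]mulrA ler_pM2l// [leRHS]mulrDl lerD//.
    by rewrite mulrAC.
  have Het s : 0 <= s -> s <= tau -> `|et s| <= Ct' * J * E s.
    move=> s0 st.
    have := @forced_decay R _ _ _ _ (expm_generator AL) ML bLL ML0 _ et
      (fun s => - (Lt (z s) *m AL) + Lt (pj (p s))) s ((k1 * Cz + k2 * kp) * J) b
      (is_deriv0_cont det) s0 _ bbL _ _ _.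
    move=> /(_ _ _ _ _ _)/le_trans; apply.
    - by move=> t c t0; exact: HL.
    - by rewrite mulr_ge0// ltW// addr_gt0// mulr_gt0.
    - by [].
    - move=> q q0; have := is_deriv0_rderiv det q0; rewrite /= zE// Hr'//.
      rewrite (linD br.1) (Ar (Dr q q0)) (linB br.1) rp0// rK CrE// sub0r.
      rewrite -[L (Ct _)]/(Lt _) (linD lLt) /et mulmxDl -hL.
      set a1 := rho (r q) *m Ah; set a2 := L _; set a3 := Lt _; set a4 := Lt _; set a5 := Lt _ *m AL.
      by have -> : a1 + - (a2 + a3) + (a3 + a4) = a1 - a2 + a5 + (- a5 + a4) by lmod R.
    - move=> q q0 qs; have qt : q <= tau by lra.
      apply: (le_trans (ler_normD _ _)); rewrite normrN !mulrDl; apply: lerD.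
        by apply: (le_trans (Hk1 _)); rewrite -!mulrA ler_pM2l// !mulrA; exact: Hz.
      by apply: (le_trans (Hk2 _)); rewrite -!mulrA ler_pM2l// mulrA; exact: Hpp.
    rewrite -/(E s) ler_pM2r// /Ct' -[leRHS]mulrA ler_pM2l// [leRHS]mulrDl lerD//; last by rewrite mulrAC.
    rewrite /et; apply: (le_trans (ler_normD _ _)); rewrite mulrDl lerD//.
      by apply: (le_trans (Hkr _)); rewrite ler_pM2l//; exact: le_trans IJ.
    by apply: (le_trans (Hk2 _)); rewrite -mulrA ler_pM2l.
  have Her s : 0 <= s -> s <= tau -> `|rho (r s)| <= Ce * J * E s.
    move=> s0 st; have -> : rho (r s) = et s - Lt (z s) by rewrite /et addrK.
    apply: (le_trans (ler_normB _ _)); rewrite /Ce !mulrDl lerD ?Het//.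
    by apply: (le_trans (Hk2 _)); rewrite -!mulrA ler_pM2l// !mulrA; exact: Hz.
  have Hxr s : 0 <= s -> s <= tau -> `|rho (x s)| <= Cx * J * E s.
    move=> s0 st.
    have := @forced_decay R _ _ _ _ (expm_generator AK) MK bK MK0 _ (rho \o x)
      (fun s => - (rho (r s) *m (AK - Ah))) s (k3 * Ce * J) b
      (is_deriv0_cont dxh) s0 _ bbK _ _ _.
    move=> /(_ _ _ _ _ _)/le_trans; apply.
    - by move=> t c t0; exact: HK.
    - by rewrite !mulr_ge0// ltW.
    - by [].
    - move=> q q0; have := is_deriv0_rderiv dxh q0; rewrite /= Hx'// (linD br.1) (Ar (Dx q q0)) hK.
      suff -> : rho (x q) *m Ah + (rho (x q) - rho (r q)) *m (AK - Ah) =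
        rho (x q) *m AK + - (rho (r q) *m (AK - Ah)) by [].
      by rewrite mulmxBl mulmxBr; lmod R.
    - move=> q q0 qs; rewrite normrN; apply: (le_trans (Hk3 _)).
      by rewrite -!mulrA ler_pM2l// !mulrA; apply: Her => //; lra.
    rewrite -/(E s) ler_pM2r// /Cx -[leRHS]mulrA ler_pM2l// [leRHS]mulrDl lerD//; last by rewrite mulrAC.
    by apply: (le_trans (Hkr _)); rewrite ler_pM2l//; exact: le_trans IJ.
  by move=> s s0 st; split; [exact: Hz|exact: Her|exact: Hxr].
have boot t : 0 <= t -> `|w0 t| <= 2 * Cw * I * E t.
  move=> t0.
  have cw0 : cont0 w0 by exact: (cont0B (is_deriv0_cont dxh) (is_deriv0_cont drh)).
  have [N N0 HN] := cont0_bounded t cw0.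
  pose q := N * expR (b * t).
  have q0 : 0 < q by rewrite mulr_gt0// expR_gt0.
  (* Each passage replaces [d] by [Cw * (I + e * d)], and [Cw * e <= 2^-1] halves the excess over
     [2 * Cw * I]. The initial [q] is a crude bound on [[0, t]]. *)
  have K k s : 0 <= s -> s <= t -> `|w0 s| <= (2 * Cw * I + q * 2^-1 ^+ k) * E s.
    elim: k s => [|k IH] s s0 st.
      rewrite expr0 mulr1; apply: (@le_trans _ _ (q * E s)).
        apply: (le_trans (HN s s0 st)); rewrite /q /E -mulrA -expRD -[leLHS]mulr1 ler_pM2l//.
        by rewrite -expR0 ler_expR mulNr subr_ge0 ler_pM2l.
      by rewrite ler_wpM2r ?(ltW (E0 s))// lerDr !mulr_ge0// ltW.
    set d := 2 * Cw * I + q * 2^-1 ^+ k.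
    have d0 : 0 <= d by rewrite addr_ge0// !mulr_ge0// ?exprn_ge0// ltW.
    have [_ h1 h2] := bnd t d t0 d0 IH s s0 st.
    apply: (le_trans (ler_normB _ _)).
    apply: (@le_trans _ _ (Cw * (I + e * d) * E s)).
      by rewrite /Cw !mulrDl; move: h1 h2; rewrite !mulrDr !mulrDl; lra.
    rewrite ler_wpM2r ?(ltW (E0 s))// exprS.
    have : Cw * e * d <= 2^-1 * d by rewrite ler_wpM2r.
    by rewrite /d; move: (2^-1 ^+ k) => u; lra.
  apply/ler_addgt0Pr => d d0.
  have [k h] := geometric_small (ltW (mulr_gt0 q0 (E0 t))) d0.
  by apply: (le_trans (K k t t0 (lexx _))); rewrite mulrDl lerD2l; lra.
have fin t : 0 <= t -> [/\ `|z t| <= 2 * Cz * I * E t,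
      `|rho (r t)| <= 2 * Ce * I * E t & `|rho (x t)| <= 2 * Cx * I * E t].
  move=> t0.
  have d0 : 0 <= 2 * Cw * I by rewrite !mulr_ge0// ltW.
  have [h1 h2 h3] := bnd t (2 * Cw * I) t0 d0 (fun s s0 _ => boot s s0) t t0 (lexx _).
  have J2 : I + e * (2 * Cw * I) <= 2 * I.
    have : Cw * e * I <= 2^-1 * I by rewrite ler_wpM2r.
    lra.
  have up (c : R) : 0 < c -> c * (I + e * (2 * Cw * I)) * E t <= 2 * c * I * E t.
    by move=> c0; rewrite ler_pM2r// (mulrC 2 c) -[leRHS]mulrA ler_pM2l.
  split; [exact: le_trans h1 (up _ Cz0)|exact: le_trans h2 (up _ Ce0)|exact: le_trans h3 (up _ Cx0)].
have xt t : 0 <= t -> `|pj (x t)| <= Cs * I * E t.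
  move=> t0.
  have := @forced_decay R _ _ _ _ gS MT bT MT0 HT (pj \o x) (fun s => pj (B (kap (w0 s)))) t (k4 * (2 * Cw) * I) b
    (is_deriv0_cont dxt) t0 _ bbT _ _ _.
  move=> /(_ _ _ _ _)/le_trans; apply.
  - by rewrite !mulr_ge0// ltW// mulr_gt0.
  - by move=> q q0; exact/Dpj/Dx.
  - by move=> q q0; have := is_deriv0_rderiv dxt q0; rewrite /= Hx'// (linD bpj.1) (pjA _ (Dx q q0)).
  - move=> q q0 qs; apply: (le_trans (Hk4 _)); rewrite -!mulrA ler_pM2l// !mulrA; exact: boot.
  rewrite -/(E t) ler_pM2r// /Cs -[leRHS]mulrA ler_pM2l// [leRHS]mulrDl lerD//; last by rewrite mulrAC.
  by apply: (le_trans (Hkp _)); rewrite ler_pM2l.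
move=> t t0; have [h1 h2 h3] := fin t t0; have h4 := xt t t0.
have nI (w : tail hb n) : `|tincl w| = `|w| by [].
have c2 (c : R) : 0 < c -> 0 < 2 * c by move=> c0; rewrite mulr_gt0.
have IE : 0 <= I * E t by rewrite mulr_ge0// ltW.
rewrite -/I -/(E t); split.
  rewrite (split_x (x t)); apply: (le_trans (ler_normD _ _)); rewrite nI.
  have k : `|iota (rho (x t))| <= ki * (2 * Cx * I * E t).
    by apply: (le_trans (Hki _)); rewrite ler_pM2l.
  have : 0 <= (ki * (2 * Ce) + 2 * Cz) * (I * E t).
    by rewrite mulr_ge0// ltW// (addr_gt0 (mulr_gt0 ki0 (c2 _ Ce0)) (c2 _ Cz0)).
  by move: k h4; rewrite /Cr; lra.
rewrite (split_x (r t)); apply: (le_trans (ler_normD _ _)); rewrite nI.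
have k : `|iota (rho (r t))| <= ki * (2 * Ce * I * E t).
  by apply: (le_trans (Hki _)); rewrite ler_pM2l.
have : 0 <= (ki * (2 * Cx) + Cs) * (I * E t).
  by rewrite mulr_ge0// ltW// (addr_gt0 (mulr_gt0 ki0 (c2 _ Cx0)) Cs0).
by move: k h1; rewrite /Cr /z; lra.
Qed.

End Cascade.

Section TailDecay.
Variables (R : realType) (U X Y : completeNormedModType R).
Variables (D : set X) (A : X -> X) (T : R -> X -> X) (B : U -> X) (C : X -> Y).
Hypotheses (hG : generator D A T) (hB : bounded_linear B) (hC : graph_bounded D A C).
Variables (Xs : nat -> set X) (hb : schauder_subspace_basis Xs) (ha : adapted Xs T).

(** An orbit is [psi] of its unstable and stable components. The stable one decays; the unstable one
    may grow, but [psi] embeds it from a finite-dimensional space, so its tail is small. The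
    isomorphism is given on trajectories, hence the passage through [sys_free_orbit]. *)
Lemma tail_stable_of_finite_unstable_part : finite_unstable_part (Sys D A B C) ->
  exists n M b, [/\ 0 < M, 0 < b & forall t (w : tail hb n), 0 <= t ->
    `|@rsg _ _ _ (tail_proj_blin hb n) (tail_proj_idem hb n) T t w| <= M * expR (- b * t) * `|w|].
Proof.
move=> [Xu [Xst [Du [Au [Bu [Cu [Ds [As [Bs [Cs [fXu hSu hSs hst]]]]]]]]]]].
move=> [phi [[bphi [psi [cpsi [phiK psiK]]]] Hphi]].
have [[Tu hGu] hBu _] := hSu; have [b [b0 [Ms HMs]]] := hst.
have lpsi : is_linear psi by move=> a u v; rewrite -[RHS]phiK bphi.1 !psiK.
have [kf kf0 Hkf] := bounded_linear_bound bphi.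
have [kg kg0 Hkg] := bounded_linear_bound (conj lpsi cpsi).
have [c c0 Hc] := head_proj_bound hb.
have [M1 [w1 [M11 w10 HT]]] := sg_growth hGu.1.
have M1p : 0 < M1 by exact: lt_le_trans M11.
have nE (u : Xu) (v : Xst) : `|(u, v)| = Num.max `|u| `|v| by [].
apply: (@tail_stable R X D A T Xs hG hb ha ((1 + c) * kg * `|Ms| * kf) b
    (fun t => M1 * expR (w1 * t) * kf) b0) => e e0.
have lf : is_linear (fun v : Xu => psi (v, 0)).
  by move=> a u v; rewrite -lpsi; congr psi; congr pair; rewrite /= scaler0 addr0.
have [N HN] := tail_proj_small hb fXu lf e0.
exists N => t x0 t0 Qx0 [k Qk].
have Dx0 : D x0 by exact: (head_domain hG ha Qk).
have [y1 [y2 [S1 [S2 _]]]] := (Hphi _ _ _).1 (sys_free_orbit hG hC hB Dx0).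
have h1 := sys_free hGu hBu S1 t0; have h2 := HMs _ _ S2 t t0.
move: h1 h2; rewrite /= (sg0 hG.1).
set p := phi (T t x0); set p0 := phi x0 => h1 h2.
have p0E : `|p0.1| <= kf * `|x0| /\ `|p0.2| <= kf * `|x0|.
  by apply/andP; have := Hkf x0; rewrite -/p0 (surjective_pairing p0) nE ge_max.
(* An orbit starting in the tail equals its own tail, so the tail projection may be applied to both
   components. *)
have -> : T t x0 = tail_proj hb N (psi (p.1, 0)) + tail_proj hb N (psi (0, p.2)).
  rewrite -(linD (tail_proj_blin hb N).1) -(linD lpsi).
  have -> : (p.1, 0) + (0, p.2) = p by rewrite (surjective_pairing p); congr pair; rewrite /= ?addr0 ?add0r.
  by rewrite phiK (tail_proj_sg hG hb ha)// /tail_proj Qx0 subr0.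
apply: (le_trans (ler_normD _ _)); rewrite addrC mulrDl; apply: lerD.
  apply: (@le_trans _ _ ((1 + c) * (kg * `|p.2|))).
    apply: (@le_trans _ _ ((1 + c) * `|psi (0, p.2)|)).
      by rewrite /tail_proj mulrDl mul1r; apply: (le_trans (ler_normB _ _)); rewrite lerD2l.
    rewrite ler_wpM2l ?addr_ge0 ?(ltW c0)//; apply: (le_trans (Hkg _)).
    by rewrite nE normr0 max_r.
  rewrite -!mulrA ler_wpM2l ?addr_ge0 ?(ltW c0)// ler_pM2l//.
  apply: (le_trans h2); rewrite -mulrA.
  apply: (@le_trans _ _ (`|Ms| * (expR (- b * t) * `|p0.2|))).
    by rewrite ler_wpM2r ?mulr_ge0 ?expR_ge0// ler_norm.
  rewrite ler_wpM2l// [leRHS]mulrCA ler_wpM2l ?expR_ge0//; exact: p0E.2.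
apply: (le_trans (HN N p.1 (leqnn _))); rewrite -[leRHS]mulrA ler_pM2l// h1.
apply: (le_trans (HT _ _ t0)); rewrite -[leRHS]mulrA ler_wpM2l//; last exact: p0E.1.
by rewrite mulr_ge0 ?expR_ge0// ltW.
Qed.

End TailDecay.

Lemma rV_findim (R : realType) m : findim 'rV[R]_m.
Proof.
by exists m, (fun j => delta_mx 0 j) => x; split=> // _; exists (x 0); exact: row_sum_delta.
Qed.

(** * Feedback and observer gains on the head *)

Section HeadDesign.
Variables (R : realType) (U X Y : completeNormedModType R).
Variables (D : set X) (A : X -> X) (T : R -> X -> X) (B : U -> X) (C : X -> Y).
Hypotheses (hG : generator D A T) (hB : bounded_linear B) (hC : graph_bounded D A C).
Variables (m : nat) (iota : 'rV[R]_m -> X) (rho : X -> 'rV[R]_m) (Ah : 'M[R]_m).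
Hypotheses (bi : bounded_linear iota) (br : bounded_linear rho).
Hypothesis rK : forall c, rho (iota c) = c.
Hypothesis Ai : forall c, D (iota c) /\ A (iota c) = iota (c *m Ah).
Hypothesis Ar : forall x, D x -> rho (A x) = rho x *m Ah.

(** [U] may be infinite-dimensional, so the input matrix is [N], whose rows span the range of
    [rho B] and have preimages [u i]. A quotient [q] annihilating [N] is not reached by inputs, so
    it decays along the trajectories given by stabilizability; their initial heads are dense, and
    the rows with decay form a subspace, hence the whole space. *)
Lemma head_feedback : stabilizable (Sys D A B C) ->
  exists (kap : 'rV[R]_m -> U) (AK : 'M[R]_m), [/\ bounded_linear kap,
    forall c, rho (B (kap c)) = c *m (AK - Ah) & vanishes (expm AK)].
Proof.
move=> hst; have lrB : is_linear (fun u => rho (B u)) := (blin_comp br hB).1.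
have [||N HN] := @linear_set_rowspace _ m [set c | exists u, c = rho (B u)].
- by exists 0; rewrite (lin0 lrB).
- by move=> a _ _ [u ->] [v ->]; exists (a *: u + v); rewrite lrB.
have /choice[u Hu] : forall i, exists u, row i N = rho (B u).
  by move=> i; apply/HN; exact: row_sub.
pose J (c : 'rV[R]_m) := \sum_i c 0 i *: u i.
have lJ : is_linear J.
  move=> a v w; rewrite /J scaler_sumr -big_split; apply: eq_bigr => i _ /=.
  by rewrite !mxE scalerDl scalerA.
have JN c : rho (B (J c)) = c *m N.
  rewrite mulmx_sum_row /J (lin_sum lrB); apply: eq_bigr => i _.
  by rewrite (linZ lrB) -Hu.
have [K HK] : exists K : 'M[R]_(m, m), vanishes (expm (Ah + K *m N)).
  apply: stabilizing_feedback => q A' Aq Nq; apply: vanishes_rows => i.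
  set P := fun t => expm Ah t *m q.
  suff H (c : 'rV[R]_m) : vanishes (fun t => c *m P t).
    by apply: (@vanishes_ext _ _ _ _ _ (H (delta_mx 0 i))) => t _ /=; rewrite -rowE.
  apply: (@findim_dense_full _ 'rV[R]_m [set d | vanishes (fun t => d *m P t)]) => [||a d f vd vf|v e e0].
  - exact: rV_findim.
  - by move=> e e0; exists 0 => // t _; rewrite mul0mx normr0 ltW.
  - apply: (@vanishes_ext _ _ (fun t => (a *: (d *m P t)) + f *m P t)).
      by move=> t _; rewrite mulmxDl scalemxAl.
    apply: vanishesD => //; apply: (@vanishes_lin _ _ _ ( *:%R a) _ _ vd); exact: blinZ (blin_id _).
  - have [k k0 Hk] := bounded_linear_bound br.
    have ek : 0 < e / k by rewrite divr_gt0.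
    have [z [zb [w [x [y [Sx [vx zE]]]]]]] :=
      hst _ (ex_intro _ _ (ballxx (iota v) ek)) (ball_open (iota v) (e / k)).
    exists (rho z); last first.
      rewrite -[v in v - _]rK -(linB br.1); apply: (le_trans (Hk _)).
      have : ball (iota v) (e / k) z := zb; rewrite -ball_normE /= => {}zb; rewrite mulrC -ler_pdivlMr//; exact: ltW.
    case: Sx => _ [Dx [cx _]] [x' [cx' [dx Hx']]] _ _.
    have bq := mulmxr_blin 1 q.
    have dz := is_deriv0_lin (blin_comp bq br) dx.
    apply: (@vanishes_ext _ _ (fun t => rho (x t) *m q)).
      move=> t t0; rewrite /= zE /P (expm_intertwine Aq t0) mulmxA.
      apply: (@expm_unique _ _ _ A' (fun t => rho (x t) *m q)) => //.
      apply: (@is_deriv0_ext _ _ _ _ _ _ _ _ dz) => // s s0 /=.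
      rewrite Hx'// (linD br.1) (Ar (Dx s s0)) mulmxDl -!mulmxA Aq.
      have /HN/submxP[M ->] : exists u, rho (B (w s)) = rho (B u) by exists (w s).
      by rewrite -mulmxA Nq mulmx0 addr0.
    exact: (vanishes_lin (blin_comp bq br) ((cvg_norm_vanishes _).1 vx)).
exists (fun c => J (c *m K)), (Ah + K *m N); split=> //.
  by apply: rV_linear_bounded => a c d; rewrite mulmxDl -scalemxAl lJ.
by move=> c; rewrite JN addrAC subrr add0r mulmxA.
Qed.

(** Dual to the feedback by transposition, with the outputs of the head read in coordinates through
    a bounded left inverse on [Y]. A direction with zero output gives an unobserved trajectory of
    the whole system, which decays by detectability. *)
Lemma head_observer : detectable (Sys D A B C) ->
  exists (L : Y -> 'rV[R]_m) (AL : 'M[R]_m), [/\ bounded_linear L,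
    forall c, c *m Ah - L (C (iota c)) = c *m AL & vanishes (expm AL)].
Proof.
move=> hdt.
pose Ch c := C (iota c).
have lCh : is_linear Ch by move=> a c d; rewrite /Ch bi.1; apply: hC.1; [exact: (Ai _).1|exact: (Ai _).1].
have [p [f [lf inj Hf]]] : exists p (f : 'rV[R]_p -> Y), [/\ is_linear f, forall x, f x = 0 -> x = 0 &
    forall y, (exists c, y = Ch c) <-> exists x, y = f x].
  apply: (@findim_sub_param _ _ [set y | exists c, y = Ch c]).
  exists m, (fun i => Ch (delta_mx 0 i)) => y; split=> [[c ->]|[c ->]].
    exists (c 0); rewrite {1}[c]row_sum_delta (lin_sum lCh); apply: eq_bigr => i _.
    by rewrite (linZ lCh).
  exists (\sum_i c i *: delta_mx 0 i); rewrite (lin_sum lCh).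
  by apply: eq_bigr => i _; rewrite (linZ lCh).
have [pinv [bp pK]] := findim_left_inverse lf inj.
pose Cm : 'M[R]_(m, p) := \matrix_i pinv (Ch (delta_mx 0 i)).
have pCh c : pinv (Ch c) = c *m Cm.
  rewrite {1}[c]row_sum_delta (lin_sum lCh) (lin_sum bp.1) mulmx_sum_row.
  by apply: eq_bigr => i _; rewrite (linZ lCh) (linZ bp.1) rowK.
have ChE c : Ch c = f (c *m Cm).
  by have /Hf[x xE] : exists d, Ch c = Ch d; [by exists c|rewrite -pCh xE pK].
have [K HK] : exists K : 'M[R]_(m, p), vanishes (expm (Ah^T + K *m Cm^T)).
  apply: stabilizing_feedback => q A' Aq Cq.
  have hq t : 0 <= t -> (expm Ah^T t *m q)^T = q^T *m expm Ah t.
    by move=> t0; rewrite trmx_mul expm_tr// trmxK.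
  apply: (@vanishes_ext _ _ (fun t => (q^T *m expm Ah t)^T)).
    by move=> t t0; rewrite -hq// trmxK.
  suff v : vanishes (fun t => q^T *m expm Ah t) by exact: (vanishes_lin (trmx_blin R m m) v).
  apply: vanishes_rows => i; set c := row i q^T.
  apply: (@vanishes_ext _ _ (fun t => c *m expm Ah t)).
    by move=> t t0; rewrite row_mul.
  pose x t := iota (c *m expm Ah t).
  have bx := blin_comp bi (mulmxl_blin m c).
  have dx := is_deriv0_lin bx (expm_deriv Ah).
  have cx := is_deriv0_cont dx.
  have cdx : cont0 (fun t => iota (c *m (expm Ah t *m Ah))).
    by apply: (cont0_comp (is_deriv0_cont (expm_deriv Ah)) (blin_comp bx (mulmxr_blin _ Ah)).2).
  have cCm t : 0 <= t -> c *m expm Ah t *m Cm = 0.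
    move=> t0; rewrite -!row_mul -hq// (expm_intertwine Aq t0) -[Cm]trmxK -trmx_mul mulmxA Cq.
    by rewrite mul0mx trmx0 row0.
  have /hdt/cvg_norm_vanishes vx : Sys D A B C (fun _ => 0, x, fun _ => 0).
    split=> //.
    - exact: cont0_cst.
    - split; first by move=> t _; exact: (Ai _).1.
      by split=> //; apply: cont0_ext cdx => t _; rewrite (Ai _).2 mulmxA.
    - exists (fun t => iota (c *m (expm Ah t *m Ah))); split=> //; split=> // t _.
      by rewrite (Ai _).2 (lin0 hB.1) addr0 mulmxA.
    - exact: cont0_cst.
    - by move=> t t0; rewrite /x -/(Ch _) ChE cCm// (lin0 lf).
  by apply: (@vanishes_ext _ _ _ _ _ (vanishes_lin br vx)) => t _ /=; exact: rK.
exists (fun y => - (pinv y *m K^T)), (Ah^T + K *m Cm^T)^T; split.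
- exact: (blinN (blin_comp (mulmxr_blin 1 K^T) bp)).
- by move=> c; rewrite pCh opprK raddfD /= trmxK trmx_mul trmxK mulmxDr mulmxA.
- apply: (@vanishes_ext _ _ _ _ _ (vanishes_lin (trmx_blin R m m) HK)) => t t0 /=.
  by rewrite expm_tr.
Qed.

End HeadDesign.

(** * The compensator *)

Section Sufficiency.
Variables (R : realType) (U X Y : completeNormedModType R).
Variables (D : set X) (A : X -> X) (T : R -> X -> X) (B : U -> X) (C : X -> Y).
Hypotheses (hG : generator D A T) (hB : bounded_linear B) (hC : graph_bounded D A C).
Variables (Xs : nat -> set X) (hb : schauder_subspace_basis Xs) (ha : adapted Xs T).

(** The order of choices matters: the gains, and with them [Cw], depend on [n0] only, so the
    threshold [e] is available before [n] is chosen. The observation error [r = x - iota1 w] then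
    satisfies the equation in [cascade]. *)
Lemma closed_loop_of_stabilizable : stabilizable (Sys D A B C) -> detectable (Sys D A B C) ->
  finite_unstable_part (Sys D A B C) ->
  exists (W : completeNormedModType R) (DE : set W) (E : W -> W) (F : Y -> W) (G : W -> U),
     [/\ findim W, sys_data DE E F G
       & exp_stable (Close (comp_rel (Sys D A B C) (Sys DE E F G)))].
Proof.
move=> hst hdt hfu.
have [n0 [MT [bT [MT0 bT0 HT]]]] := tail_stable_of_finite_unstable_part hG hB hC hb ha hfu.
have [m [iota [rho [Ah [bi br rK iQ [Ai Ar]]]]]] := head_matrix hG hb ha n0.
have [kap [AK [bkap hK vAK]]] := head_feedback hB br rK Ar hst.
have [L [AL [bL hL vAL]]] := head_observer hB hC bi br rK Ai hdt.
have [Cw [Cr [b [Cw0 Cr0 b0 main]]]] := cascade hG hB hC ha MT0 bT0 HT bi br rK iQ Ai Ar bkap bL hK hL vAK vAL.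
pose e := (2 * Cw)^-1.
have e0 : 0 < e by rewrite invr_gt0 mulr_gt0.
have Cwe : Cw * e <= 2^-1 by rewrite /e invfM mulrCA divff ?mulr1 ?gt_eqF.
have bBk := blin_comp hB bkap.
have [N HN] := tail_proj_small hb (rV_findim R m) bBk.1 e0.
pose n := maxn N n0.
have nN : (N <= n)%N by exact: leq_maxl.
have nn0 : (n0 <= n)%N by exact: leq_maxr.
have [m1 [iota1 [rho1 [An [bi1 br1 rK1 iQ1 [Ai1 Ar1]]]]]] := head_matrix hG hb ha n.
have bC1 : bounded_linear (C \o iota1).
  apply: rV_linear_bounded => a c d /=.
  by rewrite bi1.1; apply: hC.1; [exact: (Ai1 _).1|exact: (Ai1 _).1].
pose G := kap \o (rho \o iota1).
pose F := rho1 \o (iota \o L).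
(* A copy of the plant on the range of [Q n] under its own input [G w]. Together with the controller
   input [F y] the last term forms the correction by the output error. *)
pose E w := (w *m An + rho1 (B (G w))) + - F (C (iota1 w)).
have bG : bounded_linear G by exact: (blin_comp bkap (blin_comp br bi1)).
have bF : bounded_linear F by exact: (blin_comp br1 (blin_comp bi bL)).
have bE : bounded_linear E.
  apply: (blinD (blinD (mulmxr_blin 1 An) (blin_comp br1 (blin_comp hB bG))) (blinN (blin_comp bF bC1))).
have [TE gE] := bounded_generator bE.
exists 'rV[R]_m1, setT, E, F, G; split.
- exact: rV_findim.
- split=> //; first by exists TE.
  split; first by move=> a u v _ _; exact: bG.1.
  have [k k0 Hk] := bounded_linear_bound bG.
  by exists k => w _; apply: (le_trans (Hk w)); rewrite ler_pM2l// lerDl.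
have [ki ki0 Hki] := bounded_linear_bound bi1.
have [kr kr0 Hkr] := bounded_linear_bound br1.
(* The initial error is at most [1 + ki] times the initial pair, and [w] is recovered as
   [rho1 (x - r)], which costs [2 * kr]. *)
exists b; split=> //; exists ((1 + 2 * kr) * Cr * (2 + ki)).
move=> xw _ [_ [_ [v [y1 [S1 S2]]]]] t t0.
case: S1 => _ [Dx _] [x' [cx' [dx Hx']]] _ Hy.
case: S2 => _ _ [w' [cw' [dw Hw']]] _ Hv.
pose x s := (xw s).1; pose w s := (xw s).2.
rewrite -/x in dx; rewrite -/w in dw.
have dwh := is_deriv0_lin bi1 dw.
pose r s := x s - iota1 (w s).
have dr := is_deriv0B dx dwh.
have rrE s : rho (x s) - rho (r s) = rho (iota1 (w s)).
  by rewrite -(linB br.1) /r subKr.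
(* This identity and the next use [n0 <= n]: the injected correction stays in the range of [Q n],
   and [rho] does not see what [Q n] removes. *)
have Qi c : head_proj hb n (iota c) = iota c.
  have [_] := head_proj_comp hb (iota c) nn0; rewrite -iQ rK; exact.
have rQ z : rho (head_proj hb n z) = rho z.
  rewrite -[LHS]rK -[RHS]rK !iQ; congr rho.
  by have [-> _] := head_proj_comp hb z nn0.
have [|||||h1 h2] := main e x x' r _ (fun s => tail_proj hb n (B (v s))) (ltW e0) Cwe dx Dx _ dr _ _ _ _ t t0.
- by move=> s s0; rewrite rrE Hx'// Hv.
- by move=> s s0; exact: (genB hG (Dx s s0) (Ai1 _).1).1.
- move=> s s0; rewrite /= Hx'// Hw'// Hy// /r (genB hG (Dx s s0) (Ai1 _).1).2.
  rewrite (graph_boundedB hC (Dx s s0) (Ai1 _).1) (linB bL.1) (linB bi.1) /E /F /=.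
  rewrite !(linD bi1.1) (linN bi1.1) !iQ1 !Qi -(Ai1 _).2 /tail_proj -/(w s) -Hv//.
  by lmod R.
- by move=> s s0; rewrite (linB br.1) rQ subrr.
- by move=> s s0; rewrite rrE Hv//; exact: HN.
pose M := Num.max `|x 0| `|w 0|.
have nE (a : X) (c : 'rV[R]_m1) : `|(a, c)| = Num.max `|a| `|c| by [].
have xM : `|x 0| <= M by rewrite le_max lexx.
have wM : `|w 0| <= M by rewrite le_max lexx orbT.
have M0 : 0 <= M by exact: le_trans xM.
have rM : `|r 0| <= (1 + ki) * M.
  apply: (le_trans (ler_normB _ _)); rewrite mulrDl mul1r lerD//.
  by apply: (le_trans (Hki _)); rewrite ler_pM2l.
pose H := Cr * (`|x 0| + `|r 0|) * expR (- b * t).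
have HM : H <= Cr * ((2 + ki) * M) * expR (- b * t).
  rewrite ler_wpM2r ?expR_ge0// ler_pM2l//; lra.
have H0 : 0 <= H by exact: le_trans h1.
have wH : `|w t| <= 2 * kr * H.
  rewrite -[w t]rK1; apply: (le_trans (Hkr _)).
  have : `|iota1 (w t)| <= 2 * H.
    have -> : iota1 (w t) = x t - r t by rewrite /r subKr.
    apply: (le_trans (ler_normB _ _)); rewrite -/H in h1 h2; lra.
  by move=> h; rewrite (mulrC 2) -mulrA ler_pM2l.
have kH : 0 <= 2 * kr * H by rewrite !mulr_ge0// ltW.
rewrite (surjective_pairing (xw t)) (surjective_pairing (xw 0)) !nE -/(x t) -/(w t) -/(x 0) -/(w 0) -/M.
apply: (@le_trans _ _ ((1 + 2 * kr) * H)).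
  by rewrite mulrDl mul1r ge_max; apply/andP; split; rewrite -/H in h1; lra.
have -> : (1 + 2 * kr) * Cr * (2 + ki) * expR (- b * t) * M =
  (1 + 2 * kr) * (Cr * ((2 + ki) * M) * expR (- b * t)) by ring.
by rewrite ler_pM2l// addr_gt0// mulr_gt0.
Qed.

End Sufficiency.

Theorem theorem4p2 (R : realType) (U X Y : completeNormedModType R)
    (D : set X) (A : X -> X) (T : R -> X -> X) (B : U -> X) (C : X -> Y)
    (hA : generator D A T) (hB : bounded_linear B) (hC : graph_bounded D A C)
    (Xs : nat -> set X) (hbasis : schauder_subspace_basis Xs)
    (hadapt : adapted Xs T) :
  (exists (W : completeNormedModType R) (DE : set W) (E : W -> W)
          (F : Y -> W) (G : W -> U),
     [/\ findim W, sys_data DE E F G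
       & exp_stable (Close (comp_rel (Sys D A B C) (Sys DE E F G)))])
  <->
  [/\ stabilizable (Sys D A B C), detectable (Sys D A B C)
    & finite_unstable_part (Sys D A B C)].
Proof.
split=> [[W [DE [E [F [G [fW hE hst]]]]]]|[hst hdt hfu]].
  split.
  - exact: (stabilizable_of_closed_loop hA hB hC hbasis hadapt fW hE hst).
  - exact: (detectable_of_closed_loop fW hE hst).
  - exact: (finite_unstable_part_of_closed_loop hA hB hC hbasis hadapt fW hE hst).
exact: (closed_loop_of_stabilizable hA hB hC hbasis hadapt hst hdt hfu).
Qed.
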